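(* Let $N$ be a free abelian group of finite rank with a homomorphism $\psi:N\to\mathbb{Z}^2$ with finite cokernel, $K=\ker\psi$. Let $\mathbf{s}=\{e_i\}_{i\in I}$ and $\mathbf{s}'=\{e'_j\}_{j\in J}$ be seeds of $q$-Painlevé type in $N$, with mutation equivalence classes $\mathscr{S}$ and $\mathscr{S}'$, and assume $(K,(-,-)_{\mathscr{S}})$ and $(K,(-,-)_{\mathscr{S}'})$ are isometric. Then there exist a finite sequence of seed mutations $\mu$ and $g\in SL(2,\mathbb{Z})$ such that $\psi(\mathbf{s}')=g\circ\psi(\mu(\mathbf{s}))$ (as multisets of vectors in $\mathbb{Z}^2$).
   Context: For $a,b\in N$ set $\langle a,b\rangle=\det(\psi(a),\psi(b))$. A seed is an unordered basis $\{e_i\}_{i\in I}$ of $N$ with each $\psi(e_i)$ nonzero primitive. The mutation $\mu_j^\epsilon$ ($\epsilon\in\{\pm\}$) sends $e_j\mapsto -e_j$ and $e_i\mapsto e_i+[\epsilon\langle e_i,e_j\rangle]_+e_j$ for $i\neq j$, with $[a]_+=\max(0,a)$; mutation equivalence is the equivalence relation generated by mutations. Intersection form: given a seed $\mathbf{s}=\{e_i\}$, choose a smooth complete fan containing the rays $\mathbb{R}_{\ge 0}\psi(e_i)$ with toric surface $\overline{Y}$, toric divisors $\overline{D}_\rho$, let $\overline{D}_i$ be the divisor of the ray of $\psi(e_i)$, blow up distinct points $p_i\in\overline{D}_i$ which are smooth points of the toric boundary to get $\pi:Y\to\overline{Y}$ with exceptional curves $E_i$. For $a=\sum a_ie_i\in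 K$ let $\iota_\pi(a)=\pi^*C_a-\sum a_iE_i$, where $C_a\in NS(\overline{Y})$ is the unique class with $C_a\cdot\overline{D}_\rho=\sum_{i:\overline{D}_i=\overline{D}_\rho}a_i$ for all rays $\rho$. Then $(a,b)_{\mathscr{S}}:=\iota_\pi(a)\cdot\iota_\pi(b)$ (intersection on $Y$) is a symmetric bilinear form on $K$ depending only on the mutation class $\mathscr{S}$ of $\mathbf{s}$. A seed (or its class) is of $q$-Painlevé type if $(-,-)_{\mathscr{S}}$ is negative semi-definite but not negative definite. *)

(* Defs.v *)
From HB Require Import structures.
From mathcomp Require Import all_boot all_order all_algebra.
Set Implicit Arguments. Unset Strict Implicit. Unset Printing Implicit Defensive.
Import Order.TTheory GRing.Theory Num.Theory.
Local Open Scope ring_scope.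

(* The lattice N is modelled as Z^r = 'cV[int]_r; psi : N -> Z^2 is the
   integer 2 x r matrix P (psi a = P *m a); Z^2 = 'cV[int]_2. *)
Notation Z2 := 'cV[int]_2.

Definition x0 (v : Z2) : int := v ord0 ord0.
Definition x1 (v : Z2) : int := v ord_max ord0.

Definition det2 (v w : Z2) : int := x0 v * x1 w - x1 v * x0 w.

Definition primitive (v : Z2) : Prop := gcdz (x0 v) (x1 v) = 1.

Definition finite_coker (r : nat) (P : 'M[int]_(2, r)) : Prop :=
  exists L : seq Z2, forall x : Z2, exists2 y, y \in L &
    exists n : 'cV[int]_r, x - y = P *m n.

Definition inK (r : nat) (P : 'M[int]_(2, r)) (a : 'cV[int]_r) : Prop :=
  P *m a = 0.

Definition pairing (r : nat) (P : 'M[int]_(2, r)) (a b : 'cV[int]_r) : int :=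
  det2 (P *m a) (P *m b).

(* A seed is represented by the r x r integer matrix E whose columns are
   the basis vectors e_i (i : 'I_r). *)
Definition is_seed (r : nat) (P : 'M[int]_(2, r)) (E : 'M[int]_r) : Prop :=
  \det E \is a GRing.unit /\ forall i : 'I_r, primitive (P *m col i E).

Definition mutate (r : nat) (P : 'M[int]_(2, r)) (E : 'M[int]_r) (j : 'I_r)
  (eps : bool) : 'M[int]_r :=
  \matrix_(k, i) (if i == j then - E k j
                  else E k i + Num.max 0 ((if eps then 1 else -1) *
                                   pairing P (col i E) (col j E)) * E k j).

Inductive mut_reach (r : nat) (P : 'M[int]_(2, r)) (E : 'M[int]_r) :
  'M[int]_r -> Prop :=
| mut_refl : mut_reach P E E
| mut_step : forall E' (j : 'I_r) (eps : bool),
    mut_reach P E E' -> mut_reach P E (mutate P E' j eps).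

(* A fan is given by its rays listed cyclically counterclockwise. *)
Definition ray (vs : seq Z2) (k : nat) : Z2 := nth 0 vs (k %% size vs).

Definition smooth_complete_fan (vs : seq Z2) : Prop :=
  [/\ (0 < size vs)%N, uniq vs,
      (forall k, (k < size vs)%N -> det2 (ray vs k) (ray vs k.+1) = 1) &
      (* no ray lies in the interior of a cone: the cones wind once *)
      (forall j k, (j < size vs)%N -> (k < size vs)%N ->
         ~ (0 < det2 (ray vs k) (ray vs j) /\ 0 < det2 (ray vs j) (ray vs k.+1)))].

(* intersection number D_j . D_k of toric divisors (j, k < size vs);
   D_k^2 = -a_k where v_{k-1} + v_{k+1} = a_k v_k, i.e. a_k = det(v_{k-1},v_{k+1}) *)
Definition tdiv_int (vs : seq Z2) (j k : nat) : int :=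
  if j == k then - det2 (ray vs (k + size vs).-1) (ray vs k.+1)
  else if (j == k.+1 %% size vs)%N || (k == j.+1 %% size vs)%N then 1 else 0.

(* C_a . D_k = sum of a_i over i with psi(e_i) on the k-th ray *)
Definition degv (r : nat) (P : 'M[int]_(2, r)) (E : 'M[int]_r) (vs : seq Z2)
  (alpha : 'cV[int]_r) (k : nat) : int :=
  \sum_(i < r | P *m col i E == nth 0 vs k) alpha i ord0.

(* c represents C_a = sum_j c_j D_j in NS(Ybar) *)
Definition Crel (r : nat) (P : 'M[int]_(2, r)) (E : 'M[int]_r) (vs : seq Z2)
  (alpha : 'cV[int]_r) (c : nat -> int) : Prop :=
  forall k, (k < size vs)%N ->
    \sum_(j < size vs) c j * tdiv_int vs j k = degv P E vs alpha k.

(* iota(a).iota(b) = C_a.C_b - sum_i a_i b_i *)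
Definition form_val (r : nat) (P : 'M[int]_(2, r)) (E : 'M[int]_r) (vs : seq Z2)
  (alpha beta : 'cV[int]_r) (c : nat -> int) : int :=
  \sum_(k < size vs) c k * degv P E vs beta k
  - \sum_(i < r) alpha i ord0 * beta i ord0.

Definition coords (r : nat) (E : 'M[int]_r) (a : 'cV[int]_r) : 'cV[int]_r :=
  invmx E *m a.

Definition IntForm (r : nat) (P : 'M[int]_(2, r)) (E : 'M[int]_r)
  (B : 'cV[int]_r -> 'cV[int]_r -> int) : Prop :=
  exists vs : seq Z2, smooth_complete_fan vs /\
    (forall i : 'I_r, P *m col i E \in vs) /\
    forall a b, inK P a -> inK P b ->
      exists c : nat -> int, Crel P E vs (coords E a) c /\
        B a b = form_val P E vs (coords E a) (coords E b) c.

Definition q_Painleve (r : nat) (P : 'M[int]_(2, r))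
  (B : 'cV[int]_r -> 'cV[int]_r -> int) : Prop :=
  (forall a, inK P a -> B a a <= 0) /\
  ~ (forall a, inK P a -> a != 0 -> B a a < 0).

Definition isometric (r : nat) (P : 'M[int]_(2, r))
  (B B' : 'cV[int]_r -> 'cV[int]_r -> int) : Prop :=
  exists phi : 'cV[int]_r -> 'cV[int]_r,
    [/\ forall a, inK P a -> inK P (phi a),
        forall a b, inK P a -> inK P b -> phi (a + b) = phi a + phi b,
        forall a b, inK P a -> inK P b -> phi a = phi b -> a = b,
        forall b, inK P b -> exists2 a, inK P a & phi a = b &
        forall a b, inK P a -> inK P b -> B' (phi a) (phi b) = B a b].

(* Main.v *)
(* A q-Painleve seed has an isotropic vector in K, which lies in the radical of
   the semidefinite form. Its divisor therefore agrees with it along the e_i up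
   to a linear form, and after subtracting that form its support function is the
   one of a convex polygon around the origin whose edges have the directions
   psi(e_i) and whose edge lengths are multiples of their heights. Such a polygon
   is a closed path composed of the transvections w |-> w + det(w, v) v, where v
   runs over the psi(e_i) in counterclockwise order, and it persists under
   mutation. Mutating at an edge whose height is more than half of the width of
   the polygon decreases the total height, and mutations at one of two opposite
   edges merge antipodal directions; this ends in one of finitely many minimal
   polygons. Explicit mutations identify those with the same number r of edges,
   except that there are two classes for r = 4. These are distinguished by the
   parity of all determinants det(psi(e_i), psi(e_j)), that is by the image of
   psi. *)
Require Import Defs.
From HB Require Import structures.
From mathcomp Require Import all_boot all_order all_algebra.
From mathcomp Require Import zify ring.
From Stdlib Require Import Classical_Prop.
Import Order.TTheory GRing.Theory Num.Theory.
Local Open Scope ring_scope.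
Set Implicit Arguments.
Unset Strict Implicit.
Unset Printing Implicit Defensive.

(** The transvections come from intersection numbers. Turn the polygon of the divisor of an
    isotropic vector [a] by a quarter turn, so that its edges are parallel to the rays. The edge on
    a ray then has lattice length [C_a . D], the sum of the [a_i] on that ray. Radicality makes each
    [a_i], up to one common factor, the height of its edge, so every seed vector contributes one
    height to the length, that is one transvection. The first obstacle is sign: [a] may a priori
    have coefficients of both signs, and then the closed path is not a convex polygon. A passage
    from nonpositive to positive heights would force all rays that carry seed vectors onto one line,
    which contradicts finite cokernel. In the classification the highest edge is put at the bottom.
    Every other height is then at most that of the bottom edge, and minimality keeps the opposite
    vertex far away. Together these bound the slopes next to the extreme vertices, and small
    Diophantine conditions remain. The second obstacle is orientation: the classification is up to
    reflection, but only SL2 is allowed. It is removed by checking that each canonical polygon is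
    mutation equivalent to its mirror image. *)

Notation vec := (int * int)%type.

(** * Plane vectors, determinants and integral 2 x 2 matrices *)

Definition det (u v : vec) : int := u.1 * v.2 - u.2 * v.1.

Lemma det_anti u v : det v u = - det u v.
Proof. rewrite /det; lia. Qed.

Lemma det_self u : det u u = 0.
Proof. rewrite /det; lia. Qed.

Lemma plucker a b c d :
  det a b * det c d = det a c * det b d - det a d * det b c.
Proof. rewrite /det; ring. Qed.

Definition axpy (c : int) (u v : vec) : vec := (v.1 + c * u.1, v.2 + c * u.2).

Definition oppv (v : vec) : vec := (- v.1, - v.2).

Lemma oppvK v : oppv (oppv v) = v.
Proof. by case: v => a b; rewrite /oppv /= !opprK. Qed.

Lemma det_oppr u v : det u (oppv v) = - det u v.
Proof. rewrite /det /=; lia. Qed.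

Lemma det_oppl u v : det (oppv u) v = - det u v.
Proof. rewrite /det /=; lia. Qed.

Lemma det_axpyr c u v x : det x (axpy c u v) = det x v + c * det x u.
Proof. rewrite /det /=; ring. Qed.

Lemma det_axpyl c u v x : det (axpy c u v) x = det v x + c * det u x.
Proof. rewrite /det /=; ring. Qed.

Lemma axpy0 u v : axpy 0 u v = v.
Proof. by case: v => a b; rewrite /axpy /= !mul0r !addr0. Qed.

Lemma axpyA c d u v : axpy c u (axpy d u v) = axpy (c + d) u v.
Proof. by rewrite /axpy /=; congr pair; ring. Qed.

Definition prim (v : vec) : bool := gcdz v.1 v.2 == 1.

Lemma primP v : reflect (exists x y, x * v.1 + y * v.2 = 1) (prim v).
Proof.
apply: (iffP eqP) => [g1|[x [y e]]].
  by have [x [y e]] := Bezoutz v.1 v.2; exists x, y; rewrite e g1.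
have : (gcdz v.1 v.2 %| x * v.1 + y * v.2)%Z.
  by apply: rpredD; apply: dvdz_mull; rewrite ?dvdz_gcdl ?dvdz_gcdr.
by rewrite e dvdz1 /gcdz absz_nat => /eqP ->.
Qed.

Lemma mul_eq1 (c d : int) : c * d = 1 -> d = 1 \/ d = -1.
Proof.
by move/(congr1 absz)/eqP; rewrite abszM muln_eq1 => /andP [_ /eqP]; lia.
Qed.

Lemma prim_par u v : prim u -> prim v -> det u v = 0 -> v = u \/ v = oppv u.
Proof.
move=> /primP [x [y e]] /primP [x' [y' e']] d0.
set c := x * v.1 + y * v.2.
have ev : v = (c * u.1, c * u.2).
  rewrite /c; move: d0 e; rewrite /det.
  case: v {e' c} => a b; case: u => a' b' /= d0 e; congr pair.
  - transitivity (a * (x * a' + y * b')); first by rewrite e mulr1.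
    have -> : (x * a + y * b) * a' = a * (x * a' + y * b') + y * (a' * b - b' * a) by ring.
    by rewrite d0; ring.
  - transitivity (b * (x * a' + y * b')); first by rewrite e mulr1.
    have -> : (x * a + y * b) * b' = b * (x * a' + y * b') - x * (a' * b - b' * a) by ring.
    by rewrite d0; ring.
have cu : c * (x' * u.1 + y' * u.2) = 1 by rewrite -e' ev /=; ring.
rewrite mulrC in cu.
have [ec|ec] := mul_eq1 cu; [left|right]; rewrite ev ec; case: (u) => a b; rewrite /oppv /=; congr pair; lia.
Qed.

(* ((a, b), (c, d)) is the matrix with these rows. *)
Notation mat := (vec * vec)%type.

Definition act (g : mat) (v : vec) : vec :=
  (g.1.1 * v.1 + g.1.2 * v.2, g.2.1 * v.1 + g.2.2 * v.2).

Definition mdet (g : mat) : int := det g.1 g.2.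

Definition mmul (g h : mat) : mat :=
  ((g.1.1 * h.1.1 + g.1.2 * h.2.1, g.1.1 * h.1.2 + g.1.2 * h.2.2),
   (g.2.1 * h.1.1 + g.2.2 * h.2.1, g.2.1 * h.1.2 + g.2.2 * h.2.2)).

Definition minv (g : mat) : mat := ((g.2.2, - g.1.2), (- g.2.1, g.1.1)).

Definition mid : mat := ((1, 0), (0, 1)).

Lemma act_mmul g h v : act (mmul g h) v = act g (act h v).
Proof. by rewrite /act /=; congr pair; ring. Qed.

Lemma act_mid v : act mid v = v.
Proof. by case: v => a b; rewrite /act /= !(mul1r, mul0r, addr0, add0r). Qed.

Lemma mdet_mmul g h : mdet (mmul g h) = mdet g * mdet h.
Proof. rewrite /mdet /det /=; ring. Qed.

Lemma mdet_minv g : mdet (minv g) = mdet g.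
Proof. rewrite /mdet /det /=; ring. Qed.

Lemma act_minv g v : mdet g = 1 -> act (minv g) (act g v) = v.
Proof.
case: v => a b; rewrite /mdet /det /act /= => e; congr pair.
- transitivity ((g.1.1 * g.2.2 - g.1.2 * g.2.1) * a); first by ring.
  by rewrite e mul1r.
- transitivity ((g.1.1 * g.2.2 - g.1.2 * g.2.1) * b); first by ring.
  by rewrite e mul1r.
Qed.

Lemma act_minvr g v : mdet g = 1 -> act g (act (minv g) v) = v.
Proof.
move=> g1; have := @act_minv (minv g) v; rewrite mdet_minv => /(_ g1).
suff -> : minv (minv g) = g by [].
by case: g {g1} => [[a b] [c d]]; rewrite /minv /= !opprK.
Qed.

Lemma det_act g u v : det (act g u) (act g v) = mdet g * det u v.
Proof. rewrite /mdet /det /act /=; ring. Qed.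

Lemma act_axpy g c u v : act g (axpy c u v) = axpy c (act g u) (act g v).
Proof. by rewrite /act /axpy /=; congr pair; ring. Qed.

Lemma act_oppv g u : act g (oppv u) = oppv (act g u).
Proof. by rewrite /act /oppv /=; congr pair; ring. Qed.

Lemma prim_act g v : mdet g = 1 \/ mdet g = -1 -> prim v -> prim (act g v).
Proof.
move=> g1 /primP [x [y e]]; apply/primP.
exists (mdet g * (x * g.2.2 - y * g.2.1)), (mdet g * (y * g.1.1 - x * g.1.2)).
transitivity (mdet g * mdet g * (x * v.1 + y * v.2)).
  by rewrite /mdet /det /act /=; ring.
by rewrite e; case: g1 => ->.
Qed.

Lemma prim_opp v : prim (oppv v) = prim v.
Proof. by rewrite /prim /= gcdNz gcdzN. Qed.

Definition transvec (u : vec) : mat :=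
  ((1 + u.1 * u.2, - (u.1 * u.1)), (u.2 * u.2, 1 - u.1 * u.2)).

Lemma mdet_transvec u : mdet (transvec u) = 1.
Proof. rewrite /mdet /det /=; ring. Qed.

Lemma act_transvec u x : act (transvec u) x = axpy (det x u) u x.
Proof. by rewrite /act /axpy /det /=; congr pair; ring. Qed.

Lemma act_transvecV u x : act (minv (transvec u)) x = axpy (det u x) u x.
Proof. by rewrite /act /axpy /det /=; congr pair; ring. Qed.

Lemma exists_act_e1 u : prim u -> exists2 g, mdet g = 1 & act g u = (1, 0).
Proof.
move=> /primP [x [y e]]; exists ((x, y), (- u.2, u.1)).
  by rewrite /mdet /det /= -[RHS]e; ring.
by rewrite /act /= e; congr pair; ring.
Qed.

(** * Cyclically sorted lists *)

(* x, y, z are not met in strictly clockwise order. *)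
Definition ncw (x y z : vec) : bool :=
  ~~ [|| (det x y < 0) && (det y z < 0), (det y z < 0) && (det z x < 0)
       | (det z x < 0) && (det x y < 0)].

Lemma ncw_rot x y z : ncw x y z = ncw y z x.
Proof. by rewrite /ncw orbC -orbA. Qed.

(** The condition is on all triples of positions rather than on neighbours, because neighbours alone
    do not see whether the list winds around the origin once or several times. It is weak, so that
    repeated and antipodal directions are allowed. *)
Fixpoint cyc_sorted (L : seq vec) : bool :=
  if L is x :: L' then pairwise (ncw x) L' && cyc_sorted L' else true.

Lemma cyc_sorted_rcons L x :
  cyc_sorted (rcons L x) = cyc_sorted L && pairwise (fun a b => ncw a b x) L.
Proof.
elim: L => //= a L ->; rewrite pairwise_rcons.
by rewrite -!andbA [LHS]andbCA; congr andb; rewrite andbCA.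
Qed.

Lemma cyc_sorted_rot1 L x : cyc_sorted (x :: L) = cyc_sorted (rcons L x).
Proof.
rewrite cyc_sorted_rcons /= andbC; congr andb.
by apply: eq_pairwise => a b; rewrite ncw_rot.
Qed.

Lemma cyc_sorted_cat L M :
  cyc_sorted L -> cyc_sorted M ->
  (forall y, y \in M -> pairwise (fun a b => ncw a b y) L) ->
  (forall x, x \in L -> pairwise (ncw x) M) -> cyc_sorted (L ++ M).
Proof.
elim: L => //= a L IH /andP [pa cL] cM h1 h2.
rewrite IH ?andbT //=.
- rewrite pairwise_cat pa h2 ?mem_head // !andbT.
  apply/allrelP => x y xL yM; have /= /andP [/allP h _] := h1 y yM.
  exact: h.
- by move=> y yM; have /= /andP [] := h1 y yM.
- by move=> x xL; apply: h2; rewrite inE xL orbT.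
Qed.

Lemma map_cyc_sorted (f : vec -> vec) L :
  (forall x y, det (f x) (f y) = det x y) -> cyc_sorted (map f L) = cyc_sorted L.
Proof.
move=> fd; elim: L => //= x L ->; congr andb.
by rewrite pairwise_map; apply: eq_pairwise => a b; rewrite /= /ncw !fd.
Qed.

(** * Polygons as closed paths of transvections *)

(* A polygon containing the origin is given by a vertex w and the directions L
   of its edges in counterclockwise order: the edge with direction v starting
   at w has height det w v and lattice length a multiple of it, each entry of
   L contributing det w v. *)
Definition step (w v : vec) : vec := axpy (det w v) v w.

Notation run := (foldl step).

Fixpoint heights (w : vec) (L : seq vec) : seq (vec * int) :=
  if L is v :: L' then (v, det w v) :: heights (step w v) L' else [::].

Lemma det_step w v : det (step w v) v = det w v.
Proof. by rewrite det_axpyl det_self mulr0 addr0. Qed.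

Lemma step_opp w v : step w (oppv v) = step w v.
Proof. by rewrite /step /axpy det_oppr /=; congr pair; ring. Qed.

Lemma heights_cat w L M :
  heights w (L ++ M) = heights w L ++ heights (run w L) M.
Proof. by elim: L w => //= v L IH w; rewrite IH. Qed.

Lemma heights_fst w L : [seq x.1 | x <- heights w L] = L.
Proof. by elim: L w => //= v L IH w; rewrite IH. Qed.

Lemma size_heights w L : size (heights w L) = size L.
Proof. by rewrite -[RHS](congr1 size (heights_fst w L)) size_map. Qed.

Lemma heights_mem w L x : x \in heights w L -> x.1 \in L.
Proof. by move=> xL; rewrite -(heights_fst w L) map_f. Qed.

Lemma mem_heights w L v : v \in L -> exists a, (v, a) \in heights w L.
Proof.
rewrite -{1}(heights_fst w L) => /mapP [[v' a] xL ->]; by exists a.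
Qed.

Lemma run_act g w L : mdet g = 1 -> run (act g w) (map (act g) L) = act g (run w L).
Proof.
move=> g1; elim: L w => //= v L IH w.
by rewrite -IH; congr foldl; rewrite /step act_axpy det_act g1 mul1r.
Qed.

Lemma heights_act g w L : mdet g = 1 ->
  heights (act g w) (map (act g) L) = [seq (act g x.1, x.2) | x <- heights w L].
Proof.
move=> g1; elim: L w => //= v L IH w.
by rewrite -IH det_act g1 mul1r; congr (_ :: heights _ _);
  rewrite /step act_axpy det_act g1 mul1r.
Qed.

Lemma prim_run w L : prim w -> prim (run w L).
Proof.
elim: L w => //= v L IH w pw; apply: IH.
by rewrite /step -act_transvec prim_act ?mdet_transvec //; left.
Qed.

Lemma det_run u w L :
  det u (run w L) = det u w + \sum_(x <- heights w L) x.2 * det u x.1.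
Proof.
elim: L w => [|v L IH] w /=; first by rewrite big_nil addr0.
by rewrite IH big_cons det_axpyr addrA.
Qed.

Lemma run1 w L : (run w L).1 = w.1 + \sum_(x <- heights w L) x.2 * x.1.1.
Proof.
elim: L w => [|v L IH] w /=; first by rewrite big_nil addr0.
by rewrite IH big_cons /step /= addrA.
Qed.

Lemma run2 w L : (run w L).2 = w.2 + \sum_(x <- heights w L) x.2 * x.1.2.
Proof.
elim: L w => [|v L IH] w /=; first by rewrite big_nil addr0.
by rewrite IH big_cons /step /= addrA.
Qed.

Definition pos_heights (w : vec) (L : seq vec) := all (fun x : vec * int => 0 < x.2) (heights w L).

(** Scaling [w] scales the whole path and all heights. The normalisation [poly_base] is what later
    makes the parameters [q] and [h] of the standard position coprime. *)
Record polygon (w : vec) (L : seq vec) : Prop := Polygon {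
  poly_prim : all prim L;
  poly_base : prim w;
  poly_sorted : cyc_sorted L;
  poly_closed : run w L = w;
  poly_pos : pos_heights w L;
  poly_nil : L != [::] }.

Lemma perm_heights_rot w L M : run w (L ++ M) = w ->
  perm_eq (heights w (L ++ M)) (heights (run w L) (M ++ L)).
Proof.
by rewrite foldl_cat => e; rewrite !heights_cat e perm_catC.
Qed.

Lemma cyc_sorted_rot L M : cyc_sorted (L ++ M) -> cyc_sorted (M ++ L).
Proof.
elim: L M => [|x L IH] M; first by rewrite cats0.
by rewrite cat_cons cyc_sorted_rot1 -cats1 -catA => /IH; rewrite -catA cat1s.
Qed.

Lemma polygon_rot w L M : polygon w (L ++ M) -> polygon (run w L) (M ++ L).
Proof.
case=> a b c d e f; split.
- by rewrite all_cat andbC -all_cat.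
- exact: prim_run.
- exact: cyc_sorted_rot.
- by move: d; rewrite !foldl_cat => ->.
- by rewrite /pos_heights -(perm_all _ (perm_heights_rot d)).
- by move: f; rewrite -!size_eq0 !size_cat addnC.
Qed.

Lemma polygon_act g w L : mdet g = 1 -> polygon w L ->
  polygon (act g w) (map (act g) L).
Proof.
move=> g1 [a b c d e f]; split.
- rewrite all_map; apply: sub_all a => v pv; apply: prim_act => //; by left.
- by apply: prim_act => //; left.
- by rewrite map_cyc_sorted // => x y; rewrite det_act g1 mul1r.
- by rewrite run_act // d.
- by rewrite /pos_heights heights_act // all_map.
- by rewrite -size_eq0 size_map size_eq0.
Qed.

(* The reflection (x, y) -> (-x, y) maps a counterclockwise polygon to a
   clockwise one; reversing its path turns an edge direction (x, y) into
   (x, -y). *)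
Definition mir (v : vec) : vec := (v.1, - v.2).
Definition mirw (v : vec) : vec := (- v.1, v.2).

Lemma mirK v : mir (mir v) = v.
Proof. by case: v => a b; rewrite /mir /= opprK. Qed.

Lemma det_mir u v : det (mir u) (mir v) = det v u.
Proof. rewrite /det /=; ring. Qed.

Lemma det_mirw u v : det (mirw u) (mir v) = det u v.
Proof. rewrite /det /=; ring. Qed.

Lemma step_mir w v : step (mirw w) (mir v) = mirw (axpy (- det w v) v w).
Proof.
by rewrite /step det_mirw /mirw /mir /axpy /=; congr pair; ring.
Qed.

Lemma heights_mir w L :
  heights (mirw (run w L)) (rev (map mir L)) =
    rev [seq (mir x.1, x.2) | x <- heights w L] /\
  run (mirw (run w L)) (rev (map mir L)) = mirw w.
Proof.
elim: L w => //= v L IH w; have [h1 h2] := IH (step w v).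
rewrite !rev_cons -!cats1 heights_cat foldl_cat h1 h2 /= det_mirw det_step.
by split; rewrite // step_mir det_step /step axpyA addNr axpy0.
Qed.

Lemma ncw_mir x y z : ncw (mir z) (mir y) (mir x) = ncw x y z.
Proof.
rewrite /ncw !det_mir.
by case: (det x y < 0); case: (det y z < 0); case: (det z x < 0).
Qed.

Lemma cyc_sorted_mir L : cyc_sorted (rev (map mir L)) = cyc_sorted L.
Proof.
elim: L => //= v L IH; rewrite rev_cons cyc_sorted_rcons IH andbC; congr andb.
elim: L {IH} => //= x L IH; rewrite rev_cons pairwise_rcons IH; congr andb.
rewrite all_rev all_map; apply: eq_all => y /=.
exact: ncw_mir.
Qed.

Lemma polygon_mir w L : polygon w L -> polygon (mirw w) (rev (map mir L)).
Proof.
case=> a b c d e f; have [h1 h2] := heights_mir w L.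
rewrite d in h1 h2; split.
- rewrite all_rev all_map; apply: sub_all a => v.
  by rewrite /prim /= gcdzN.
- by move: b; rewrite /prim /= gcdNz.
- by rewrite cyc_sorted_mir.
- by [].
- by rewrite /pos_heights h1 all_rev all_map.
- by rewrite -size_eq0 size_rev size_map size_eq0.
Qed.

Lemma perm_heights_mir w L : run w L = w ->
  perm_eq (heights (mirw w) (rev (map mir L)))
          [seq (mir x.1, x.2) | x <- heights w L].
Proof.
move=> d; have [h1 _] := heights_mir w L.
by rewrite d in h1; rewrite h1 perm_rev.
Qed.

(** * Splitting a polygon at an edge *)

Lemma span_seq (T : Type) (P : pred T) (L : seq T) :
  exists X Y, [/\ L = X ++ Y, all P X & forall y Z, Y = y :: Z -> ~~ P y].
Proof.
elim: L => [|x L [X [Y [-> aX hY]]]]; first by exists [::], [::].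
case Px: (P x); first by exists (x :: X), Y; rewrite /= Px.
by exists [::], (x :: X ++ Y); split=> // y Z [<- _]; rewrite Px.
Qed.

(* The edges after u split into the part X going up and the part Y going down;
   further copies of u sit at the start of X or at the end of Y. *)
Record frame (u : vec) (X Y : seq vec) : Prop := Frame {
  fr_up : all (fun x => (0 < det u x) || (x == u)) X;
  fr_down : all (fun y => (det u y < 0) || (y == u) || (y == oppv u)) Y;
  fr_sortX : pairwise (fun x y => 0 <= det x y) X;
  fr_sortY : pairwise (fun x y => (0 <= det x y) && ((x == u) ==> (y == u))) Y;
  fr_hasX : has (fun x => 0 < det u x) X;
  fr_hasY : has (fun y => det u y < 0) Y }.

(** A step along [u] does not change [det _ u], so an edge [oppv u] would have negative height. *)
Lemma run_parallel u w L : 0 < det w u ->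
  all (fun v => (v == u) || (v == oppv u)) L -> pos_heights w L -> all (pred1 u) L.
Proof.
elim: L w => //= v L IH w wu /andP [/orP [] /eqP -> aL].
  rewrite /pos_heights /= => /andP [_ pL]; rewrite eqxx.
  by apply: (IH (step w u)) => //; rewrite det_step.
by rewrite /pos_heights /= det_oppr => /andP [h _]; exfalso; lia.
Qed.

Lemma sum_heights_det w L v : run w L = w ->
  \sum_(x <- heights w L) x.2 * det v x.1 = 0.
Proof. move=> c; have := det_run v w L; rewrite c; lia. Qed.

(** Closing up means that the directions, weighted by their heights, sum to zero; with positive
    weights and terms of one sign, each term vanishes. *)
Lemma one_sided u w L : run w L = w -> pos_heights w L ->
  (forall x, x \in L -> det u x <= 0) -> forall x, x \in L -> det u x = 0.
Proof.
move=> cl /allP ps h x xL; have [a xa] := mem_heights w xL.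
have pa : 0 < a := ps _ xa.
have : \sum_(x <- heights w L) - (x.2 * det u x.1) == 0.
  by rewrite sumrN sum_heights_det ?oppr0.
rewrite big_seq_cond psumr_eq0; last first.
  move=> y; rewrite andbT => yL; rewrite oppr_ge0.
  by apply: mulr_ge0_le0; [exact/ltW/ps | exact/h/heights_mem/yL].
move/allP => /(_ _ xa); rewrite xa /= oppr_eq0 mulf_eq0 => /orP [] /eqP //; lia.
Qed.

(** Without an upper edge all edges are parallel to [u] by [one_sided], hence equal to [u] by
    [run_parallel]. They then all lie strictly on one side of the line of [w], and the path cannot
    close. *)
Lemma exists_upper w u L : polygon w (u :: L) -> has (fun x => 0 < det u x) L.
Proof.
move=> [pL0 _ _ cl ps _]; apply/negPn/negP => /hasPn nup.
have /= /andP [pu pL] := pL0.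
have le0 x : x \in u :: L -> det u x <= 0.
  by rewrite inE => /orP [/eqP ->|/nup]; rewrite ?det_self //; lia.
have z := one_sided cl ps le0.
have wu : 0 < det w u by move: ps; rewrite /pos_heights /= => /andP [].
have aL : all (pred1 u) (u :: L).
  apply: (@run_parallel u w) => //; apply/allP => x xL.
  by have [->|->] := prim_par pu (allP pL0 _ xL) (z _ xL); rewrite eqxx ?orbT.
have le0' x : x \in u :: L -> det (oppv w) x <= 0.
  by move=> /(allP aL) /= /eqP ->; rewrite det_oppl; lia.
have := one_sided cl ps le0' (mem_head _ _).
by rewrite det_oppl; lia.
Qed.

Lemma exists_lower w u L : polygon w (u :: L) -> has (fun x => det u x < 0) L.
Proof.
move=> pw; apply/negPn/negP => /hasPn nlo.
have /hasP [x xL ux] := exists_upper pw; case: pw => _ _ _ cl ps _.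
have le0 y : y \in u :: L -> det (oppv u) y <= 0.
  rewrite det_oppl inE => /orP [/eqP ->|/nlo]; rewrite ?det_self //; lia.
have := @one_sided _ _ _ cl ps le0 x.
by rewrite inE xL orbT det_oppl => /(_ isT); lia.
Qed.

Lemma pairwise_in (T : eqType) (r s : rel T) (L : seq T) :
  {in L &, forall x y, r x y -> s x y} -> pairwise r L -> pairwise s L.
Proof.
elim: L => //= x L IH h /andP [a p]; apply/andP; split.
  apply/allP => y yL; apply: h; rewrite ?mem_head // ?(allP a) //.
  by rewrite inE yL orbT.
by apply: IH p => y z yL zL; apply: h; rewrite inE ?yL ?zL orbT.
Qed.

Lemma ncw12 x y z : ncw x y z -> det x y < 0 -> 0 <= det y z.
Proof. by rewrite /ncw leNgt; move=> + h; rewrite h /=; case: (det y z < 0). Qed.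

Lemma ncw23 x y z : ncw x y z -> det y z < 0 -> 0 <= det z x.
Proof. by rewrite ncw_rot; apply: ncw12. Qed.

Lemma ncw31 x y z : ncw x y z -> det z x < 0 -> 0 <= det x y.
Proof. by rewrite ncw_rot; apply: ncw23. Qed.

Lemma ncw_pos x y z : 0 <= det x y -> 0 <= det y z -> ncw x y z.
Proof. by rewrite /ncw !leNgt => /negbTE -> /negbTE ->; rewrite /= andbF. Qed.

Lemma ncw_pos12 x y z : 0 <= det x y -> (det y z < 0 -> 0 <= det z x) -> ncw x y z.
Proof.
rewrite /ncw !leNgt => /negbTE -> /=; rewrite !andbF orbF.
by case: (det y z < 0) => //= ->.
Qed.

Lemma ncw_pos23 x y z : 0 <= det y z -> (det z x < 0 -> 0 <= det x y) -> ncw x y z.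
Proof. by rewrite ncw_rot; apply: ncw_pos12. Qed.

(** [X] is the longest initial part made of upper edges and copies of [u]. The cyclic order relative
    to [u], to one upper edge and to one lower edge then leaves no freedom for the rest. *)
Lemma polygon_frame w u L : polygon w (u :: L) ->
  exists X Y, L = X ++ Y /\ frame u X Y.
Proof.
move=> pw; have hup := exists_upper pw; have hlo := exists_lower pw.
have [/= /andP [pu pL] _ /andP [cu cL] _ _ _] := pw.
have [X [Y [eL aX hY]]] := span_seq (fun x => (0 < det u x) || (x == u)) L.
exists X, Y; split=> //.
move: pL cu cL hup hlo; rewrite eL !all_cat !has_cat pairwise_cat.
move=> /andP [pX pY] /and3P [/allrelP cXY cX cY] cs hup hlo.
have par y : y \in Y -> det u y = 0 -> (y == u) || (y == oppv u).
  by move=> yY e; have [->|->] := prim_par pu (allP pY _ yY) e; rewrite eqxx ?orbT.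
have YP : all (fun y => (det u y < 0) || (y == u) || (y == oppv u)) Y.
  case: Y hY par cY {eL cXY pY hup hlo cs} => // y Y hY par /= /andP [cy _].
  have := hY y Y erefl; rewrite negb_or -leNgt => /andP [n1 n2].
  have yP : (det u y < 0) || (y == oppv u).
    case: ltgtP n1 => //= e _; have := par y (mem_head _ _) e.
    by rewrite (negbTE n2).
  rewrite -orbA orbCA yP orbT /=; apply/allP => z zY.
  have c := allP cy z zY.
  have nz : det u z <= 0.
    case/orP: yP => [yl|/eqP ey].
      rewrite det_anti oppr_le0 leNgt; apply/negP => zl.
      by have := ncw31 c zl; rewrite leNgt yl.
    move: c; rewrite ey det_anti oppr_le0 leNgt => c; apply/negP => zl.
    by have := ncw23 c; rewrite det_oppl -det_anti => /(_ zl); rewrite leNgt zl.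
  by case: ltgtP nz => //= e _; apply: par; rewrite ?inE ?zY ?orbT.
have hX : has (fun x => 0 < det u x) X.
  case/orP: hup => // /hasP [y /(allP YP)]; case/orP => [/orP []|] h.
    by move=> /(lt_trans h); rewrite ltxx.
    by rewrite (eqP h) det_self.
  by rewrite (eqP h) det_oppr det_self.
have hYl : has (fun x => det u x < 0) Y.
  case/orP: hlo => // /hasP [y /(allP aX)]; case/orP => h; first by move=> /lt_trans /(_ h); rewrite ltxx.
  by rewrite (eqP h) det_self.
have /hasP [x0 x0X ux0] := hX; have /hasP [y0 y0Y uy0] := hYl.
have x0u : det x0 u < 0 by rewrite det_anti oppr_lt0.
have y0u : 0 < det y0 u by rewrite det_anti oppr_gt0.
split => //.
- (* a copy of u after an upper edge is excluded by a lower edge y0 *)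
  have : pairwise (fun a b => ncw u a b && ncw a b y0) X.
    rewrite pairwise_relI cX /=.
    elim: (X) cs => //= a X' IH /andP [+ /IH ->]; rewrite andbT pairwise_cat.
    case/and3P => /allrelP h _ _; apply/allP => b bX; exact: h.
  apply: pairwise_in => a b aX' bX' /andP [c1 c2].
  case/orP: (allP aX _ aX') => [ua|/eqP ->].
    case/orP: (allP aX _ bX') => [ub|/eqP eb].
      rewrite leNgt; apply/negP => h; have := ncw23 c1 h.
      by rewrite det_anti oppr_ge0 leNgt ub.
    have au : det a u < 0 by rewrite det_anti oppr_lt0.
    by have := ncw12 c2; rewrite eb => /(_ au); rewrite leNgt uy0.
  by case/orP: (allP aX _ bX') => [ub|/eqP ->]; rewrite ?det_self // ltW.
(* Comparison with the upper edge [x0], which precedes [Y], shows that only copies of [u] can follow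
   a copy of [u]. *)
- have : pairwise (fun a b => ncw u a b && ncw x0 a b) Y.
    rewrite pairwise_relI cY /=.
    elim: (X) cs x0X => //= a X' IH /andP [+ cs']; rewrite pairwise_cat inE.
    by case/and3P => _ _ h /orP [/eqP ->|] //; apply: IH.
  apply: pairwise_in => a b aY bY /andP [c1 c2].
  have nu : oppv u != u.
    by apply/eqP => h; have := congr1 (det x0) h; rewrite det_oppr; move: x0u; clear; lia.
  case/orP: (allP YP _ aY) => [/orP [ua|/eqP ea]|/eqP ea].
  + have -> : (a == u) = false by apply/eqP => e; move: ua; rewrite e det_self.
    by rewrite andbT (ncw12 c1).
  + have -> : b = u.
      have := ncw12 c2; rewrite ea => /(_ x0u) ub.
      case/orP: (allP YP _ bY) => [/orP [ub'|/eqP eb]|/eqP eb] //; first by rewrite leNgt ub' in ub.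
      have := ncw31 c2; rewrite eb ea det_oppl oppr_lt0 => /(_ ux0).
      by rewrite leNgt x0u.
    by rewrite ea eqxx det_self.
  + rewrite ea (negbTE nu) andbT det_oppl.
    by case/orP: (allP YP _ bY) => [/orP [ub|/eqP ->]|/eqP ->];
      rewrite ?det_oppr ?det_self ?oppr0 // oppr_ge0 ltW.
Qed.

Lemma sorted_triples (L : seq vec) :
  pairwise (fun x y => 0 <= det x y) L -> cyc_sorted L.
Proof.
elim: L => //= x L IH /andP [ax pL]; rewrite IH // andbT.
elim: L ax pL {IH} => //= y L IH /andP [xy ax] /andP [ay pL].
rewrite IH // andbT; apply/allP => z zL; apply: ncw_pos => //.
exact: (allP ay).
Qed.

(** This reassembles a cyclic order after a mutation. Each half lies in a closed half plane, and
    triples that meet both halves are decided by the Pluecker relation with [u]. *)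
Lemma frame_cyc_sorted u X Y :
  all (fun x => (0 < det u x) || (x == u)) X ->
  all (fun y => (det u y < 0) || (y == u) || (y == oppv u)) Y ->
  pairwise (fun x y => 0 <= det x y) X ->
  pairwise (fun x y => (0 <= det x y) && ((x == u) ==> (y == u))) Y ->
  cyc_sorted (X ++ Y).
Proof.
move=> aX aY pX pY.
have le0 y : y \in Y -> det u y <= 0.
  by move=> yY; case/orP: (allP aY _ yY) => [/orP [ua|/eqP ->]|/eqP ->];
    rewrite ?det_oppr ?det_self //; exact: ltW.
apply: cyc_sorted_cat.
- exact: sorted_triples.
- by apply: sorted_triples; apply: sub_pairwise pY => x y /andP [].
- move=> y yY; apply: pairwise_in pX => a b aX' bX' ab.
  have uy := le0 _ yY; have pl := plucker u y a b.
  have ub : 0 <= det u b.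
    by case/orP: (allP aX _ bX') => [|/eqP ->]; rewrite ?det_self //; exact: ltW.
  apply: ncw_pos12 => // h1; rewrite leNgt; apply/negP => h2.
  rewrite (det_anti y b) in h1.
  case/orP: (allP aX _ aX') => [ua|/eqP ea]; last by move: h2; rewrite ea det_anti oppr_lt0 ltNge uy.
  by move: uy ub ab h1 h2 ua pl; clear; nia.
- move=> x xX; apply: pairwise_in pY => a b aY' bY' /andP [ab imp].
  have ua := le0 _ aY'; have ub := le0 _ bY'.
  apply: ncw_pos23 => // h2; rewrite leNgt; apply/negP => h1.
  have pl := plucker u x a b; rewrite (det_anti x b) in h2.
  case/orP: (allP aX _ xX) => [ux|/eqP ex]; last first.
    by move: h2; rewrite ex -det_anti (det_anti u) oppr_lt0; move: ub; clear; lia.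
  have a0 : det u a = 0 by move: ua ub ab h1 h2 ux pl; clear; nia.
  case/orP: (allP aY _ aY') => [/orP [|/eqP ea]|/eqP ea]; first by rewrite a0 ltxx.
    move: imp; rewrite ea eqxx /= => /eqP eb; move: h2 h1; rewrite eb ea; clear; lia.
  by move: h1; rewrite ea det_oppr (det_anti u x) opprK ltNge ltW.
Qed.

(** * Mutation of polygons *)

Definition shear (u x : vec) : vec := axpy (Num.max 0 (det u x)) u x.

(** For a polygon this is the lattice width transverse to [v]: the total rise of [det v _] along the
    edges on which it increases. *)
Definition width (w : vec) (L : seq vec) (v : vec) : int :=
  \sum_(x <- heights w L) x.2 * Num.max 0 (det v x.1).

Lemma det_step_pos z v : 0 < det z v -> 0 < det z (step z v).
Proof. by move=> h; rewrite det_axpyr det_self add0r mulr_gt0. Qed.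

(** Within a half plane, lying counterclockwise of each other is transitive: the Pluecker relation
    for [u], [w], [z], [z'] leaves no other sign for [det w z']. *)
Lemma half_plane_step u w z z' : det u w < 0 -> det u z <= 0 -> det u z' <= 0 ->
  0 < det w z -> 0 < det z z' -> 0 < det w z'.
Proof.
move=> uw uz uz' wz zz'; have := plucker u w z z'.
by move: uw uz uz' wz zz'; clear; nia.
Qed.

(** [det u _] does not decrease along such a path, so an end point in the half plane forces all
    earlier vertices into it, and [half_plane_step] applies at each edge. *)
Lemma half_plane_up u w z X : det u w < 0 -> 0 < det w z -> pos_heights z X ->
  all (fun x => 0 <= det u x) X -> det u (run z X) <= 0 ->
  det u z <= 0 /\ 0 < det w (run z X).
Proof.
move=> uw; elim: X z => //= v X IH z wz; rewrite /pos_heights /=.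
move=> /andP [zv pX] /andP [uv aX] e.
have [|l r] := IH (step z v) _ pX aX e; last first.
  split=> //; move: l; rewrite det_axpyr; move: zv uv; clear; nia.
have: det u (step z v) <= 0.
  move: e; rewrite det_run; suff: 0 <= \sum_(x <- heights (step z v) X) x.2 * det u x.1.
    by clear; lia.
  rewrite big_seq_cond; apply: sumr_ge0 => x; rewrite andbT => xX.
  by apply: mulr_ge0; [apply/ltW/(allP pX) | apply/(allP aX)/heights_mem/xX].
move=> h; apply: (half_plane_step uw _ h wz); last exact: det_step_pos.
by move: h; rewrite det_axpyr; move: zv uv; clear; nia.
Qed.

Lemma half_plane_down u w z Y : det u w < 0 -> det u z <= 0 -> 0 < det w z ->
  pos_heights z Y -> all (fun x => det u x <= 0) Y -> 0 < det w (run z Y).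
Proof.
move=> uw; elim: Y z => //= v Y IH z uz wz; rewrite /pos_heights /=.
move=> /andP [zv pX] /andP [uv aX].
have h : det u (step z v) <= 0 by rewrite det_axpyr; move: uz zv uv; clear; nia.
apply: IH => //; apply: (half_plane_step uw uz h wz); exact: det_step_pos.
Qed.

Section Frame.
Variables (w u : vec) (X Y : seq vec).
Hypotheses (pw : polygon w (u :: X ++ Y)) (fr : frame u X Y).

Let z := run (step w u) X.

Lemma base_height : 0 < det w u.
Proof. by case: pw => _ _ _ _ + _; rewrite /pos_heights /= => /andP []. Qed.

Lemma frame_up x : x \in X -> 0 <= det u x.
Proof. by move/(allP (fr_up fr)) => /orP [/ltW|/eqP ->] //; rewrite det_self. Qed.

Lemma frame_down y : y \in Y -> det u y <= 0.
Proof.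
move/(allP (fr_down fr)) => /orP [/orP [/ltW|/eqP ->]|/eqP ->] //.
  by rewrite det_self.
by rewrite det_oppr det_self.
Qed.

Lemma pos_heightsXY : pos_heights (step w u) X /\ pos_heights z Y.
Proof.
case: pw => _ _ _ _ + _; rewrite /pos_heights /= heights_cat all_cat.
by case/and3P.
Qed.

Lemma run_down : run z Y = w.
Proof. by case: pw => _ _ _ + _ _; rewrite /= foldl_cat. Qed.

Lemma top_height : det u z = width w (u :: X ++ Y) u - det w u.
Proof.
rewrite /width /= big_cons det_self /= maxxx mulr0 add0r heights_cat big_cat /=.
rewrite /z det_run det_axpyr det_self mulr0 addr0 (det_anti w) [LHS]addrC.
congr (_ - _); rewrite [X in _ + X]big_seq_cond [X in _ + X]big1 ?addr0.
  rewrite big_seq_cond [RHS]big_seq_cond; apply: eq_bigr => x /andP [xX _].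
  by rewrite max_r //; apply/frame_up/heights_mem/xX.
move=> x /andP [xX _]; rewrite max_l ?mulr0 //; exact/frame_down/heights_mem/xX.
Qed.

(* Otherwise all vertices lie in the half plane det u _ <= 0, where a path
   turning counterclockwise around the origin cannot close up. *)
Lemma top_height_pos : 0 < det u z.
Proof.
rewrite ltNge; apply/negP => h; have bh := base_height.
have [pX pY] := pos_heightsXY.
have uw : det u w < 0 by rewrite det_anti oppr_lt0.
have ww1 := det_step_pos bh.
have aX : all (fun x => 0 <= det u x) X by apply/allP => x; apply: frame_up.
have [_ wz] := half_plane_up uw ww1 pX aX h.
have aY : all (fun y => det u y <= 0) Y by apply/allP => y; apply: frame_down.
by have := half_plane_down uw h wz pY aY; rewrite run_down det_self ltxx.
Qed.

Let g := minv (transvec u).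

Lemma shear_up x : x \in X -> shear u x = act g x.
Proof. by move/frame_up => h; rewrite /shear max_r // /g act_transvecV. Qed.

Lemma shear_down y : y \in Y -> shear u y = y.
Proof. by move/frame_down => h; rewrite /shear max_l // axpy0. Qed.

Lemma mdet_g : mdet g = 1.
Proof. by rewrite mdet_minv mdet_transvec. Qed.

Lemma act_g_step : act g (step w u) = w.
Proof. by rewrite /step -act_transvec /g act_minv ?mdet_transvec. Qed.

Lemma step_top : step (act g z) (oppv u) = z.
Proof.
by rewrite step_opp /step -act_transvec act_minvr ?mdet_transvec.
Qed.

Lemma heights_mutated :
  heights w (map (act g) X ++ oppv u :: Y) =
  [seq (shear u x.1, x.2) | x <- heights (step w u) X] ++
  (oppv u, det u z) :: [seq (shear u x.1, x.2) | x <- heights z Y].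
Proof.
have e : run w (map (act g) X) = act g z.
  by rewrite -{1}act_g_step run_act // mdet_g.
rewrite heights_cat e /= step_top; congr (_ ++ _ :: _).
- rewrite -{1}act_g_step heights_act ?mdet_g //.
  by apply/eq_in_map => x /heights_mem xX; rewrite shear_up.
- congr pair; rewrite act_transvecV det_axpyl det_oppr det_oppr det_self.
  by rewrite oppr0 mulr0 addr0 -det_anti.
- rewrite -[LHS]map_id; apply/eq_in_map => x /heights_mem xY.
  by rewrite shear_down //; case: (x).
Qed.

(** Mutation is a piecewise linear map on the polygon. The inverse transvection [g] moves [step w u]
    back to [w], which removes one copy of the bottom edge, and acts on the upper edges [X]. It ends
    at [act g z] instead of [z], and a new edge [oppv u] at the top closes this gap. Heights survive
    because [g] has determinant 1. *)
Lemma polygon_mutated : polygon w (map (act g) X ++ oppv u :: Y).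
Proof.
have [aP pwb _ cl ps _] := pw; have [pX pY] := pos_heightsXY.
move: aP; rewrite /= all_cat => /and3P [pu aX aY].
have e : run w (map (act g) X) = act g z.
  by rewrite -{1}act_g_step run_act // mdet_g.
have ug x : det u (act g x) = det u x.
  by rewrite act_transvecV det_axpyr det_self mulr0 addr0.
split => //.
- rewrite all_cat /= prim_opp pu aY !andbT all_map.
  by apply: sub_all aX => x px; apply: prim_act => //; left; rewrite mdet_g.
- apply: (@frame_cyc_sorted u).
  + rewrite all_map; apply: sub_all (fr_up fr) => x /=; rewrite ug.
    case/orP => [->//|/eqP ->]; apply/orP; right.
    by rewrite act_transvecV det_self axpy0.
  + by rewrite /= eqxx orbT; exact: fr_down fr.
  + rewrite pairwise_map; apply: sub_pairwise (fr_sortX fr) => x y /=.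
    by rewrite det_act mdet_g mul1r.
  + rewrite /= (fr_sortY fr) andbT; apply/allP => y yY.
    rewrite det_oppl oppr_ge0 frame_down //=; apply/implyP => /eqP h.
    have := top_height_pos; have /hasP [x xX ux] := fr_hasX fr.
    by have := congr1 (det x) h; rewrite det_oppr (det_anti u); move: ux; clear; lia.
- by rewrite foldl_cat e /= step_top run_down.
- rewrite /pos_heights heights_mutated all_cat /= top_height_pos !all_map /=.
  by rewrite [X in X && _]pX; exact: pY.
- by case: (map _ X).
Qed.

End Frame.

Lemma polygon_mutate w u L : polygon w (u :: L) ->
  exists L', [/\ polygon w L',
    perm_eq L' (oppv u :: map (shear u) L) &
    perm_eq (heights w L') ((oppv u, width w (u :: L) u - det w u) ::
      [seq (shear u x.1, x.2) | x <- heights (step w u) L])].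
Proof.
move=> pw; have [X [Y [eL fr]]] := polygon_frame pw; rewrite eL in pw *.
exists (map (act (minv (transvec u))) X ++ oppv u :: Y); split.
- exact: polygon_mutated.
- have -> : map (shear u) (X ++ Y) = map (act (minv (transvec u))) X ++ Y.
    rewrite map_cat; congr (_ ++ _).
      by apply/eq_in_map => x; apply: (shear_up fr).
    by rewrite -[RHS]map_id; apply/eq_in_map => y; apply: (shear_down fr).
  exact: (permEl (perm_catCA _ [:: oppv u] Y)).
- rewrite heights_mutated // -top_height // heights_cat map_cat.
  exact: (permEl (perm_catCA _ [:: (_, _)] _)).
Qed.

(** * Mutation equivalence of multisets of vectors *)

(** One sign of mutation is enough: the opposite sign differs from it by [transvec u], which
    [meq_act] supplies. Symmetry is not built in; it follows from [shear_shear]. *)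
Inductive meq (L : seq vec) : seq vec -> Prop :=
| meq_refl : meq L L
| meq_perm M N : meq L M -> perm_eq M N -> meq L N
| meq_act g M : mdet g = 1 -> meq L M -> meq L (map (act g) M)
| meq_mut u M : meq L (u :: M) -> meq L (oppv u :: map (shear u) M).

Lemma meq_trans L M N : meq L M -> meq M N -> meq L N.
Proof.
move=> LM; elim=> // {N}.
- by move=> N N' _ LN; apply: meq_perm.
- by move=> g N g1 _; apply: meq_act.
- by move=> u N _; apply: meq_mut.
Qed.

Lemma shear_act g u x : mdet g = 1 -> shear (act g u) (act g x) = act g (shear u x).
Proof. by move=> g1; rewrite /shear det_act g1 mul1r act_axpy. Qed.

Lemma axpy_oppv c u x : axpy c (oppv u) x = axpy (- c) u x.
Proof. by rewrite /axpy /=; congr pair; ring. Qed.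

(* Mutating twice at the same vector is a transvection. *)
Lemma shear_shear u x : shear (oppv u) (shear u x) = act (minv (transvec u)) x.
Proof.
rewrite act_transvecV /shear det_oppl det_axpyr det_self mulr0 addr0.
rewrite axpy_oppv axpyA; congr axpy; lia.
Qed.

Lemma meq_sym L M : meq L M -> meq M L.
Proof.
elim=> {M}.
- exact: meq_refl.
- move=> M N _ ML MN; apply: meq_trans ML.
  by apply: (meq_perm (meq_refl _)); rewrite perm_sym.
- move=> g M g1 _ ML; apply: meq_trans ML.
  have : map (act (minv g)) (map (act g) M) = M.
    by rewrite -map_comp -[RHS]map_id; apply: eq_map => x /=; rewrite act_minv.
  move=> {2}<-; apply: meq_act; first by rewrite mdet_minv.
  exact: meq_refl.
- move=> u M _ ML; apply: meq_trans ML.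
  have h := meq_act (mdet_transvec u) (meq_mut (meq_refl (oppv u :: map (shear u) M))).
  suff : map (act (transvec u)) (oppv (oppv u) ::
      map (shear (oppv u)) (map (shear u) M)) = u :: M by move=> <-.
  rewrite /= oppvK act_transvec det_self axpy0; congr cons.
  rewrite -!map_comp -[RHS]map_id; apply: eq_map => x /=.
  by rewrite shear_shear act_minvr ?mdet_transvec.
Qed.

Lemma size_meq L M : meq L M -> size M = size L.
Proof.
elim=> {M} //= [M N _ <- /perm_size //|g M _ _ <-|u M _ <-]; by rewrite ?size_map.
Qed.

Lemma mir_axpy c u x : mir (axpy c u x) = axpy c (mir u) (mir x).
Proof. by rewrite /mir /axpy /=; congr pair; ring. Qed.

(** Reflection negates determinants and so turns a mutation into one of opposite sign; since [d]_+ -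
    [-d]_+ = d, the two signs differ by a transvection. *)
Lemma mir_shear u x :
  mir (shear u x) = act (transvec (mir u)) (shear (mir u) (mir x)).
Proof.
rewrite act_transvec /shear mir_axpy det_axpyl det_self mulr0 addr0 axpyA.
rewrite !det_mir (det_anti u x); congr axpy; lia.
Qed.

Lemma meq_mir L M : meq L M -> meq (map mir L) (map mir M).
Proof.
elim=> {M}.
- exact: meq_refl.
- by move=> M N _ ML MN; apply: meq_perm ML _; apply: perm_map.
- move=> g M g1 _ ML.
  (* This is the conjugate of [g] by the reflection [mir]. *)
  pose h : mat := ((g.1.1, - g.1.2), (- g.2.1, g.2.2)).
  have h1 : mdet h = 1 by rewrite -g1 /mdet /det /=; ring.
  rewrite (_ : map mir (map (act g) M) = map (act h) (map mir M)).
    exact: meq_act.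
  rewrite -!map_comp; apply: eq_map => x /=.
  by rewrite /mir /act /=; congr pair; ring.
- move=> u M _ ML.
  have := meq_act (g := transvec (mir u)) _ (meq_mut ML).
  rewrite mdet_transvec => /(_ erefl).
  rewrite /= act_oppv act_transvec det_self axpy0.
  rewrite (_ : map _ (map _ (map mir M)) = map mir (map (shear u) M)) //.
  by rewrite -!map_comp; apply: eq_map => x /=; rewrite mir_shear.
Qed.

(** * Descent to minimal polygons *)

Definition no_antipodes (L : seq vec) := all (fun v => oppv v \notin L) L.

Definition minimal (w : vec) (L : seq vec) :=
  all (fun x : vec * int => 2 * x.2 <= width w L x.1) (heights w L).

Definition total (w : vec) (L : seq vec) : int := \sum_(x <- heights w L) x.2.

Lemma perm_width w L w' L' v : perm_eq (heights w L) (heights w' L') ->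
  width w L v = width w' L' v.
Proof. by move=> p; apply: perm_big. Qed.

Lemma perm_total w L w' L' : perm_eq (heights w L) (heights w' L') ->
  total w L = total w' L'.
Proof. by move=> p; apply: perm_big. Qed.

Lemma total_ge0 w L : pos_heights w L -> 0 <= total w L.
Proof.
move=> /allP ps; rewrite /total big_seq_cond; apply: sumr_ge0 => x.
by rewrite andbT => /ps /ltW.
Qed.

(** This is the sum of the squares of the multiplicities. It grows when a vector joins a direction
    at least as frequent as its own, and it is bounded by the square of the length, so it can serve
    to prove termination. *)
Definition coincidences (L : seq vec) : nat := \sum_(x <- L) count_mem x L.

Lemma perm_coincidences L M : perm_eq L M -> coincidences L = coincidences M.
Proof.
move=> p; rewrite /coincidences (perm_big _ p) /=; apply: eq_bigr => x _.
exact/permP.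
Qed.

Lemma coincidences_cons x L :
  coincidences (x :: L) = ((count_mem x L).*2.+1 + coincidences L)%N.
Proof.
rewrite /coincidences big_cons /= eqxx add1n.
have -> : \sum_(j <- L) ((x == j) + count_mem j L)%N =
   (count_mem x L + \sum_(j <- L) count_mem j L)%N.
  rewrite big_split /=; congr addn.
  by rewrite -sum1_count [RHS]big_mkcond /=; apply: eq_bigr => j _; rewrite eq_sym; case: eqP.
by rewrite -addnn addnA !addSn.
Qed.

Lemma coincidences_le L : (coincidences L <= size L * size L)%N.
Proof.
rewrite /coincidences; apply: (@leq_trans (\sum_(x <- L) size L)).
  by apply: leq_sum => x _; apply: count_size.
by rewrite big_const_seq count_predT iter_addn_0.
Qed.

Lemma shear_inj u : injective (shear u).
Proof.
move=> x y h; have : act (minv (transvec u)) x = act (minv (transvec u)) y.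
  by rewrite -!shear_shear h.
by move/(congr1 (act (transvec u))); rewrite !act_minvr ?mdet_transvec.
Qed.

Lemma coincidences_map (f : vec -> vec) L : injective f ->
  coincidences (map f L) = coincidences L.
Proof.
move=> fi; rewrite /coincidences big_map; apply: eq_bigr => x _.
by rewrite count_map; apply: eq_count => y /=; rewrite inj_eq.
Qed.

Lemma shear_self u : shear u (oppv u) = oppv u.
Proof. by rewrite /shear det_oppr det_self oppr0 maxxx axpy0. Qed.

Lemma heights_split w L (x : vec * int) : x \in heights w L ->
  exists L1 L2, L = L1 ++ x.1 :: L2 /\ x.2 = det (run w L1) x.1.
Proof.
elim: L w => //= v L IH w; rewrite inE => /orP [/eqP ->|/IH [L1 [L2 [-> e]]]].
  by exists [::], L.
by exists (v :: L1), L2.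
Qed.

Lemma polygon_head w L (x : vec * int) : polygon w L -> x \in heights w L ->
  exists w' (M : seq vec), [/\ polygon w' (x.1 :: M), perm_eq L (x.1 :: M),
    perm_eq (heights w L) (heights w' (x.1 :: M)) & det w' x.1 = x.2].
Proof.
move=> pw /heights_split [L1 [L2 [eL e]]].
exists (run w L1), (L2 ++ L1); rewrite eL in pw *; split=> //.
- exact: (polygon_rot pw).
- by rewrite -cat_cons perm_catC.
- by rewrite -cat_cons; apply: perm_heights_rot; case: pw.
Qed.

(** An edge of height [x.2] is replaced by one of height [width w L x.1 - x.2]. Coincidences among
    the other edges persist since [shear] is injective, and [shear] fixes [oppv x.1], so the new
    edge joins the existing copies of that vector. *)
Lemma mutate_at w L (x : vec * int) : polygon w L -> x \in heights w L ->
  exists w' L', [/\ polygon w' L', meq L L',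
    total w' L' = total w L + width w L x.1 - 2 * x.2 &
    (coincidences L' + (count_mem x.1 L).*2 =
     coincidences L + (count_mem (oppv x.1) L).*2 + 2)%N].
Proof.
move=> pw xL; have [w' [M [pM pLM pH e]]] := polygon_head pw xL.
have [L' [pL' pp ph]] := polygon_mutate pM.
exists w', L'; split=> //.
- apply: (@meq_perm _ (oppv x.1 :: map (shear x.1) M)); last by rewrite perm_sym.
  by apply: meq_mut; apply: meq_perm pLM; apply: meq_refl.
- rewrite (perm_total pH) (perm_width _ pH) /total (perm_big _ ph) /=.
  rewrite !big_cons big_map /= e; ring.
- rewrite (perm_coincidences pp) (perm_coincidences pLM) !coincidences_cons.
  rewrite (coincidences_map _ (@shear_inj _)) (permP pLM) (permP pLM) /= eqxx.
  rewrite count_map.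
  rewrite (eq_count (a2 := pred1 (oppv x.1))); last first.
    by move=> y /=; rewrite -{1}(shear_self x.1) (inj_eq (@shear_inj _)).
  have -> : (x.1 == oppv x.1) = false.
    have := exists_upper pM; case: eqP => // h /hasP [y _].
    by have := congr1 (det^~ y) h => /=; rewrite det_oppl; clear; lia.
  rewrite add0n add1n doubleS.
  by move: (count_mem (oppv x.1) M) (count_mem x.1 M) (coincidences M); clear; lia.
Qed.

Lemma width_opp w L v : run w L = w -> width w L (oppv v) = width w L v.
Proof.
move=> cl; apply/eqP; rewrite eq_sym -subr_eq0 -(sum_heights_det v cl) /width -sumrB.
apply/eqP; apply: eq_bigr => x _; rewrite -mulrBr det_oppl; congr (_ * _); lia.
Qed.

(** The cyclic order makes [oppv u] the first edge going down, so it sits at the topmost vertex,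
    whose height is given by [top_height]. *)
Lemma antipode_height w u L : polygon w (u :: L) -> oppv u \in L ->
  (oppv u, width w (u :: L) u - det w u) \in heights w (u :: L).
Proof.
move=> pw; have [X [Y [eL fr]]] := polygon_frame pw; rewrite eL in pw *.
have nu : oppv u != u.
  have /hasP [x _ ux] := fr_hasX fr.
  by apply/eqP => h; have := congr1 (det^~ x) h; rewrite /= det_oppl; move: ux; clear; lia.
rewrite mem_cat => /orP [/(allP (fr_up fr))|uY].
  by rewrite det_oppr det_self oppr0 ltxx (negbTE nu).
rewrite -(top_height w fr) /= heights_cat !inE mem_cat.
case: Y uY {eL pw} fr => // y Y uY fr.
have -> : y = oppv u.
  have /= /andP [+ _] := fr_down fr; have /= /andP [/allP h _] := fr_sortY fr.
  move: uY; rewrite inE => /orP [/eqP -> //|/h]; rewrite (negbTE nu) implybF.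
  rewrite det_oppr (det_anti u) opprK leNgt => /andP [/negbTE -> /negbTE ->] /=.
  by move/eqP.
by rewrite /= inE det_oppr -det_anti eqxx !orbT.
Qed.

(* For a minimal polygon u and -u have equal heights, so that mutating at the
   rarer of the two keeps the total height. *)
Lemma merge_antipodes w L (u : vec) : polygon w L -> minimal w L ->
  u \in L -> oppv u \in L -> (count_mem u L <= count_mem (oppv u) L)%N ->
  exists w' L', [/\ polygon w' L', meq L L', total w' L' = total w L &
    (coincidences L < coincidences L')%N].
Proof.
move=> pw mi uL nuL cnt; have [a ua] := mem_heights w uL.
have [w' [M [pM pLM pH e]]] := polygon_head pw ua.
have pW := perm_width u pH; rewrite [_.1]/= in pM pLM pH pW; rewrite [_.1]/= [_.2]/= in e.
have [w2 [L2 /= [p2 m2 t2 c2]]] := mutate_at pw ua.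
exists w2, L2; split=> //; last first.
  move: c2 cnt.
  by move: (count_mem u L) (count_mem (oppv u) L) (coincidences L) (coincidences L2); clear; lia.
have m1 := allP mi _ ua; rewrite /= in m1.
have nuM : oppv u \in M.
  move: nuL; rewrite (perm_mem pLM) inE => /orP [/eqP h|//].
  have /hasP [y _] := exists_upper pM.
  by have := congr1 (det^~ y) h => /=; rewrite det_oppl; clear; lia.
(* Minimality at [u] gives 2a <= width, and minimality at [oppv u], of height width - a, gives the
   reverse inequality. *)
have := antipode_height pM nuM; rewrite -(perm_mem pH) => /(allP mi) /=.
rewrite (width_opp _ (poly_closed pw)) -pW e t2.
move: m1; clear; lia.
Qed.

Lemma minimal_exists w L : polygon w L ->
  exists w' L', [/\ polygon w' L', meq L L', minimal w' L' & no_antipodes L'].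
Proof.
(* A lexicographic measure in one number: total height first, then the missing coincidences, which
   never exceed the squared length. The length itself is constant under mutation. *)
pose m w L := (`|total w L| * (size L * size L).+1 +
               (size L * size L - coincidences L))%N.
have [n] := ubnP (m w L); elim: n w L => // n IH w L; rewrite ltnS => mn pw.
have next w' L' : polygon w' L' -> meq L L' -> (m w' L' < m w L)%N ->
    exists w' L', [/\ polygon w' L', meq L L', minimal w' L' & no_antipodes L'].
  move=> p' e lt; have [|w2 [L2 [a b c d]]] := IH w' L' _ p'.
    exact: leq_trans lt mn.
  by exists w2, L2; split=> //; apply: meq_trans b.
have t0 := total_ge0 (poly_pos pw).
have [mi|/allPn [x xL nx]] := boolP (minimal w L); last first.
  have [w' [L' [p' e' t' c']]] := mutate_at pw xL.
  apply: (next _ _ p' e'); rewrite /m (size_meq e').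
  have t1 := total_ge0 (poly_pos p').
  rewrite -ltNge in nx.
  have lt : (`|total w' L'| < `|total w L|)%N.
    move: t' nx t0 t1; case: (x) => v a /=.
    by move: (total w' L') (total w L) (width w L v) (a : int); clear; lia.
  move: (size L * size L)%N lt => k lt.
  apply: (@leq_trans (`|total w' L'|.+1 * k.+1)).
    by rewrite mulSn addnC ltn_add2r ltnS leq_subr.
  by apply: leq_trans (leq_addr _ _); rewrite leq_mul2r lt orbT.
have [na|/allPn [u uL]] := boolP (no_antipodes L); first by exists w, L; split=> //; apply: meq_refl.
rewrite negbK => nuL.
have [w' [L' [p' e' t' c']]] : exists w' L', [/\ polygon w' L', meq L L',
    total w' L' = total w L & (coincidences L < coincidences L')%N].
  have [h|h] := leqP (count_mem u L) (count_mem (oppv u) L).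
    exact: (merge_antipodes pw mi uL nuL h).
  apply: (merge_antipodes pw mi nuL); rewrite oppvK //.
  exact: ltnW.
apply: (next _ _ p' e'); rewrite /m (size_meq e') t' ltn_add2l.
have := coincidences_le L'; rewrite (size_meq e'); move: c'.
by move: (coincidences L) (coincidences L') (size L * size L)%N; clear; lia.
Qed.

(** * Minimal polygons in standard position *)

Lemma act_inj g : mdet g = 1 -> injective (act g).
Proof. by move=> g1; apply: can_inj => x; apply: act_minv. Qed.

Lemma exists_max (T : eqType) (f : T -> int) (s : seq T) : s != [::] ->
  exists2 x, x \in s & forall y, y \in s -> f y <= f x.
Proof.
elim: s => //= x [|y s] IH _.
  by exists x; rewrite ?mem_head // => y; rewrite inE => /eqP ->.
have [z zs zm] := IH isT.
have [xz|zx] := leP (f x) (f z).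
  exists z; first by rewrite inE zs orbT.
  by move=> t; rewrite inE => /orP [/eqP ->|/zm].
exists x; first exact: mem_head.
move=> t; rewrite inE => /orP [/eqP -> //|/zm h].
exact: le_trans h (ltW zx).
Qed.

Lemma pairwise_split (T : eqType) (P : pred T) (L : seq T) :
  pairwise (fun x y => P y ==> P x) L -> L = filter P L ++ filter (predC P) L.
Proof.
elim: L => //= x L IH /andP [/allP ax /IH eL]; case: ifP => Px /=.
  by rewrite {1}eL.
have n0 : filter P L = [::].
  apply/eqP; rewrite -(negbK (_ == _)) -has_filter; apply/hasPn => y yL.
  by have := ax y yL; rewrite Px implybF.
by rewrite n0 /= {1}eL n0.
Qed.

(* u has maximal height h, and is most frequent among the edges of height h. *)
Record extremal (w : vec) (L : seq vec) (u : vec) (h : int) : Prop := Extremal {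
  ex_poly : polygon w L;
  ex_min : minimal w L;
  ex_anti : no_antipodes L;
  ex_max : forall v a, (v, a) \in heights w L -> a <= h;
  ex_count : forall v, (v, h) \in heights w L -> (count_mem v L <= count_mem u L)%N }.

Lemma minimal_perm w L w' L' : perm_eq (heights w L) (heights w' L') ->
  minimal w L -> minimal w' L'.
Proof.
move=> p; rewrite /minimal -(perm_all _ p); apply: sub_all => x.
by rewrite (perm_width _ p).
Qed.

Lemma extremal_perm w L w' L' u h : polygon w' L' ->
  perm_eq (heights w L) (heights w' L') -> extremal w L u h -> extremal w' L' u h.
Proof.
move=> p' pm [p mi an mx ct].
have pL : perm_eq L L'.
  by rewrite -(heights_fst w L) -(heights_fst w' L') perm_map.
split=> //.
- exact: minimal_perm mi.
- rewrite /no_antipodes -(perm_all _ pL); apply: sub_all an => v.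
  by rewrite (perm_mem pL).
- by move=> v a; rewrite -(perm_mem pm); apply: mx.
- by move=> v; rewrite -(perm_mem pm) -!(permP pL); apply: ct.
Qed.

Lemma width_act g w L v : mdet g = 1 ->
  width (act g w) (map (act g) L) (act g v) = width w L v.
Proof.
move=> g1; rewrite /width heights_act // big_map /=.
by apply: eq_bigr => y _; rewrite det_act g1 mul1r.
Qed.

Lemma extremal_act g w L u h : mdet g = 1 -> extremal w L u h ->
  extremal (act g w) (map (act g) L) (act g u) h.
Proof.
move=> g1 [p mi an mx ct]; have gi := act_inj g1; split.
- exact: polygon_act.
- rewrite /minimal heights_act // all_map; apply: sub_all mi => x /=.
  by rewrite width_act.
- rewrite /no_antipodes all_map; apply: sub_all an => v /=.
  by rewrite -act_oppv mem_map.
- by move=> v a; rewrite heights_act // => /mapP [[v' a'] /mx /= h' [_ ->]].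
- move=> v; rewrite heights_act // => /mapP [[v' a'] va [-> e]].
  rewrite !count_map /=.
  rewrite (eq_count (a2 := pred1 v')); last by move=> y /=; rewrite inj_eq.
  rewrite [X in (_ <= X)%N](eq_count (a2 := pred1 u)); last by move=> y /=; rewrite inj_eq.
  by apply: ct; rewrite e.
Qed.

Lemma extremal_exists w L : polygon w L -> minimal w L -> no_antipodes L ->
  exists2 x, x \in heights w L & extremal w L x.1 x.2.
Proof.
move=> pw mi na.
(* The factor exceeds every multiplicity, so [f] compares heights first and multiplicities
   second. *)
pose f (x : vec * int) : int := x.2 * (size L).+1%:Z + (count_mem x.1 L)%:Z.
have [|[u h] xL xm] := @exists_max _ f (heights w L).
  by rewrite -size_eq0 size_heights size_eq0; case: pw.
exists (u, h) => //; split=> //= v.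
- move=> a /xm; rewrite /f /=.
  have := count_size (pred1 u) L.
  move: (count_mem u L) (count_mem v L) (size L); clear => c c' s.
  by move=> cs; rewrite leNgt => le; apply/negP; nia.
- by move=> /xm; rewrite /f /= lerD2l.
Qed.

(** The bottom edge runs on the line y = -h from (q - n h, -h) to (q, -h); [A] is the right side,
    going up, and [C] the left side, going down. The shears fixing (1, 0) move the right end point
    by multiples of h, whence the normalisation of [q]. *)
Record standard (h q : int) (n : nat) (A C : seq vec) : Prop := Standard {
  st_n : (0 < n)%N;
  st_q : 0 < q <= h;
  st_ex : extremal (q - n%:Z * h, - h) (nseq n (1, 0) ++ A ++ C) (1, 0) h;
  st_A : all (fun v : vec => 0 < v.2) A;
  st_C : all (fun v : vec => v.2 < 0) C;
  st_sortA : pairwise (fun x y => 0 <= det x y) A;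
  st_sortC : pairwise (fun x y => 0 <= det x y) C;
  st_nilA : A != [::];
  st_nilC : C != [::] }.

Lemma det_run_nseq w u n : det (run w (nseq n u)) u = det w u.
Proof. by elim: n w => //= n IH w; rewrite IH det_step. Qed.

(** Copies of [u] can occur at the start of the upper part and at the end of the lower part. These
    are cyclically adjacent, so moving the base point back collects them in one block. *)
Lemma block_form w L : polygon w L -> minimal w L -> no_antipodes L ->
  exists w' u h n A C, [/\ (0 < n)%N, meq L (nseq n u ++ A ++ C),
    extremal w' (nseq n u ++ A ++ C) u h, det w' u = h &
    [/\ all (fun v => 0 < det u v) A, all (fun v => det u v < 0) C,
     pairwise (fun x y => 0 <= det x y) A, pairwise (fun x y => 0 <= det x y) C &
     A != [::] /\ C != [::]]].
Proof.
move=> pw mi na; have [[u h] uL ex] := extremal_exists pw mi na.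
have [w1 [M [p1 pLM pH e1]]] := polygon_head pw uL.
rewrite [_.1]/= in p1 pLM pH ex; rewrite [_.2]/= in ex.
rewrite [_.1]/= [_.2]/= in e1.
have [X [Y [eM fr]]] := polygon_frame p1.
have ex1 := extremal_perm p1 pH ex.
have nu : oppv u \notin Y.
  have := allP (ex_anti ex1) u (mem_head _ _).
  by rewrite eM inE mem_cat !negb_or => /and3P [].
have eX : X = filter (pred1 u) X ++ filter (predC (pred1 u)) X.
  apply: pairwise_split; apply: pairwise_in (fr_sortX fr) => x y xX yX.
  move=> xy; apply/implyP => /eqP ey; rewrite ey in xy.
  have := allP (fr_up fr) _ xX => /orP [|//].
  by move: xy; rewrite (det_anti u); clear; lia.
have eY : Y = filter (predC (pred1 u)) Y ++ filter (predC (predC (pred1 u))) Y.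
  apply: pairwise_split; apply: sub_pairwise (fr_sortY fr) => x y /andP [_].
  by rewrite /=; case: (x == u); case: (y == u).
have tl (T : seq vec) : filter (pred1 u) T = nseq (count_mem u T) u.
  by rewrite -size_filter; apply/all_pred1P; exact: filter_all.
have eY2 : filter (predC (predC (pred1 u))) Y = filter (pred1 u) Y.
  by apply: eq_filter => y /=; rewrite negbK.
rewrite eY2 !tl in eX eY.
set A := filter _ X in eX; set C := filter _ Y in eY.
set a := count_mem u X in eX; set b := count_mem u Y in eY.
have eL : u :: M = (nseq a.+1 u ++ A ++ C) ++ nseq b u.
  by rewrite eM {1}eX {1}eY /= !catA.
have e2 : nseq (b + a.+1) u ++ A ++ C = nseq b u ++ nseq a.+1 u ++ A ++ C.
  by rewrite nseqD -catA.
have ex2 : extremal (run w1 (nseq a.+1 u ++ A ++ C)) (nseq (b + a.+1) u ++ A ++ C) u h.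
  rewrite e2; apply: extremal_perm ex1; first by apply: polygon_rot; rewrite -eL.
  by rewrite eL; apply: perm_heights_rot; rewrite -eL; case: p1.
exists (run w1 (nseq a.+1 u ++ A ++ C)), u, h, (b + a.+1)%N, A, C; split=> //.
- by rewrite addnS.
- apply: (meq_perm (meq_perm (meq_refl _) pLM)).
  by rewrite eL e2 perm_catC.
- have cl : run w1 ((nseq a.+1 u ++ A ++ C) ++ nseq b u) = w1 by rewrite -eL; case: p1.
  have : det (run (run w1 (nseq a.+1 u ++ A ++ C)) (nseq b u)) u = h.
    by rewrite -foldl_cat cl.
  by rewrite det_run_nseq.
split.
- apply/allP => x; rewrite mem_filter /= => /andP [xu /(allP (fr_up fr))].
  by rewrite (negbTE xu) orbF.
- apply/allP => y; rewrite mem_filter /= => /andP [yu yY].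
  have := allP (fr_down fr) _ yY; rewrite (negbTE yu) orbF => /orP [//|/eqP h'].
  by rewrite -h' yY in nu.
- by apply: pairwise_filter; case: fr.
- by apply: pairwise_filter; apply: sub_pairwise (fr_sortY fr) => x y /andP [].
split.
- have /hasP [x xX ux] := fr_hasX fr; apply/eqP => h0.
  have : x \in A.
    by rewrite mem_filter xX andbT /=; apply/eqP => e; move: ux; rewrite e det_self ltxx.
  by rewrite h0.
- have /hasP [x xX ux] := fr_hasY fr; apply/eqP => h0.
  have : x \in C.
    by rewrite mem_filter xX andbT /=; apply/eqP => e; move: ux; rewrite e det_self ltxx.
  by rewrite h0.
Qed.

Lemma standard_form w L : polygon w L -> minimal w L -> no_antipodes L ->
  exists h q n A C, meq L (nseq n (1, 0) ++ A ++ C) /\ standard h q n A C.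
Proof.
move=> pw mi na.
have [w1 [u [h [n [A [C [n0 me ex hu [aA aC sA sC [nA nC]]]]]]]]] := block_form pw mi na.
have pu : prim u.
  by have := poly_prim (ex_poly ex); case: (n) n0 => //= m _ /andP [].
have h0 : 0 < h.
  have := poly_pos (ex_poly ex); case: (n) n0 => //= m _; rewrite /pos_heights /=.
  by rewrite hu => /andP [].
have [g g1 gu] := exists_act_e1 pu.
(* The right end of the bottom edge has abscissa m + 1. Shearing by the quotient of m by h brings it
   to the remainder plus one, hence into the range 1, ..., h. *)
pose m := (act g w1).1 + n%:Z * h - 1.
pose s : mat := ((1, (m %/ h)%Z), (0, 1)).
have s1 : mdet s = 1 by rewrite /mdet /det /=; ring.
pose k := mmul s g.
have k1 : mdet k = 1 by rewrite mdet_mmul s1 g1.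
have ku : act k u = (1, 0).
  by rewrite act_mmul gu /act /=; congr pair; ring.
have w2 : (act g w1).2 = - h.
  by have := det_act g w1 u; rewrite g1 mul1r hu gu /det /=; clear; lia.
have d0 v : 0 < det u v -> 0 < (act k v).2.
  by rewrite -[det u v]mul1r -k1 -det_act ku /det /=; clear; lia.
have d1 v : det u v < 0 -> (act k v).2 < 0.
  by rewrite -[det u v]mul1r -k1 -det_act ku /det /=; clear; lia.
have kpw L' : pairwise (fun x y => 0 <= det x y) L' ->
    pairwise (fun x y => 0 <= det x y) (map (act k) L').
  rewrite pairwise_map; apply: sub_pairwise => x y /=.
  by rewrite det_act k1 mul1r.
exists h, ((m %% h)%Z + 1), n, (map (act k) A), (map (act k) C); split.
  have := meq_act k1 me; rewrite !map_cat map_nseq ku; exact.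
split=> //.
- have := modz_ge0 m (lt0r_neq0 h0); have := ltz_pmod m h0; move: h0; clear; lia.
- have := extremal_act k1 ex; rewrite !map_cat map_nseq ku.
  suff -> : act k w1 = ((m %% h)%Z + 1 - n%:Z * h, - h) by [].
  rewrite act_mmul; move: w2; rewrite /s /m.
  case: (act g w1) => x y /= ->; rewrite /act /=; congr pair; last by ring.
  have := divz_eq (x + n%:Z * h - 1) h; set M := x + n%:Z * h - 1.
  by rewrite /M; move: (M %/ h)%Z (M %% h)%Z (n%:Z * h) => c d e; clear; lia.
- by rewrite all_map; apply: sub_all aA => v; apply: d0.
- by rewrite all_map; apply: sub_all aC => v; apply: d1.
- exact: kpw.
- exact: kpw.
- by rewrite -size_eq0 size_map size_eq0.
- by rewrite -size_eq0 size_map size_eq0.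
Qed.

(** * Classification of minimal polygons *)

Lemma heights_rcons w L v :
  heights w (rcons L v) = rcons (heights w L) (v, det (run w L) v).
Proof. by rewrite -!cats1 heights_cat. Qed.

Lemma run_rcons w L v : run w (rcons L v) = step (run w L) v.
Proof. by rewrite -cats1 foldl_cat. Qed.

Lemma heights_nseq w n u : heights w (nseq n u) = nseq n (u, det w u).
Proof. by elim: n w => //= n IH w; rewrite IH det_step. Qed.

Lemma run_nseq w n u : run w (nseq n u) = axpy (n%:Z * det w u) u w.
Proof.
elim: n w => [|n IH] w /=; first by rewrite mul0r axpy0.
by rewrite IH det_step /step axpyA intS; congr axpy; ring.
Qed.

(** This certifies that a path has ended: every edge would advance strictly in the direction [f],
    but no displacement is left. *)
Lemma sum_heights_nil (f : vec -> int) w L :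
  pos_heights w L -> (forall v, v \in L -> 0 < f v) ->
  \sum_(x <- heights w L) x.2 * f x.1 <= 0 -> L = [::].
Proof.
case: L => // v L ps fp; rewrite /= big_cons /=.
have fv := fp v (mem_head _ _).
move: ps; rewrite /pos_heights /= => /andP [pv /allP ps].
set S := bigop.body _ _ _; suff S0 : 0 <= S.
  have := mulr_gt0 pv fv; move: (det w v * f v) S S0; clear => c S; lia.
rewrite /S big_seq_cond; apply: sumr_ge0 => x; rewrite andbT => xL.
apply: mulr_ge0; first exact/ltW/ps.
by apply/ltW/fp; rewrite inE (heights_mem xL) orbT.
Qed.

Lemma coprime_dvd_mul (a b c : int) : (exists x y, x * a + y * b = 1) ->
  (exists k, k * a = c * b) -> exists k, k * a = c.
Proof.
move=> [x [y e]] [k h]; exists (c * x + k * y).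
transitivity (c * (x * a + y * b)); last by rewrite e mulr1.
by rewrite mulrDr !mulrDl -!mulrA [y * a]mulrC [k * _]mulrA h; ring.
Qed.

(* The edges going up are k copies of (0, 1), of height q. *)
Section Upright.
Variables (h q : int) (n k : nat) (C : seq vec).
Let w0 : vec := (q - n%:Z * h, - h).
Let L := nseq n (1, 0) ++ nseq k (0, 1) ++ C.
Hypotheses (n0 : (0 < n)%N) (k0 : (0 < k)%N) (q0 : 0 < q) (qh : q <= h)
  (qn : q < n%:Z * h) (ex : extremal w0 L (1, 0) h)
  (aC : all (fun v : vec => v.2 < 0) C)
  (sC : pairwise (fun x y => 0 <= det x y) C) (nC : C != [::]).

Let z : vec := (q, k%:Z * q - h).

Lemma upright_run : run w0 (nseq n (1, 0) ++ nseq k (0, 1)) = z.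
Proof.
rewrite foldl_cat !run_nseq /w0 /z /axpy /det /=; congr pair; ring.
Qed.

Lemma upright_closed : run z C = w0.
Proof. by rewrite -upright_run -foldl_cat -catA; case: (ex_poly ex). Qed.

Lemma upright_heights :
  heights w0 L = nseq n ((1, 0), h) ++ nseq k ((0, 1), q) ++ heights z C.
Proof.
rewrite /L !heights_cat -foldl_cat upright_run !heights_nseq run_nseq.
have -> : det w0 (1, 0) = h by rewrite /w0 /det /=; ring.
suff -> : det (axpy (n%:Z * h) (1, 0) w0) (0, 1) = q by [].
by rewrite /w0 /det /=; ring.
Qed.

Lemma upright_pos : pos_heights z C.
Proof.
have := poly_pos (ex_poly ex).
by rewrite /pos_heights upright_heights !all_cat => /and3P [].
Qed.

Lemma upright_le (v : vec) (a : int) : (v, a) \in heights z C -> 0 < a <= h.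
Proof.
move=> va; have := allP upright_pos _ va => /= ->.
by apply: (ex_max ex (v := v)); rewrite upright_heights !mem_cat va !orbT.
Qed.

(** The last edge ends at [w0], strictly left of the vertical axis, so leaning right would give it a
    height above h; the sorting carries this over to the earlier edges. A vertical edge would be an
    antipode of (0, 1). *)
Lemma upright_neg (v : vec) : v \in C -> v.1 < 0.
Proof.
move=> vC; have e2 : v.2 < 0 := allP aC _ vC.
suff le0 : v.1 <= 0.
  rewrite lt_neqAle le0 andbT; apply/eqP => e1.
  have pv : prim v.
    by apply: (allP (poly_prim (ex_poly ex))); rewrite !mem_cat vC !orbT.
  have ev : v = oppv (0, 1).
    case/primP: pv => x [y]; rewrite e1 mulr0 add0r => e.
    rewrite [v]surjective_pairing e1 /oppv /= oppr0; congr pair.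
    by case: (mul_eq1 e) e2 => ->.
  have m01 : (0, 1) \in L by rewrite /L !mem_cat !mem_nseq k0 eqxx orbT.
  have := allP (ex_anti ex) _ m01; rewrite -ev => /negP; apply.
  by rewrite /L !mem_cat vC !orbT.
move: nC sC vC e2 aC upright_le upright_closed.
case/lastP: (C) => // D b _; rewrite pairwise_rcons all_rcons mem_rcons inE.
move=> /andP [/allP sb _] vD v2 /andP [b2 _] le; rewrite run_rcons => cl.
have b1 : b.1 <= 0.
  have := le b (det w0 b); rewrite -{1}cl det_step heights_rcons mem_rcons mem_head.
  move=> /(_ isT) /andP [_]; rewrite /w0 /det /=.
  by move: q0 qh qn b2; move: (n%:Z * h) => N; clear; nia.
have : v = b \/ 0 <= det v b by case/orP: vD => [/eqP|/sb]; [left|right].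
case=> [-> //|]; rewrite /det; move: v2 b2 b1; clear; nia.
Qed.

Lemma upright_sum1 : \sum_(x <- heights z C) x.2 * - x.1.1 = n%:Z * h.
Proof.
under eq_bigr do rewrite mulrN.
rewrite sumrN; have := run1 z C; rewrite upright_closed /=.
by move: (bigop.body _ _ _) => S; clear; lia.
Qed.

Lemma upright_sum2 : \sum_(x <- heights z C) x.2 * - x.1.2 = k%:Z * q.
Proof.
under eq_bigr do rewrite mulrN.
rewrite sumrN; have := run2 z C; rewrite upright_closed /=.
by move: (bigop.body _ _ _) => S; clear; lia.
Qed.

Lemma upright_width1 : 2 * h <= k%:Z * q.
Proof.
have := allP (ex_min ex) ((1, 0), h); rewrite upright_heights mem_cat mem_nseq n0 eqxx.
move/(_ isT) => /=; rewrite /width upright_heights !big_cat /= !big_nseq /det /=.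
rewrite big_seq_cond big1 ?addr0 => [|x /andP [/heights_mem xC _]]; last first.
  by have := allP aC _ xC => /= xl; rewrite max_l ?mulr0 //; move: xl; clear; lia.
rewrite !iter_addr_0 /=; clear; lia.
Qed.

Lemma upright_width2 : 2 * q <= n%:Z * h.
Proof.
have := allP (ex_min ex) ((0, 1), q).
rewrite upright_heights !mem_cat !mem_nseq k0 eqxx orbT.
move/(_ isT) => /=; rewrite /width upright_heights !big_cat /= !big_nseq /det /=.
rewrite -upright_sum1 !iter_addr_0.
rewrite (_ : \sum_(i <- heights z C) _ = \sum_(x <- heights z C) x.2 * - x.1.1).
  clear; lia.
rewrite big_seq_cond [RHS]big_seq_cond.
apply: eq_bigr => x /andP [/heights_mem xC _].
have x1 := upright_neg xC; rewrite mul0r mul1r sub0r max_r //.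
by rewrite oppr_ge0 ltW.
Qed.

Lemma upright_prim : exists x y, x * q + y * h = 1.
Proof.
have /primP [x [y e]] := poly_base (ex_poly ex); rewrite /w0 /= in e.
by exists x, (- y - x * n%:Z); rewrite -e; ring.
Qed.

Lemma upright_prim_mem v : v \in C -> prim v.
Proof.
move=> vC; apply: (allP (poly_prim (ex_poly ex))).
by rewrite /L !mem_cat vC !orbT.
Qed.

Lemma upright_first (f : vec) D : C = f :: D ->
  0 < - (q * - f.2 - (k%:Z * q - h) * - f.1) <= h.
Proof.
move=> eC; have /= := @upright_le f (det z f).
rewrite {1}eC /= mem_head => /(_ isT).
by rewrite /z /det /=; clear; lia.
Qed.

(** The first edge of [C] starts at (q, kq - h) with kq - h >= h. If it were flatter than the
    diagonal, its height would exceed h because q < h. Later edges are at least as steep. *)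
Lemma upright_below (v : vec) : q < h -> v \in C -> - v.1 <= - v.2.
Proof.
move=> qh' vC; have := upright_width1; have v1 := upright_neg vC.
have v2 : v.2 < 0 := allP aC _ vC.
case eC : C nC => [//|f D] _; have fC : f \in C by rewrite eC mem_head.
have f1 := upright_neg fC; have f2 : f.2 < 0 := allP aC _ fC.
have /andP [_ hf] := upright_first eC.
have : 0 <= det f v.
  move: vC sC; rewrite eC inE => /orP [/eqP ->|vD]; first by rewrite det_self.
  by move=> /= /andP [/allP /(_ _ vD)].
rewrite /det; move: q0 qh' v1 v2 f1 f2 hf; move: (k%:Z * q) => K.
clear; case: v f => [a b] [c d] /= q0 qh v1 v2 f1 f2 hf dt K2.
have cd : d <= c by nia.
by nia.
Qed.

Section Last.
Variables (D : seq vec) (b : vec).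
Hypothesis eC : C = rcons D b.

Lemma upright_bC : b \in C.
Proof. by rewrite eC mem_rcons mem_head. Qed.

Lemma upright_b : b.1 < 0 /\ b.2 < 0.
Proof. by split; [apply/upright_neg/upright_bC | apply/(allP aC)/upright_bC]. Qed.

Lemma upright_lastE : heights z C = rcons (heights z D) (b, det w0 b).
Proof.
rewrite eC heights_rcons; have := upright_closed.
by rewrite eC run_rcons => <-; rewrite det_step.
Qed.

Lemma upright_last : 0 < det w0 b <= h.
Proof. by apply: (@upright_le b); rewrite upright_lastE mem_rcons mem_head. Qed.

Lemma upright_lastdet : det w0 b = (n%:Z * h - q) * - b.2 - h * - b.1.
Proof. rewrite /w0 /det /=; ring. Qed.

Lemma upright_run_last : run z D = axpy (- det w0 b) b w0.
Proof.
have := upright_closed; rewrite eC run_rcons => <-.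
by rewrite det_step /step axpyA addNr axpy0.
Qed.

Lemma upright_sorted_last (v : vec) : v \in C -> 0 <= det v b.
Proof.
rewrite eC mem_rcons inE => /orP [/eqP ->|vD]; first by rewrite det_self.
by move: sC; rewrite eC pairwise_rcons => /andP [/allP /(_ _ vD)].
Qed.

Lemma upright_sumD1 :
  \sum_(x <- heights z D) x.2 * - x.1.1 = n%:Z * h - det w0 b * - b.1.
Proof.
rewrite -upright_sum1 upright_lastE -cats1 big_cat big_seq1 /=; ring.
Qed.

Lemma upright_sumD2 :
  \sum_(x <- heights z D) x.2 * - x.1.2 = k%:Z * q - det w0 b * - b.2.
Proof.
rewrite -upright_sum2 upright_lastE -cats1 big_cat big_seq1 /=; ring.
Qed.

Lemma upright_D (v : vec) : v \in D -> v \in C.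
Proof. by rewrite eC mem_rcons inE => ->; rewrite orbT. Qed.

Lemma upright_posD : pos_heights z D.
Proof.
by have := upright_pos; rewrite /pos_heights upright_lastE all_rcons => /andP [].
Qed.

Lemma upright_nilD : det w0 b * - b.1 = n%:Z * h -> D = [::].
Proof.
move=> e; apply: (@sum_heights_nil (fun v => - v.1) z) => //; first exact: upright_posD.
  by move=> v /upright_D /upright_neg; rewrite oppr_gt0.
by rewrite upright_sumD1 e subrr.
Qed.

Lemma upright_sumD_ge0 : det w0 b * - b.1 <= n%:Z * h.
Proof.
rewrite -subr_ge0 -upright_sumD1 big_seq_cond; apply: sumr_ge0 => x.
rewrite andbT => xD; apply: mulr_ge0; first exact/ltW/(allP upright_posD).
by rewrite oppr_ge0 ltW // upright_neg // upright_D // (heights_mem xD).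
Qed.

End Last.

Lemma upright_split : exists D b, C = rcons D b.
Proof. by case/lastP: (C) nC => // D b _; exists D, b. Qed.

Lemma upright_const (v : vec) : (forall x, x \in C -> x = v) ->
  exists m : nat, [/\ C = nseq m v, m%:Z * (det w0 v * - v.1) = n%:Z * h &
    m%:Z * (det w0 v * - v.2) = k%:Z * q].
Proof.
move=> cv; have eC : C = nseq (size C) v.
  by apply/all_pred1P/allP => x /cv ->; rewrite /= eqxx.
exists (size C); have zv : det z v = det w0 v.
  by rewrite -upright_closed eC det_run_nseq.
split=> //.
- rewrite -upright_sum1 {2}eC heights_nseq big_nseq iter_addr_0 /= zv.
  by rewrite -mulr_natl natz.
- rewrite -upright_sum2 {2}eC heights_nseq big_nseq iter_addr_0 /= zv.
  by rewrite -mulr_natl natz.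
Qed.

(** The last edge is at least as steep as the diagonal, so its height is at least (n - 1) h - q
    times [- b.2]. For n >= 3 this exceeds h. *)
Lemma upright_n_le2 : q < h -> (n <= 2)%N.
Proof.
move=> qh'; have [D [b eC]] := upright_split.
have := upright_last eC; have := upright_below qh' (upright_bC eC).
have [b1 b2] := upright_b eC; rewrite upright_lastdet => ab /andP [_].
rewrite leqNgt => hb; apply/negP => n3.
have N3 : 3 * h <= n%:Z * h by move: n3 q0 qh; clear; nia.
move: N3 hb ab b1 b2 q0 qh'; move: (n%:Z * h) => N; clear.
by case: b => c d /= N3 hb ab b1 b2 q0 qh; nia.
Qed.

Lemma prim_diag (v : vec) : prim v -> v.1 = v.2 -> v.1 < 0 -> v = (-1, -1).
Proof.
case: v => a b /primP [x [y /=]] + e; rewrite -e -mulrDl => /mul_eq1 [] -> //.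
Qed.

Lemma prim_double (v : vec) : prim v -> v.2 = 2 * v.1 -> v.1 < 0 -> v = (-1, -2).
Proof.
case: v => a b /primP [x [y /=]] + e.
rewrite e [y * _]mulrA -mulrDl => /mul_eq1 [] -> //.
Qed.

(** [q] divides 2h and is coprime to h. *)
Lemma upright_q2 : k%:Z * q = 2 * h -> q = 1 \/ q = 2.
Proof.
move=> e; have [x xq] : exists x, x * q = 2.
  by apply: (coprime_dvd_mul (b := h)); [exact: upright_prim | exists k%:Z].
move: q0 xq; clear => q0 xq; have x0 : 0 < x by nia.
have q2 : q <= 2 by nia.
by lia.
Qed.

Lemma upright_odd : q = 2 -> forall t, h <> 2 * t.
Proof.
move=> e t eh; have [x [y]] := upright_prim; rewrite e eh.
move: (y * t) (mulrA y 2 t) (mulrC y 2); clear; lia.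
Qed.

Lemma upright_double : h = 2 * q -> q = 1 /\ h = 2.
Proof.
move=> eh; have [x [y]] := upright_prim; rewrite eh mulrA -mulrDl => /mul_eq1.
by case=> e; move: q0; rewrite e.
Qed.

Lemma upright_triple : h = 3 * q -> q = 1 /\ h = 3.
Proof.
move=> eh; have [x [y]] := upright_prim; rewrite eh mulrA -mulrDl => /mul_eq1.
by case=> e; move: q0; rewrite e.
Qed.

(** The entries are the outcomes of three cases: n = 2 with q < h (three entries), n = 1 with q < h
    (nine entries) and q = h = 1 (four entries). *)
Definition upright_table : seq (nat * nat * seq vec) :=
  [:: (2, 4, nseq 4 (-1, -1)%R); (2, 6, nseq 3 (-1, -1)%R); (2, 3, nseq 6 (-1, -1)%R);
      (1, 6, nseq 3 (-1, -2)%R); (1, 8, nseq 2 (-1, -2)%R); (1, 5, nseq 5 (-1, -2)%R);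
      (1, 5, [:: (-2, -5)%R]); (1, 8, [:: (-1, -4)%R]); (1, 9, [:: (-1, -3)%R]);
      (1, 4, [:: (-1, -1)%R; (-1, -3)%R]); (1, 5, [:: (-1, -2)%R; (-1, -3)%R]);
      (1, 6, [:: (-1, -3)%R; (-1, -3)%R]);
      (3, 2, [:: (-3, -2)%R]); (3, 2, [:: (-2, -1)%R; (-1, -1)%R]);
      (4, 2, [:: (-2, -1)%R; (-2, -1)%R]); (3, 3, nseq 3 (-1, -1)%R)]%N.

(** If the last edge were strictly steeper than the diagonal, its height would exceed h. It is the
    steepest edge of [C], and no edge is flatter than the diagonal, so all edges are (-1, -1). With
    m of them, m (h - q) = 2h = kq, and q is 1 or 2. *)
Lemma upright_n2 : q < h -> n = 2%N -> (n, k, C) \in upright_table.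
Proof.
move=> qh' n2; have [D [b eC]] := upright_split.
have := upright_last eC; have := upright_below qh' (upright_bC eC).
have [b1 b2] := upright_b eC; rewrite upright_lastdet => ab /andP [_ hb].
have e : b.1 = b.2.
  move: hb ab b1 b2 q0 qh'; rewrite n2; clear.
  by case: b => c d /= hb ab b1 b2 q0 qh; nia.
have eb : b = (-1, -1) by apply: prim_diag => //; exact/upright_prim_mem/(upright_bC eC).
have cC v : v \in C -> v = (-1, -1).
  move=> vC; apply: prim_diag; [exact: upright_prim_mem| |exact: upright_neg].
  have := upright_sorted_last eC vC; have := upright_below qh' vC.
  by rewrite eb /det /=; clear; case: v => c d /=; lia.
have [m [-> e1 e2]] := upright_const cC.
move: e1 e2; rewrite /w0 /det /= n2 => e1 e2.
have kq : k%:Z * q = 2 * h by rewrite -e2 e1.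
have e3 : m%:Z * (h - q) = 2 * h by rewrite -e1; ring.
case: (upright_q2 kq) => q1.
- have : (m = 4%N /\ k = 4%N) \/ (m = 3%N /\ k = 6%N).
    move: e3 kq qh'; rewrite q1; clear => e3 kq h1.
    have m3 : (3 <= m)%N by nia.
    have h3 : h <= 3 by nia.
    have [e|e] : h = 2 \/ h = 3 by lia.
      by left; move: e3 kq; rewrite e; lia.
    by right; move: e3 kq; rewrite e; lia.
  by case=> [[-> ->]|[-> ->]].
- have : m = 6%N /\ k = 3%N.
    have h4 := upright_odd q1 (t := 2); have h6 := upright_odd q1 (t := 3).
    move: e3 kq qh' h4 h6; rewrite q1; clear => e3 kq h1 h4 h6.
    have m3 : (3 <= m)%N by nia.
    have hl : h <= 6 by nia.
    have [e|[e|[e|e]]] : h = 3 \/ h = 4 \/ h = 5 \/ h = 6 by lia.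
    + by move: e3 kq; rewrite e; lia.
    + by case: h4; rewrite e.
    + by move: e3; rewrite e; lia.
    + by case: h6; rewrite e.
  by case=> -> ->.
Qed.

Lemma sum_heights_zero (f : vec -> int) w' L' :
  pos_heights w' L' -> (forall v, v \in L' -> 0 <= f v) ->
  \sum_(x <- heights w' L') x.2 * f x.1 <= 0 -> forall v, v \in L' -> f v = 0.
Proof.
move=> /allP ps f0 s0 v vL; have [a va] := mem_heights w' vL.
have p0 x : x \in heights w' L' -> 0 <= x.2 * f x.1.
  by move=> xL; apply: mulr_ge0; [exact/ltW/ps | exact/f0/heights_mem/xL].
have : \sum_(x <- heights w' L') x.2 * f x.1 == 0.
  rewrite eq_le s0 big_seq_cond; apply: sumr_ge0 => x.
  by rewrite andbT; exact: p0.
rewrite big_seq_cond psumr_eq0 => [/allP /(_ _ va)|x]; last by rewrite andbT; exact: p0.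
rewrite va /= mulf_eq0 => /orP [] /eqP // a0.
by have := ps _ va; rewrite /= a0.
Qed.

(** The cases follow the steepest edge [b], the last one. If its slope is exactly 2, all edges of
    [C] are (-1, -2). Otherwise its height is at least h / 2, so it uses up at least half of the
    horizontal displacement h of [C], and few edges remain. *)
Lemma upright_n1 : q < h -> n = 1%N -> (n, k, C) \in upright_table.
Proof.
move=> qh' n1; have [D [b eC]] := upright_split; have bC := upright_bC eC.
have hq := upright_width2; have kq2 := upright_width1.
have lb := upright_last eC; have eb := upright_lastdet b.
have [b1 b2] := upright_b eC; have pb := upright_prim_mem bC.
have s1 := upright_sumD1 eC; have s2 := upright_sumD2 eC; have nD := upright_nilD eC.
have sD := upright_sumD_ge0 eC.
rewrite n1 !mul1r in hq eb s1 nD sD.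
have slope (v : vec) : v \in C -> 0 <= - v.1 * - b.2 - - v.2 * - b.1.
  by move/(upright_sorted_last eC); rewrite /det; clear; lia.
have sumE : \sum_(x <- heights z C) x.2 * (- x.1.1 * - b.2 - - x.1.2 * - b.1) =
    h * - b.2 - k%:Z * q * - b.1.
  have := upright_sum1; rewrite n1 mul1r => <-.
  rewrite -upright_sum2 !mulr_suml -sumrB; apply: eq_bigr => x _; ring.
have sum0 : 0 <= h * - b.2 - k%:Z * q * - b.1.
  rewrite -sumE big_seq_cond; apply: sumr_ge0 => x; rewrite andbT => xC.
  apply: mulr_ge0; first exact/ltW/(allP upright_pos).
  exact/slope/heights_mem/xC.
(* The slope of [C] as a whole is kq / h >= 2, and [b] is its steepest edge. *)
have be2 : 2 * - b.1 <= - b.2.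
  move: sum0 kq2 b1 b2 q0 qh'; move: (k%:Z * q) => K; clear.
  by case: (b) => c d /= *; nia.
have [e|ne] : - b.2 = 2 * - b.1 \/ 2 * - b.1 + 1 <= - b.2 by move: be2; clear; lia.
- have ebb : b = (-1, -2).
    by apply: prim_double => //; move: e; clear; lia.
  have cC (v : vec) : v \in C -> v = (-1, -2).
    move=> vC; apply: prim_double; [exact: upright_prim_mem| |exact: upright_neg].
    have H := sum_heights_zero upright_pos slope; rewrite sumE in H.
    have {}H := H _ v vC; rewrite ebb /= in H.
    suff K0 : h * - -2 - k%:Z * q * - -1 <= 0 by move: (H K0); clear; lia.
    by move: kq2; move: (k%:Z * q) => K; clear; lia.
  have [m [-> e1 e2]] := upright_const cC.
  move: e1 e2; rewrite /w0 /det /= n1 !mul1r => e1 e2.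
  have kq : k%:Z * q = 2 * h by rewrite -e2 -[X in 2 * X]e1; ring.
  have e3 : m%:Z * (h - 2 * q) = h by rewrite -[RHS]e1; ring.
  case: (upright_q2 kq) => q1.
  + have : (m = 3%N /\ k = 6%N) \/ (m = 2%N /\ k = 8%N).
      move: e3 kq qh'; rewrite q1; clear => e3 kq h1.
      have h2 : h <> 2 by move=> h2; move: e3; rewrite h2; lia.
      have m2 : (2 <= m)%N by nia.
      have h4 : h <= 4 by nia.
      have [e|e] : h = 3 \/ h = 4 by lia.
        by left; move: e3 kq; rewrite e; lia.
      by right; move: e3 kq; rewrite e; lia.
    by case=> [[-> ->]|[-> ->]].
  + have : m = 5%N /\ k = 5%N.
      have h4 := upright_odd q1 (t := 2); have h6 := upright_odd q1 (t := 3).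
      have h8 := upright_odd q1 (t := 4).
      move: e3 kq qh' h4 h6 h8; rewrite q1; clear => e3 kq h1 h4 h6 h8.
      have h3 : h <> 3 by move=> h2; move: e3; rewrite h2; lia.
      have m2 : (2 <= m)%N by nia.
      have hl : h <= 8 by nia.
      have [e|[e|[e|e]]] : h = 4 \/ h = 5 \/ h = 6 \/ (h = 7 \/ h = 8) by lia.
      * by case: h4; rewrite e.
      * by move: e3 kq; rewrite e; lia.
      * by case: h6; rewrite e.
      * by case: e => e; [move: e3; rewrite e; lia | case: h8; rewrite e].
    by case=> -> ->.
- set a := det w0 b in eb lb s1 s2 nD sD.
  (* Uses 2q <= h. Since the contribution a [- b.1] to the horizontal displacement is at most h,
     this leaves only 1 and 2 for [- b.1]. *)
  have a2 : h <= 2 * a.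
    move: ne hq b1 b2 q0; rewrite eb; clear; case: (b) => c d /= *; nia.
  have /andP [a0 ah] := lb.
  have al2 : - b.1 <= 2 by move: a2 sD a0 b1 q0 qh'; clear; nia.
  have [e1|e1] : b.1 = -2 \/ b.1 = -1 by move: al2 b1; clear; lia.
  + have ea : 2 * a = h by move: sD a2; rewrite e1; clear; lia.
    have D0 : D = [::] by apply: nD; rewrite e1 -ea mulrC.
    have b5 : b.2 = -5.
      move: ne ea eb hq; rewrite e1 => ne ea eb hq.
      by move: ne ea eb hq q0 qh'; clear; case: (b) => c d /= *; nia.
    have [q1 h2] : q = 1 /\ h = 2.
      by apply: upright_double; move: eb ea; rewrite e1 b5; clear; lia.
    have k5 : k = 5%N.
      move: s2; rewrite D0 big_nil b5 q1; move: ea; rewrite h2; clear; lia.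
    by rewrite n1 k5 eC D0 [b]surjective_pairing e1 b5.
  + have b3 : -4 <= b.2.
      move: ah eb hq qh' q0; rewrite e1; clear; case: (b) => c d /= *; nia.
    rewrite e1 opprK mulr1 in s1 nD sD.
    have [e2|e2] : b.2 = -4 \/ b.2 = -3 by move: b3 ne; rewrite e1; clear; lia.
    * have [q1 h2] : q = 1 /\ h = 2.
        by apply: upright_double; move: eb ah hq; rewrite e1 e2; clear; lia.
      have ea : a = 2 by move: eb; rewrite e1 e2 q1 h2; clear; lia.
      have D0 : D = [::] by apply: nD; rewrite ea h2.
      have k8 : k = 8%N by move: s2; rewrite D0 big_nil ea e2 q1; clear; lia.
      by rewrite n1 k8 eC D0 [b]surjective_pairing e1 e2.
    * have ea : a = 2 * h - 3 * q by rewrite eb e1 e2; ring.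
      have [D0|[D' [c eD]]] : D = [::] \/ exists D' c, D = rcons D' c.
        by case/lastP: (D) => [|D' c]; [left | right; exists D', c].
        have [q1 h2] : q = 1 /\ h = 3.
          by apply: upright_triple; move: s1; rewrite D0 big_nil ea; clear; lia.
        have k9 : k = 9%N.
          by move: s2; rewrite D0 big_nil ea e2 q1 h2; clear; lia.
        by rewrite n1 k9 eC D0 [b]surjective_pairing e1 e2.
      have cD : c \in D by rewrite eD mem_rcons mem_head.
      have cC := upright_D eC cD.
      have c1 := upright_neg cC; have c2 : c.2 < 0 := allP aC _ cC.
      have hc : det (run z D) c = (5 * h - 9 * q) * - c.1 - (h - 2 * q) * - c.2.
        rewrite (upright_run_last eC) -/a ea /w0 /det /= e1 e2 n1; ring.
      have eH : heights z D = rcons (heights z D') (c, det (run z D) c).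
        by rewrite {1}eD heights_rcons eD run_rcons det_step.
      set ac := det (run z D) c in hc eH.
      have sl := slope c cC; rewrite e1 e2 in sl.
      have pD' : pos_heights z D'.
        by have := upright_posD eC; rewrite /pos_heights eH all_rcons => /andP [].
      have s1' : \sum_(x <- heights z D') x.2 * - x.1.1 = h - a - ac * - c.1.
        by rewrite -s1 eH -cats1 big_cat big_seq1 /=; ring.
      have s0' : 0 <= h - a - ac * - c.1.
        rewrite -s1' big_seq_cond; apply: sumr_ge0 => x; rewrite andbT => xD.
        apply: mulr_ge0; first exact/ltW/(allP pD').
        rewrite oppr_ge0 ltW // upright_neg //; apply: (upright_D eC).
        by rewrite eD mem_rcons inE (heights_mem xD) orbT.
      (* The edge [c] before [b] is no steeper than [b], so its height is at least a times [- c.1].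
         The displacement left for it is h - a = 3q - h <= q <= a, hence equality holds throughout
         and h = 2q. *)
      have low : (2 * h - 3 * q) * - c.1 <= ac.
        by rewrite hc; move: sl hq c1 c2; clear; case: (c) => x y /= *; nia.
      have [ec1 ehq] : c.1 = -1 /\ h = 2 * q.
        have ec1 : c.1 = -1.
          move: s0' low hq c1 qh' q0; rewrite ea; clear; case: (c) => x y /=; nia.
        split=> //; move: s0' low hq; rewrite ea ec1; clear; lia.
      have [q1 h2] := upright_double ehq.
      have ac1 : ac = 1 by rewrite hc ec1 q1 h2; ring.
      have a1 : a = 1 by rewrite ea q1 h2.
      have D'0 : D' = [::].
        apply: (@sum_heights_nil (fun v => - v.1) z) => // [v vD|].
          rewrite oppr_gt0 upright_neg //; apply: (upright_D eC).
          by rewrite eD mem_rcons inE vD orbT.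
        by rewrite s1' h2 a1 ac1 ec1.
      have ek : k%:Z = 3 - c.2.
        by move: s2; rewrite eH D'0 big_seq1 /= ac1 a1 e2 q1; clear; lia.
      have eCC : C = [:: (-1, c.2); (-1, -3)].
        by rewrite eC eD D'0 /= [b]surjective_pairing [c]surjective_pairing e1 e2 ec1.
      have [e|[e|e]] : c.2 = -1 \/ c.2 = -2 \/ c.2 = -3.
        by move: sl c2; rewrite ec1; clear; lia.
      - have k4 : k = 4%N by move: ek; rewrite e; clear; lia.
        by rewrite n1 k4 eCC e.
      - have k4 : k = 5%N by move: ek; rewrite e; clear; lia.
        by rewrite n1 k4 eCC e.
      - have k4 : k = 6%N by move: ek; rewrite e; clear; lia.
        by rewrite n1 k4 eCC e.
Qed.

Lemma upright_eq : q = h -> q = 1.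
Proof.
move=> e; have [x [y]] := upright_prim; rewrite -e -mulrDl => /mul_eq1.
by case=> e'; move: q0; rewrite e'.
Qed.

Lemma upright_count : q = h -> (k <= n)%N.
Proof.
move=> e; have := ex_count ex (v := (0, 1)).
rewrite upright_heights !mem_cat !mem_nseq k0 e eqxx orbT => /(_ isT).
rewrite /L !count_cat !count_nseq /= !mul1n !mul0n !add0n.
suff -> : count_mem (1, 0) C = 0%N by rewrite addn0; apply: leq_trans (leq_addr _ _).
apply/eqP; rewrite -leqn0 leqNgt -has_count; apply/hasPn => v vC.
by apply/eqP => ev; have := allP aC _ vC; rewrite /= ev.
Qed.

(** All heights are 1, so over [C] the values [- v.1] sum to n and the values [- v.2] sum to k,
    where 2 <= k <= n because (1, 0) is most frequent. If [b] is the only edge, then (n - 1)(k - 1)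
    = 2. Otherwise its height condition gives [b] = (2 - n, -1), which leaves horizontal
    displacement 2, so at most two further edges. *)
Lemma upright_h1 : q = h -> (n, k, C) \in upright_table.
Proof.
move=> qh'; have q1 := upright_eq qh'; have h1 : h = 1 by rewrite -qh'.
have kn := upright_count qh'; have n2 : (2 <= n)%N.
  by move: qn; rewrite q1 h1; clear; lia.
have k2 : (2 <= k)%N by have := upright_width1; rewrite q1 h1; clear; lia.
have [D [b eC]] := upright_split; have bC := upright_bC eC.
have eb := upright_lastdet b; have [b1 b2] := upright_b eC.
have s1 := upright_sumD1 eC; have s2 := upright_sumD2 eC; have nD := upright_nilD eC.
have hv (v : vec) a : (v, a) \in heights z C -> a = 1.
  by move/upright_le; rewrite h1; clear; lia.
have e1 : det w0 b = 1.
  by apply: (hv b); rewrite (upright_lastE eC) mem_rcons mem_head.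
have hD (v : vec) a : (v, a) \in heights z D -> a = 1.
  by move=> va; apply: (hv v); rewrite (upright_lastE eC) mem_rcons inE va orbT.
rewrite e1 h1 q1 ?mulr1 !mul1r in eb s1 s2.
case eD : D => [|x D1].
  rewrite eD big_nil in s1; rewrite eD big_nil in s2.
  have [n3 k3] : n = 3%N /\ k = 2%N.
    move: s1 s2 eb k2 kn n2; clear; case: (b) => c d /= s1 s2 eb k2 kn n2.
    have ec : - c = n by lia.
    have ed : - d = k by lia.
    rewrite ec ed in eb; have k3 : (k < 3)%N by nia.
    have e : k = 2%N by lia.
    by rewrite e in eb *; lia.
  have ebb : b = (-3, -2).
    by rewrite [b]surjective_pairing; congr pair; move: s1 s2; rewrite n3 k3; clear; lia.
  by rewrite n3 k3 eC eD ebb.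
have xC : x \in C by rewrite eC eD mem_rcons !inE eqxx orbT.
have x1 := upright_neg xC; have x2 : x.2 < 0 := allP aC _ xC.
have dx : det z x = 1 by apply: (hD x); rewrite eD /= mem_head.
have sx := upright_sorted_last eC xC.
rewrite eD /= big_cons /= dx mul1r in s1; rewrite eD /= big_cons /= dx mul1r in s2.
have pD1 : pos_heights (step z x) D1.
  by have := upright_posD eC; rewrite /pos_heights eD /= => /andP [].
have neg1 (v : vec) : v \in D1 -> v.1 < 0 /\ v.2 < 0.
  move=> vD; have vC : v \in C by rewrite eC eD mem_rcons !inE vD !orbT.
  by split; [apply: upright_neg | apply: (allP aC)].
have t1 : 0 <= \sum_(j <- heights (step z x) D1) j.2 * - j.1.1.
  rewrite big_seq_cond; apply: sumr_ge0 => y; rewrite andbT => yD.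
  have [y1 y2] := neg1 _ (heights_mem yD).
  by apply: mulr_ge0; [exact/ltW/(allP pD1) | rewrite oppr_ge0 ltW].
have t2 : 0 <= \sum_(j <- heights (step z x) D1) j.2 * - j.1.2.
  rewrite big_seq_cond; apply: sumr_ge0 => y; rewrite andbT => yD.
  have [y1 y2] := neg1 _ (heights_mem yD).
  by apply: mulr_ge0; [exact/ltW/(allP pD1) | rewrite oppr_ge0 ltW].
set S1 := bigop.body _ _ _ in s1 t1; set S2 := bigop.body _ _ _ in s2 t2.
have [be1 al1] : b.2 = -1 /\ - b.1 = n%:Z - 2.
  have be1 : b.2 = -1.
    move: s1 s2 t1 t2 eb x1 x2 b1 b2 n2 kn k2; clear; case: (b) => c d; case: (x) => c' d' /=.
    move: S1 S2 => S1 S2 *; nia.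
  by split=> //; move: eb; rewrite be1; clear; lia.
have dzx : (k%:Z - 1) * - x.1 + x.2 = 1.
  by rewrite -[RHS]dx /z /det /= q1 h1; ring.
have sxb : 0 <= - x.1 * 1 - - x.2 * (n%:Z - 2).
  by move: sx; rewrite /det -al1 be1; clear; lia.
rewrite al1 in s1; rewrite be1 in s2.
have bE : b = (- (n%:Z - 2), -1).
  by rewrite [b]surjective_pairing -al1 be1 opprK.
case eD1 : D1 => [|y D2].
  have S10 : S1 = 0 by rewrite /S1 eD1 big_nil.
  have S20 : S2 = 0 by rewrite /S2 eD1 big_nil.
  have ex1 : x.1 = -2 by move: s1; rewrite S10; clear; lia.
  have [ek ex2] : k = 2%N /\ x.2 = -1.
    by move: s2 dzx; rewrite S20 ex1; clear; lia.
  have : n = 3%N \/ n = 4%N.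
    by move: sxb b1; rewrite ex1 ex2; move: al1; clear; lia.
  have xE : x = (-2, -1) by rewrite [x]surjective_pairing ex1 ex2.
  by case=> en; rewrite eC eD eD1 bE xE en ek.
have [y1 y2] : y.1 < 0 /\ y.2 < 0 by apply: neg1; rewrite eD1 mem_head.
have dy : det (step z x) y = 1.
  by apply: (hD y); rewrite eD eD1 /= inE mem_head orbT.
have S1E : S1 = - y.1 + \sum_(j <- heights (step (step z x) y) D2) j.2 * - j.1.1.
  by rewrite /S1 eD1 /= big_cons /= dy mul1r.
have S2E : S2 = - y.2 + \sum_(j <- heights (step (step z x) y) D2) j.2 * - j.1.2.
  by rewrite /S2 eD1 /= big_cons /= dy mul1r.
have pD2 : pos_heights (step (step z x) y) D2.
  by move: pD1; rewrite /pos_heights eD1 /= => /andP [].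
have D20 : D2 = [::].
  apply: (@sum_heights_nil (fun v => - v.1) (step (step z x) y)) => //.
    move=> v vD; rewrite oppr_gt0; apply: (proj1 (neg1 v _)).
    by rewrite eD1 inE vD orbT.
  move: S1E; set S := bigop.body _ _ _; move: s1 y1 x1; clear; lia.
rewrite D20 big_nil addr0 in S1E; rewrite D20 big_nil addr0 in S2E.
have [ex1 ey1] : x.1 = -1 /\ y.1 = -1 by move: s1 S1E y1 x1; clear; lia.
have sxy : 0 <= det x y.
  move: sC; rewrite eC eD eD1 pairwise_rcons => /andP [_] /= /andP [/andP [h' _] _].
  exact: h'.
have ey2 : y.2 = -1 by move: s2 S2E dzx; rewrite ex1; clear; lia.
have ex2 : x.2 = -1 by move: sxy; rewrite /det ex1 ey1 ey2; move: x2; clear; lia.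
have ek : k = 3%N by move: dzx; rewrite ex1 ex2; clear; lia.
have en : n = 3%N by move: sxb; rewrite ex1 ex2; move: kn; rewrite ek; clear; lia.
by rewrite eC eD eD1 D20 bE [x]surjective_pairing [y]surjective_pairing ex1 ex2 ey1 ey2 en ek.
Qed.

Lemma upright : (n, k, C) \in upright_table.
Proof.
have [qh'|qh'] : q < h \/ q = h by move: qh; clear; lia.
  have := upright_n_le2 qh'; case: (ltngtP n 1) n0 => [||n1 _ _].
  - by case: (n).
  - by move=> n1 _ n2; apply: upright_n2 => //; move: n1 n2; clear; lia.
  - exact: upright_n1.
exact: upright_h1.
Qed.

End Upright.

Lemma prim_e2 (v : vec) : prim v -> v.1 = 0 -> 0 < v.2 -> v = (0, 1).
Proof.
case: v => a b /primP [x [y /=]] + e; rewrite e mulr0 add0r => /mul_eq1 [] -> //.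
Qed.

Lemma prim_Ne2 (v : vec) : prim v -> v.1 = 0 -> v.2 < 0 -> v = (0, -1).
Proof.
case: v => a b /primP [x [y /=]] + e; rewrite e mulr0 add0r => /mul_eq1 [] -> //.
Qed.

Section Standard.
Variables (h q : int) (n : nat) (A C : seq vec).
Hypothesis st : standard h q n A C.
Let w0 : vec := (q - n%:Z * h, - h).
Let L := nseq n (1, 0) ++ A ++ C.
Let w1 : vec := (q, - h).
Let z := run w1 A.

Lemma std_base : run w0 (nseq n (1, 0)) = w1.
Proof. rewrite run_nseq /w0 /w1 /axpy /det /=; congr pair; ring. Qed.

Lemma std_poly : polygon w0 L.
Proof. by case: (st_ex st). Qed.

Lemma std_closed : run z C = w0.
Proof. by rewrite /z -std_base -!foldl_cat; case: std_poly. Qed.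

Lemma std_heights :
  heights w0 L = nseq n ((1, 0), h) ++ heights w1 A ++ heights z C.
Proof.
rewrite /L !heights_cat std_base heights_nseq.
suff -> : det w0 (1, 0) = h by [].
by rewrite /w0 /det /=; ring.
Qed.

Lemma std_le (v : vec) (a : int) :
  (v, a) \in heights w1 A ++ heights z C -> 0 < a <= h.
Proof.
move=> va; have vL : (v, a) \in heights w0 L by rewrite std_heights mem_cat va orbT.
have := allP (poly_pos std_poly) _ vL => /= ->.
exact: (ex_max (st_ex st) vL).
Qed.

Lemma std_memA (v : vec) : v \in A -> v \in L.
Proof. by move=> vA; rewrite /L !mem_cat vA orbT. Qed.

Lemma std_memC (v : vec) : v \in C -> v \in L.
Proof. by move=> vC; rewrite /L !mem_cat vC !orbT. Qed.

Lemma std_prim (v : vec) : v \in L -> prim v.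
Proof. exact: (allP (poly_prim std_poly)). Qed.

(** [z] is the highest vertex, so the width transverse to the bottom edge is [z.2] + h, and
    minimality makes it at least 2h. *)
Lemma std_top : h <= z.2.
Proof.
have := allP (ex_min (st_ex st)) ((1, 0), h).
rewrite -/w0 -/L std_heights mem_cat mem_nseq (st_n st) eqxx.
move/(_ isT) => /=; rewrite /width std_heights !big_cat /= big_nseq.
rewrite [X in _ + (_ + X)]big_seq_cond [X in _ + (_ + X)]big1 ?addr0; last first.
  move=> x /andP [/heights_mem xC _]; rewrite /det /=.
  by have /= xl := allP (st_C st) _ xC; rewrite max_l ?mulr0 //; move: xl; clear; lia.
rewrite iter_addr_0 det_self maxxx mulr0 mul0rn add0r /z run2 [w1.2]/=.
rewrite (_ : \sum_(i <- heights w1 A) i.2 * i.1.2 =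
  \sum_(i <- heights w1 A) i.2 * Num.max 0 (det (1, 0) i.1)).
  by move: (bigop.body _ _ _) => S; clear; lia.
rewrite big_seq_cond [RHS]big_seq_cond; apply: eq_bigr => x /andP [/heights_mem xA _].
by have /= xl := allP (st_A st) _ xA; rewrite /det /= mul1r mul0r subr0 max_r // ltW.
Qed.

Lemma std_first (f : vec) A' : A = f :: A' -> 0 < q * f.2 + h * f.1 <= h.
Proof.
move=> eA; have := @std_le f (det w1 f); rewrite {1}eA /= inE eqxx => /(_ isT).
by rewrite /w1 /det /= mulNr opprK.
Qed.

Lemma std_lastA A' (v : vec) : A = rcons A' v -> 0 < det z v <= h.
Proof.
move=> eA; apply: (std_le (v := v)); rewrite mem_cat; apply/orP; left.
by rewrite {1}eA heights_rcons /z eA run_rcons det_step mem_rcons mem_head.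
Qed.

Lemma std_firstC (f : vec) C' : C = f :: C' -> 0 < det z f <= h.
Proof.
by move=> eC; apply: (std_le (v := f)); rewrite mem_cat eC /= !inE eqxx orbT.
Qed.

Lemma std_lastC C' (v : vec) : C = rcons C' v -> 0 < det w0 v <= h.
Proof.
move=> eC; apply: (std_le (v := v)); rewrite mem_cat; apply/orP; right.
by rewrite -{1}std_closed eC heights_rcons run_rcons det_step mem_rcons mem_head.
Qed.

Lemma std_A_le0 (v : vec) : v \in A -> v.1 <= 0.
Proof.
case eA : A (st_nilA st) => [//|f A'] _ vA.
have /andP [_ hf] := std_first eA.
have f2 : 0 < f.2 by apply: (allP (st_A st)); rewrite eA mem_head.
have v2 : 0 < v.2 by apply: (allP (st_A st)); rewrite eA.
have f1 : f.1 <= 0 by move: hf f2 (st_q st); clear; nia.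
have : 0 <= det f v.
  move: vA (st_sortA st); rewrite eA inE => /orP [/eqP ->|vA]; first by rewrite det_self.
  by move=> /= /andP [/allP /(_ _ vA)].
by rewrite /det; move: f1 f2 v2; clear; nia.
Qed.

Lemma std_C_le0 (v : vec) : q < n%:Z * h -> v \in C -> v.1 <= 0.
Proof.
move=> qn; case/lastP eC : C (st_nilC st) => [//|C' f] _ vC.
have /andP [_ hf] := std_lastC eC.
have f2 : f.2 < 0 by apply: (allP (st_C st)); rewrite eC mem_rcons mem_head.
have v2 : v.2 < 0 by apply: (allP (st_C st)); rewrite eC.
have f1 : f.1 <= 0.
  move: hf f2 qn (st_q st); rewrite /w0 /det /=; move: (n%:Z * h) => N.
  by clear; case: f => a b /=; nia.
have : 0 <= det v f.
  move: vC (st_sortC st); rewrite eC mem_rcons inE.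
  move=> /orP [/eqP ->|vC]; first by rewrite det_self.
  by rewrite pairwise_rcons => /andP [/allP /(_ _ vC)].
by rewrite /det; move: f1 f2 v2; clear; nia.
Qed.

Lemma std_q1 : q = h -> q = 1.
Proof.
move=> e; have /primP [x [y]] := poly_base std_poly.
rewrite /w0 /= e (_ : _ + _ = (x - x * n%:Z - y) * h); last by ring.
by move/mul_eq1 => [] // h1; have := st_q st; rewrite e h1.
Qed.

Lemma std_coord1 : z.1 = q + \sum_(x <- heights w1 A) x.2 * x.1.1.
Proof. by rewrite /z run1. Qed.

Lemma std_coord2 : z.2 = - h + \sum_(x <- heights w1 A) x.2 * x.1.2.
Proof. by rewrite /z run2. Qed.

Lemma std_vertical (v : vec) A' : A = rcons A' v -> v.1 = 0 ->
  exists k : nat, (0 < k)%N /\ A = nseq k (0, 1).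
Proof.
move=> eA v1; exists (size A); split.
  by rewrite lt0n size_eq0; case: st.
apply/all_pred1P/allP => x xA /=; apply/eqP; apply: prim_e2.
- exact/std_prim/std_memA.
- have x0 := std_A_le0 xA; have v2 : 0 < v.2.
    by apply: (allP (st_A st)); rewrite eA mem_rcons mem_head.
  have : 0 <= det x v.
    move: xA (st_sortA st); rewrite eA mem_rcons inE.
    move=> /orP [/eqP ->|xA]; first by rewrite det_self.
    by rewrite pairwise_rcons => /andP [/allP /(_ _ xA)].
  by rewrite /det v1; move: x0 v2; clear; nia.
- exact: (allP (st_A st)).
Qed.

End Standard.

Lemma sum_heights_ge0 (f : vec -> int) w L :
  pos_heights w L -> (forall v, v \in L -> 0 <= f v) ->
  0 <= \sum_(x <- heights w L) x.2 * f x.1.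
Proof.
move=> /allP ps f0; rewrite big_seq_cond; apply: sumr_ge0 => x; rewrite andbT => xL.
by apply: mulr_ge0; [exact/ltW/ps | exact/f0/heights_mem/xL].
Qed.

Lemma sum_heights_opp (f : vec -> int) (H : seq (vec * int)) :
  \sum_(x <- H) x.2 * - f x.1 = - \sum_(x <- H) x.2 * f x.1.
Proof. by under eq_bigr do rewrite mulrN; rewrite sumrN. Qed.

Lemma extremal_mir w L u h :
  extremal w L u h -> extremal (mirw w) (rev (map mir L)) (mir u) h.
Proof.
move=> [p mi an mx ct]; have ph := perm_heights_mir (poly_closed p).
have mi_inj : injective mir by apply: can_inj mirK.
have cnt v : count_mem (mir v) (rev (map mir L)) = count_mem v L.
  rewrite count_rev count_map; apply: eq_count => x /=.
  by rewrite (inj_eq mi_inj).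
split.
- exact: polygon_mir.
- rewrite /minimal (perm_all _ ph) all_map; apply: sub_all mi => x /=.
  rewrite -(width_opp _ (poly_closed p)) /width (perm_big _ ph) /= big_map.
  suff -> : \sum_(y <- heights w L) y.2 * Num.max 0 (det (oppv x.1) y.1) =
    \sum_(j <- heights w L) j.2 * Num.max 0 (det (mir x.1) (mir j.1)) by [].
  by apply: eq_bigr => y _; rewrite det_mir det_oppl -det_anti.
- rewrite /no_antipodes all_rev all_map; apply: sub_all an => v /=.
  by rewrite mem_rev -[oppv (mir v)]/(mir (oppv v)) mem_map.
- by move=> v a; rewrite (perm_mem ph) => /mapP [[v' a'] /mx /= h' [_ ->]].
- move=> v; rewrite (perm_mem ph) => /mapP [[v' a'] va [-> e]].
  by rewrite !cnt; apply: ct; rewrite e.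
Qed.

Definition upright_forms : seq (seq vec) :=
  [seq nseq t.1.1 (1, 0) ++ nseq t.1.2 (0, 1) ++ t.2 | t <- upright_table].

Definition leaning_forms : seq (seq vec) :=
  [:: [:: (1, 0); (1, 0); (-1, 2); (-1, -2)];
      [:: (1, 0); (1, 0); (-1, 2); (-1, -1); (0, -1)];
      [:: (1, 0); (1, 0); (1, 0); (-1, 2); (-1, -1); (-1, -1)];
      [:: (1, 0); (1, 0); (0, 1); (-1, 1); (-1, -2)];
      [:: (1, 0); (1, 0); (1, 0); (0, 1); (-1, 1); (-1, -1); (-1, -1)]].

Definition thin_forms : seq (seq vec) :=
  [:: [:: (1, 0); (-2, 3); (1, -3)]; [:: (1, 0); (-2, 3); (0, -1); (1, -2)];
      [:: (1, 0); (-1, 2); (-1, 1); (1, -3)]; [:: (1, 0); (0, 1); (-2, 1); (1, -2)];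
      [:: (1, 0); (-1, 2); (-1, -1); (1, -1)]].

Section Cases.
Variables (h q : int) (n : nat) (A C : seq vec).
Hypothesis st : standard h q n A C.
Let w0 : vec := (q - n%:Z * h, - h).
Let L := nseq n (1, 0) ++ A ++ C.
Let w1 : vec := (q, - h).
Let z := run w1 A.

Lemma std_upright k : q < n%:Z * h -> (0 < k)%N -> A = nseq k (0, 1) ->
  L \in upright_forms.
Proof.
move=> qn k0 eA; have [n0 /andP [q0 qh] ex _ aC _ sC _ nC] := st.
rewrite eA in ex; apply/mapP; exists (n, k, C); last by rewrite /L eA.
exact: (upright n0 k0 q0 qh qn ex aC sC nC).
Qed.

(** Reflection in the vertical axis exchanges the two sides, so a vertical left side becomes the
    upright right side of the reflected polygon, whose bottom edge ends at abscissa n h - q. *)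
Lemma std_upright_mir k : q < n%:Z * h -> n%:Z * h - q <= h -> (0 < k)%N ->
  C = nseq k (0, -1) -> exists2 F, F \in upright_forms & perm_eq (map mir L) F.
Proof.
move=> qn ph k0 eC; have [n0 /andP [q0 qh] ex aA _ sA _ nA _] := st.
pose A' := rev (map mir A); pose p := n%:Z * h - q.
have eL : rev (map mir L) = (nseq k (0, 1) ++ A') ++ nseq n (1, 0).
  rewrite /L eC !map_cat !rev_cat !map_nseq.
  by rewrite !rev_nseq -catA.
have p1 : run w1 (A ++ C) = w0 by rewrite foldl_cat; exact: std_closed.
have [_ hm] := heights_mir w1 (A ++ C); rewrite p1 in hm.
have em : rev (map mir (A ++ C)) = nseq k (0, 1) ++ A'.
  by rewrite eC map_cat rev_cat map_nseq rev_nseq.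
rewrite em in hm.
have pr : perm_eq (heights (mirw w0) ((nseq k (0, 1) ++ A') ++ nseq n (1, 0)))
   (heights (mirw w1) (nseq n (1, 0) ++ nseq k (0, 1) ++ A')).
  rewrite -hm; apply: perm_heights_rot; rewrite -eL.
  exact: (poly_closed (polygon_mir (ex_poly ex))).
have ex' : extremal (mirw w1) (nseq n (1, 0) ++ nseq k (0, 1) ++ A') (1, 0) h.
  have exm := extremal_mir ex; rewrite -/w0 -/L eL in exm.
  apply: (extremal_perm _ pr exm); rewrite -hm; apply: polygon_rot.
  exact: (ex_poly exm).
have ew : mirw w1 = (p - n%:Z * h, - h) by rewrite /mirw /w1 /p /=; congr pair; ring.
rewrite ew in ex'.
have pq : p < n%:Z * h by rewrite /p; move: q0; clear; lia.
have p0 : 0 < p by rewrite /p; move: qn; clear; lia.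
have aA' : all (fun v : vec => v.2 < 0) A'.
  by rewrite /A' all_rev all_map; apply: sub_all aA => v /=; rewrite oppr_lt0.
have sA' : pairwise (fun x y => 0 <= det x y) A'.
  rewrite /A'; elim: (A) sA => //= x B IH /andP [xB sB].
  rewrite rev_cons pairwise_rcons IH // andbT all_rev all_map.
  by apply: sub_all xB => y /=; rewrite det_mir.
have nA' : A' != [::] by rewrite -size_eq0 size_rev size_map size_eq0.
exists (nseq n (1, 0) ++ nseq k (0, 1) ++ A').
  apply/mapP; exists (n, k, A') => //.
  exact: (upright n0 k0 p0 ph pq ex' aA' sA' nA').
by rewrite -(perm_rev (map mir L)) eL perm_catC.
Qed.

Lemma pos_heightsA : pos_heights w1 A.
Proof.
by apply/allP => -[v a] va; have := std_le st (v := v) (a := a);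
  rewrite mem_cat va => /(_ isT) /andP [].
Qed.

Lemma pos_heightsC : pos_heights z C.
Proof.
by apply/allP => -[v a] va; have := std_le st (v := v) (a := a);
  rewrite mem_cat va orbT => /(_ isT) /andP [].
Qed.

Lemma std_antipode (v : vec) : v \in L -> oppv v \in L -> False.
Proof. by move=> vL nL; have := allP (ex_anti (st_ex st)) _ vL; rewrite nL. Qed.

(** The last edge of [A] leans left and ends at [z] with [z.2] >= h; a height of at most h forces
    [v.1] = -1 and [z] = (0, h). This edge alone moves the path left by h >= q, hence q = h = 1 and
    all other edges of [A] are vertical. *)
Lemma std_leaning A' (v : vec) : q < n%:Z * h -> 0 <= z.1 -> A = rcons A' v ->
  v.1 < 0 -> L \in leaning_forms.
Proof.
move=> qn z1 eA v1; have top : h <= z.2 := std_top st.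
have /andP [q0 qh] := st_q st.
have v2 : 0 < v.2 by apply: (allP (st_A st)); rewrite eA mem_rcons mem_head.
have /andP [_ hv] := std_lastA st eA; rewrite -/w1 -/z in hv.
have [ev1 [ez1 ez2]] : v.1 = -1 /\ (z.1 = 0 /\ z.2 = h).
  move: hv z1 top v1 v2 q0 qh; rewrite /det; clear.
  case: z => a b; case: v => c d /= hv z1 top v1 v2 q0 qh.
  have ec : c = -1 by nia.
  by rewrite ec in hv *; split=> //; nia.
have hvE : det z v = h by rewrite /det ez1 ez2 ev1; ring.
have eH : heights w1 A = rcons (heights w1 A') (v, h).
  by rewrite {1}eA heights_rcons -hvE /z eA run_rcons det_step.
have pA' : pos_heights w1 A'.
  by have := pos_heightsA; rewrite /pos_heights eH all_rcons => /andP [].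
have A'A (x : vec) : x \in A' -> x \in A by move=> xA; rewrite eA mem_rcons inE xA orbT.
have le0 (x : vec) : x \in A' -> 0 <= - x.1.
  by move/A'A/(std_A_le0 st); rewrite oppr_ge0.
have s1 := std_coord1 h q A; rewrite -/w1 -/z ez1 eH -cats1 big_cat big_seq1 /= ev1 in s1.
have s1' := sum_heights_opp (fun x : vec => x.1) (heights w1 A').
have g1 := sum_heights_ge0 pA' le0; rewrite s1' in g1.
pose S : int := \sum_(x <- heights w1 A') x.2 * x.1.1.
have {}s1 : 0 = q + (S + h * -1) := s1.
have {}g1 : 0 <= - S := g1.
have qh' : q = h by move: s1 g1 qh; clear; lia.
have q1 := std_q1 st qh'; have h1 : h = 1 by rewrite -qh'.
have z0 (x : vec) : x \in A' -> - x.1 = 0.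
  apply: (sum_heights_zero pA' le0).
  by rewrite s1' -[X in - X]/S; move: s1 qh'; clear; lia.
have eA' : A' = nseq (size A') (0, 1).
  apply/all_pred1P/allP => x xA /=; apply/eqP; apply: prim_e2.
  - exact/(std_prim st)/(std_memA _ _)/A'A.
  - by have := z0 _ xA; clear; lia.
  - exact/(allP (st_A st))/A'A.
have s2 := std_coord2 h q A; rewrite -/w1 -/z ez2 eH -cats1 big_cat big_seq1 /= in s2.
have hw1 : det w1 (0, 1) = 1 by rewrite /w1 /det /= q1; ring.
rewrite eA' heights_nseq big_nseq iter_addr_0 /= hw1 h1 in s2.
have jv : (size A')%:Z + v.2 = 2 by move: s2; rewrite -mulr_natl natz; clear; lia.
have eAA : A = [:: (-1, 2)] \/ A = [:: (0, 1); (-1, 1)].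
  have -> : A = rcons (nseq (size A') (0, 1)) (-1, v.2).
    by rewrite -eA' -ev1 -surjective_pairing.
  have [[-> ->]|[-> ->]] : (size A' = 0%N /\ v.2 = 2) \/ (size A' = 1%N /\ v.2 = 1).
    by move: jv v2; clear; lia.
  by left. by right.
have zE : z = (0, 1) by rewrite [z]surjective_pairing ez1 ez2 h1.
have c1 (x : vec) : x \in C -> x.1 <= 0 by apply: (std_C_le0 st qn).
have c2 (x : vec) : x \in C -> x.2 < 0 := allP (st_C st) x.
have hC (x : vec) a : (x, a) \in heights z C -> a = 1.
  move=> xC; have := std_le st (v := x) (a := a).
  by rewrite mem_cat xC orbT h1 => /(_ isT); clear; lia.
(* [C] descends from ordinate 1 to -1 and all its heights are 1, so it has at most two edges. *)
have t1 := run1 z C; have t2 := run2 z C.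
rewrite [run z C](std_closed st) zE /= q1 h1 ?mulr1 in t1 t2.
have pC := pos_heightsC; rewrite zE in pC hC.
case eC : C (st_nilC st) => [//|f C1] _.
have fC : f \in C by rewrite eC mem_head.
have df : det (0, 1) f = 1 by apply: (hC f); rewrite eC /= mem_head.
have ef1 : f.1 = -1 by move: df; rewrite /det /=; clear; lia.
rewrite eC /= big_cons /= df mul1r ef1 in t1; rewrite eC /= big_cons /= df mul1r in t2.
rewrite eC /pos_heights /= in pC; have /andP [_ pC1] := pC.
have f2 := c2 _ fC.
have n2 : L = nseq n (1, 0) ++ A ++ C by [].
case eC1 : C1 => [|g C2].
  rewrite eC1 big_nil in t1; rewrite eC1 big_nil in t2.
  have en : n = 2%N by move: t1; clear; lia.
  have ef2 : f.2 = -2 by move: t2; clear; lia.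
  by rewrite n2 en eC eC1 [f]surjective_pairing ef1 ef2; case: eAA => ->.
have gC : g \in C by rewrite eC eC1 !inE eqxx orbT.
have dg : det (step (0, 1) f) g = 1.
  by apply: (hC g); rewrite eC eC1 /= !inE eqxx orbT.
rewrite eC1 /= big_cons /= dg mul1r in t1; rewrite eC1 /= big_cons /= dg mul1r in t2.
have pC2 : pos_heights (step (step (0, 1) f) g) C2.
  by move: pC1; rewrite eC1 /pos_heights /= => /andP [].
have c2' (x : vec) : x \in C2 -> 0 < - x.2.
  by move=> xC; rewrite oppr_gt0; apply: c2; rewrite eC eC1 !inE xC !orbT.
have s2o := sum_heights_opp (fun x : vec => x.2) (heights (step (step (0, 1) f) g) C2).
have C20 : C2 = [::].
  apply: (sum_heights_nil pC2 c2').
  by rewrite /= in s2o *; rewrite s2o; have := c2 _ gC; move: t2 f2; clear; lia.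
rewrite C20 big_nil in t1; rewrite C20 big_nil in t2.
have g2 := c2 _ gC; have g1' := c1 _ gC.
have [ef2 eg2] : f.2 = -1 /\ g.2 = -1 by move: t2 f2 g2; clear; lia.
have sfg : 0 <= det f g.
  by have := st_sortC st; rewrite eC eC1 /= => /andP [/andP []].
have [eg1|eg1] : g.1 = 0 \/ g.1 = -1.
  by move: sfg; rewrite /det ef1 ef2 eg2; move: g1'; clear; lia.
- have en : n = 2%N by move: t1; rewrite eg1; clear; lia.
  have gE : g = (0, -1) by rewrite [g]surjective_pairing eg1 eg2.
  case: eAA => eAA.
    by rewrite n2 en eC eC1 C20 [f]surjective_pairing ef1 ef2 gE eAA.
  case: (@std_antipode (0, 1)); first by apply: std_memA; rewrite eAA.
  by apply: std_memC; rewrite -[oppv _]/(0, -1) -gE.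
- have en : n = 3%N by move: t1; rewrite eg1; clear; lia.
  have gE : g = (-1, -1) by rewrite [g]surjective_pairing eg1 eg2.
  by rewrite n2 en eC eC1 C20 [f]surjective_pairing ef1 ef2 gE; case: eAA => ->.
Qed.

End Cases.

Lemma uniq_count_le1 (T : eqType) (s : seq T) :
  (forall x, x \in s -> (count_mem x s <= 1)%N) -> uniq s.
Proof.
elim: s => //= x s IH h; apply/andP; split.
  apply/negP => xs; have := h x (mem_head _ _); rewrite eqxx -(leq_add2l 1) /=.
  by move: xs; rewrite -has_pred1 has_count; case: (count_mem x s).
apply: IH => y ys; apply: leq_trans (h y _); first by rewrite leq_addl.
by rewrite inE ys orbT.
Qed.

Lemma uniq_catr (T : eqType) (s t : seq T) : uniq (s ++ t) -> uniq t.
Proof. by rewrite cat_uniq => /and3P []. Qed.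

Lemma uniq_catl (T : eqType) (s t : seq T) : uniq (s ++ t) -> uniq s.
Proof. by rewrite cat_uniq => /and3P []. Qed.

Lemma det_prim_gt0 (u v w : vec) : prim u -> prim v -> 0 < det w u -> 0 < det w v ->
  u != v -> 0 <= det u v -> 0 < det u v.
Proof.
move=> pu pv wu wv uv; rewrite le_eqVlt => /orP [/eqP e|//].
have [ev|ev] := prim_par pu pv (esym e); first by rewrite ev eqxx in uv.
by move: wu wv; rewrite ev det_oppr; clear; lia.
Qed.

Section Thin.
Variables (A C : seq vec).
Hypothesis st : standard 1 1 1 A C.
Let w1 : vec := (1, -1).
Let z := run w1 A.
Let L := (1, 0) :: A ++ C.

Lemma thin_height (v : vec) (a : int) : (v, a) \in heights w1 A ++ heights z C -> a = 1.
Proof. by move/(std_le st); clear; lia. Qed.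

(** All heights are 1, so the choice of (1, 0) as a most frequent edge of maximal height bounds
    every multiplicity by its own, which is 1. *)
Lemma thin_uniq : uniq (A ++ C).
Proof.
have : uniq L.
  apply: uniq_count_le1 => v vL; have [a va] := mem_heights (1 - 1%:Z * 1, -1) vL.
  have ea : a = 1.
    move: va; rewrite (std_heights 1 1 1 A C) mem_cat => /orP [|/thin_height //].
    by rewrite inE => /eqP [].
  rewrite ea in va; have := ex_count (st_ex st) va.
  suff -> : count_mem (1, 0) (nseq 1 (1, 0) ++ A ++ C) = 1%N by [].
  suff c0 : count_mem (1, 0) (A ++ C) = 0%N by rewrite /= c0.
  apply/eqP; rewrite -leqn0 leqNgt -has_count; apply/hasPn => x.
  rewrite mem_cat => /orP [] xm; apply/eqP => ex.
    by have := allP (st_A st) _ xm; rewrite /= ex.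
  by have := allP (st_C st) _ xm; rewrite /= ex.
by rewrite /L /= => /andP [].
Qed.

Lemma thin_sortA : pairwise (fun x y => 0 < det x y) A.
Proof.
have := uniq_catl thin_uniq; rewrite uniq_pairwise => u.
have : pairwise (fun x y => (x != y) && (0 <= det x y)) A.
  by rewrite pairwise_relI u; case: st.
apply: pairwise_in => x y xA yA /andP [xy]; apply: (@det_prim_gt0 x y (1, 0)) => //.
- exact/(std_prim st)/std_memA.
- exact/(std_prim st)/std_memA.
- by have := allP (st_A st) _ xA; rewrite /det /=; clear; lia.
- by have := allP (st_A st) _ yA; rewrite /det /=; clear; lia.
Qed.

Lemma thin_sortC : pairwise (fun x y => 0 < det x y) C.
Proof.
have := uniq_catr thin_uniq; rewrite uniq_pairwise => u.
have : pairwise (fun x y => (x != y) && (0 <= det x y)) C.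
  by rewrite pairwise_relI u; case: st.
apply: pairwise_in => x y xA yA /andP [xy]; apply: (@det_prim_gt0 x y (-1, 0)) => //.
- exact/(std_prim st)/std_memC.
- exact/(std_prim st)/std_memC.
- by have := allP (st_C st) _ xA; rewrite /det /=; clear; lia.
- by have := allP (st_C st) _ yA; rewrite /det /=; clear; lia.
Qed.

(* After an edge leaning to the left all later edges going up lean to the
   left, and each moves the path by at least one unit. *)
Lemma thin_exhausted (w : vec) (g : vec) B : g.1 < 0 -> 0 < g.2 ->
  all (fun v : vec => 0 < v.2) B -> pairwise (fun x y => 0 < det x y) (g :: B) ->
  pos_heights w B -> 0 <= \sum_(x <- heights w B) x.2 * x.1.1 -> B = [::].
Proof.
move=> g1 g2 /allP aB /= /andP [/allP gB _] pB s0.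
apply: (@sum_heights_nil (fun v => - v.1) w) => //; last first.
  by rewrite sum_heights_opp oppr_le0.
move=> v vB; have := gB v vB; have := aB v vB => /=; rewrite /det.
by move: g1 g2; clear; nia.
Qed.

(** Starting at (1, -1), an edge of height 1 has the form (-t, 1 + t) with t >= 0. Every edge
    leaning left consumes at least one of the s units of leftward displacement, and at most one edge
    is vertical. *)
Lemma thin_A (s : int) : z.1 = 1 - s -> 1 <= z.2 ->
  (s = 1 -> A = [:: (-1, 2)] \/ A = [:: (0, 1); (-1, 1)]) /\
  (s = 2 -> [\/ A = [:: (-2, 3)], A = [:: (-1, 2); (-1, 1)] |
     A = [:: (0, 1); (-2, 1)]]) /\ 0 < s.
Proof.
move=> es z2; have s1 := std_coord1 1 1 A; rewrite -/w1 -/z es in s1.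
have s2 := std_coord2 1 1 A; rewrite -/w1 -/z in s2.
have pA := pos_heightsA st; rewrite -/w1 in pA.
have hA (v : vec) a : (v, a) \in heights w1 A -> a = 1.
  by move=> va; apply: (@thin_height v); rewrite mem_cat va.
have aA := st_A st; have sA := thin_sortA.
have A0 (v : vec) : v \in A -> v.1 <= 0 by exact: (std_A_le0 st).
have neg w B : {subset B <= A} -> pos_heights w B ->
    \sum_(x <- heights w B) x.2 * x.1.1 <= 0.
  move=> sB pB; have := @sum_heights_ge0 (fun v => - v.1) w B pB.
  rewrite sum_heights_opp oppr_ge0; apply=> v /sB /A0; clear; lia.
case eA : A (st_nilA st) => [//|f A1] _.
have fA : f \in A by rewrite eA mem_head.
have f0 := A0 _ fA; have f2 := allP aA _ fA; rewrite /= in f2.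
have df : det w1 f = 1 by apply: (hA f); rewrite eA /= mem_head.
have ef : f.2 = 1 - f.1 by move: df; rewrite /w1 /det /=; clear; lia.
have pA1 : pos_heights (step w1 f) A1.
  by move: pA; rewrite eA /pos_heights /= => /andP [].
rewrite eA /= big_cons /= df mul1r in s1; rewrite eA /= big_cons /= df mul1r in s2.
pose S1 : int := \sum_(x <- heights (step w1 f) A1) x.2 * x.1.1.
have {}s1 : 1 - s = 1 + (f.1 + S1) := s1.
have S10 : S1 <= 0 by apply: neg => // v vA; rewrite eA inE vA orbT.
have aA1 : all (fun v : vec => 0 < v.2) A1 by move: aA; rewrite eA => /andP [].
have exh : S1 = 0 -> f.1 < 0 -> A1 = [::].
  move=> S1e f1; apply: (thin_exhausted (w := step w1 f) f1 f2 aA1) => //.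
    by rewrite -eA.
  by rewrite -/S1 S1e.
have [f1|f1] : f.1 = 0 \/ f.1 < 0 by move: f0; clear; lia.
- have fE : f = (0, 1) by rewrite [f]surjective_pairing ef f1.
  have sw : step w1 f = (1, 0) by rewrite fE.
  rewrite sw in pA1 S1 s1 S10 exh s2.
  case eA1 : A1 => [|g A2].
    by move: s2; rewrite eA1 big_nil fE /=; move: z2; clear; lia.
  have gA : g \in A by rewrite eA eA1 !inE eqxx orbT.
  have g0 := A0 _ gA; have g2 := allP aA _ gA; rewrite /= in g2.
  have dg : det (1, 0) g = 1 by apply: (hA g); rewrite eA eA1 /= sw !inE eqxx orbT.
  have eg2 : g.2 = 1 by move: dg; rewrite /det /=; clear; lia.
  have g1 : g.1 < 0.
    move: sA; rewrite eA eA1 /= => /andP [/andP [+ _] _].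
    by rewrite fE /det /=; clear; lia.
  have pA2 : pos_heights (step (1, 0) g) A2.
    by move: pA1; rewrite eA1 /pos_heights /= => /andP [].
  pose S2 : int := \sum_(x <- heights (step (1, 0) g) A2) x.2 * x.1.1.
  have S1E : S1 = g.1 + S2 by rewrite /S1 eA1 /= big_cons /= dg mul1r.
  have S20 : S2 <= 0 by apply: neg => // v vA; rewrite eA eA1 !inE vA !orbT.
  have aA2 : all (fun v : vec => 0 < v.2) A2 by move: aA1; rewrite eA1 => /andP [].
  have exh2 : S2 = 0 -> A2 = [::].
    move=> S2e; apply: (thin_exhausted (w := step (1, 0) g) g1 g2 aA2) => //.
      by move: sA; rewrite eA eA1 /= => /andP [_].
    by rewrite -/S2 S2e.
  split; last split; last by move: s1 S1E S20 g1; rewrite f1; clear; lia.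
  - move=> se; have [S2e eg1] : S2 = 0 /\ g.1 = -1.
      by move: s1 S1E S20 g1; rewrite f1 se; clear; lia.
    by right; rewrite exh2 // fE [g]surjective_pairing eg1 eg2.
  - move=> se; have [[S2e eg1]|[S2e eg1]] : (S2 = 0 /\ g.1 = -2) \/ (S2 = -1 /\ g.1 = -1).
      by move: s1 S1E S20 g1; rewrite f1 se; clear; lia.
      by apply: Or33; rewrite exh2 // fE [g]surjective_pairing eg1 eg2.
    have gE : g = (-1, 1) by rewrite [g]surjective_pairing eg1 eg2.
    case eA2 : A2 => [|m A3]; first by move: S2e; rewrite /S2 eA2 big_nil.
    have mA : m \in A by rewrite eA eA1 eA2 !inE eqxx !orbT.
    have m2 := allP aA _ mA; rewrite /= in m2.
    have sg : step (1, 0) g = (0, 1) by rewrite gE.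
    have dm : det (0, 1) m = 1.
      by apply: (hA m); rewrite eA eA1 eA2 /= sw sg !inE eqxx !orbT.
    have gm : 0 < det g m.
      by move: sA; rewrite eA eA1 eA2 /= => /and3P [_ /andP [+ _] _].
    by exfalso; move: dm gm m2; rewrite gE /det /=; clear; lia.
- split; last split; last by move: s1 S10 f1; clear; lia.
  - move=> se; have [S1e ef1] : S1 = 0 /\ f.1 = -1 by move: s1 S10 f1; rewrite se; clear; lia.
    by left; rewrite exh // [f]surjective_pairing ef ef1.
  - move=> se; have [[S1e ef1]|[S1e ef1]] : (S1 = 0 /\ f.1 = -2) \/ (S1 = -1 /\ f.1 = -1).
      by move: s1 S10 f1; rewrite se; clear; lia.
      by apply: Or31; rewrite exh // [f]surjective_pairing ef ef1.
    have fE : f = (-1, 2) by rewrite [f]surjective_pairing ef ef1.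
    have sf : step w1 f = (0, 1) by rewrite fE.
    rewrite sf in pA1 S1 S10 s1 exh S1e.
    case eA1 : A1 => [|g A2]; first by move: S1e; rewrite /S1 eA1 big_nil.
    have gA : g \in A by rewrite eA eA1 !inE eqxx orbT.
    have g2 := allP aA _ gA; rewrite /= in g2.
    have dg : det (0, 1) g = 1 by apply: (hA g); rewrite eA eA1 /= sf !inE eqxx orbT.
    have fg : 0 < det f g by move: sA; rewrite eA eA1 /= => /andP [/andP []].
    have [eg1 eg2] : g.1 = -1 /\ g.2 = 1.
      by move: dg fg g2; rewrite fE /det /=; clear; lia.
    have pA2 : pos_heights (step (0, 1) g) A2.
      by move: pA1; rewrite eA1 /pos_heights /= => /andP [].
    have A20 : A2 = [::].
      apply: (thin_exhausted (w := step (0, 1) g) (g := g)) => //.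
      + by rewrite eg1.
      + by move: aA1; rewrite eA1 => /andP [].
      + by move: sA; rewrite eA eA1 /= => /andP [_].
      + by move: S1e; rewrite /S1 eA1 /= big_cons /= dg mul1r eg1; clear; lia.
    by apply: Or32; rewrite A20 fE [g]surjective_pairing eg1 eg2.
Qed.

(** The last edge arrives at (0, -1) with height 1, which makes its first coordinate 1 and its
    starting point (-1, b). The height of the edge before it rules out that this edge leans right
    too. *)
Lemma thin_C : exists C0 b, [/\ C = rcons C0 (1, - (b + 1)), 0 <= b, run z C0 = (-1, b) &
  forall v : vec, v \in C0 -> v.1 <= 0].
Proof.
case/lastP eC : C (st_nilC st) => [//|C0 c] _.
have cC : c \in C by rewrite eC mem_rcons mem_head.
have c2 := allP (st_C st) _ cC; rewrite /= in c2.
have cl := std_closed st; rewrite -/w1 -/z eC run_rcons in cl.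
have hC (v : vec) a : (v, a) \in heights z C -> a = 1.
  by move=> va; apply: (@thin_height v); rewrite mem_cat va orbT.
have dc : det (run z C0) c = 1.
  by apply: (hC c); rewrite eC heights_rcons mem_rcons mem_head.
have c1 : c.1 = 1.
  by have := det_step (run z C0) c; rewrite cl dc /det /=; clear; lia.
pose b := - c.2 - 1.
have cE : c = (1, - (b + 1)) by rewrite [c]surjective_pairing c1 /b; congr pair; lia.
have b0 : 0 <= b by rewrite /b; move: c2; clear; lia.
have rE : run z C0 = (-1, b).
  move: cl; rewrite /step dc cE; case: (run z C0) => x y [e1 e2].
  by congr pair; move: e1 e2; clear; lia.
exists C0, b; split=> //; first by rewrite -cE.
have sC := thin_sortC; rewrite eC pairwise_rcons in sC.
move: sC rE eC; case/lastP: C0 {dc cl} => // C1 v /andP [] /allP vc.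
rewrite pairwise_rcons => /andP [/allP xv _] rE eC.
have v2 : v.2 < 0.
  by apply: (allP (st_C st)); rewrite eC mem_rcons inE mem_rcons inE eqxx orbT.
have dv : det (-1, b) v = 1.
  rewrite -rE run_rcons det_step; apply: (hC v).
  by rewrite eC !heights_rcons mem_rcons inE mem_rcons inE eqxx orbT.
have v1 : v.1 <= 0.
  have : 0 < det v c by apply: vc; rewrite mem_rcons mem_head.
  by move: dv; rewrite cE /det /=; clear; nia.
move=> x; rewrite mem_rcons inE => /orP [/eqP -> //|xC1].
have x2 : x.2 < 0.
  by apply: (allP (st_C st)); rewrite eC mem_rcons inE mem_rcons inE xC1 !orbT.
by have := xv x xC1; rewrite /det; move: x2 v1 v2; clear; nia.
Qed.

Lemma thin_vertical (w : vec) B : {subset B <= C} -> pairwise (fun x y => 0 < det x y) B ->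
  (forall v : vec, v \in B -> v.1 <= 0) -> pos_heights w B ->
  0 <= \sum_(x <- heights w B) x.2 * x.1.1 -> B = [::] \/ B = [:: (0, -1)].
Proof.
move=> sB sortB B0 pB s0.
have B1 (v : vec) : v \in B -> v = (0, -1).
  move=> vB; apply: prim_Ne2.
  - exact/(std_prim st)/std_memC/sB.
  - suff : - v.1 = 0 by clear; lia.
    apply: (@sum_heights_zero (fun v => - v.1) _ _ pB) vB.
      by move=> x /B0; rewrite oppr_ge0.
    by rewrite sum_heights_opp oppr_le0.
  - exact/(allP (st_C st))/sB.
case: B B1 sortB {sB B0 pB s0} => [|x [|y B]] B1 sortB; first by left.
  by right; rewrite (B1 x) // mem_head.
move: sortB => /= /andP [/andP [+ _] _].
by rewrite (B1 x) ?mem_head // (B1 y) ?inE ?eqxx ?orbT // det_self.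
Qed.

Lemma thin_forms_mem : L \in thin_forms.
Proof.
have [C0 [b [eC b0 rE C00]]] := thin_C.
have z2 : 1 <= z.2 := std_top st.
pose s := 1 - z.1; have es : z.1 = 1 - s by rewrite /s; lia.
have [A1 [A2 s0]] := thin_A es z2.
have sub : {subset C0 <= C} by move=> x xC; rewrite eC mem_rcons inE xC orbT.
have pC := pos_heightsC st; rewrite -/w1 -/z in pC.
have hC (v : vec) a : (v, a) \in heights z C -> a = 1.
  by move=> va; apply: (@thin_height v); rewrite mem_cat va orbT.
have pC0 : pos_heights z C0.
  by move: pC; rewrite eC /pos_heights heights_rcons all_rcons => /andP [].
have sC0 : pairwise (fun x y => 0 < det x y) C0.
  by have := thin_sortC; rewrite eC pairwise_rcons => /andP [].
have r1 := run1 z C0; have r2 := run2 z C0; rewrite rE [(_, _).1]/= in r1.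
rewrite rE [(_, _).2]/= in r2.
pose S1 : int := \sum_(x <- heights z C0) x.2 * x.1.1.
have {}r1 : -1 = z.1 + S1 := r1.
have S1le : S1 <= 0.
  have := @sum_heights_ge0 (fun v => - v.1) z C0 pC0.
  by rewrite sum_heights_opp oppr_ge0; apply=> v /C00; rewrite oppr_ge0.
have LE : L = (1, 0) :: A ++ rcons C0 (1, - (b + 1)) by rewrite /L eC.
have anti (v : vec) : v \in A -> oppv v \in C -> L \in thin_forms.
  move=> vA vC; case: (@std_antipode 1 1 1 A C st v); first exact: std_memA.
  exact: std_memC.
have memC (v : vec) : v \in C0 -> v \in C := sub v.
have lastC : (1, - (b + 1)) \in C by rewrite eC mem_rcons mem_head.
have [se|se] : s = 1 \/ s = 2 by move: s0 S1le r1 es; clear; lia.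
- have zE : z = (0, 1).
    by case: (A1 se) => eA; rewrite /z eA.
  have S1e : S1 = -1 by move: r1; rewrite zE /=; clear; lia.
  case eC0 : C0 => [|f B]; first by move: S1e; rewrite /S1 eC0 big_nil.
  have fC0 : f \in C0 by rewrite eC0 mem_head.
  have df : det (0, 1) f = 1.
    by rewrite -zE; apply: (hC f); rewrite eC eC0 /= inE eqxx.
  have ef1 : f.1 = -1 by move: df; rewrite /det /=; clear; lia.
  have pB : pos_heights (step z f) B.
    by move: pC0; rewrite eC0 /pos_heights /= => /andP [].
  have eB : B = [::] \/ B = [:: (0, -1)].
    apply: (@thin_vertical (step z f)) => //.
    - by move=> x xB; apply: sub; rewrite eC0 inE xB orbT.
    - by move: sC0; rewrite eC0 /= => /andP [].
    - by move=> x xB; apply: C00; rewrite eC0 inE xB orbT.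
    - by move: S1e; rewrite /S1 eC0 /= big_cons /= zE df mul1r ef1; clear; lia.
  have f2 : f.2 < 0 := allP (st_C st) _ (memC _ fC0).
  have sf : step z f = (-1, 1 + f.2).
    by rewrite zE /step df [f]surjective_pairing ef1 /axpy /= add0r !mul1r.
  move: rE; rewrite eC0 /= sf; case: eB => eB; rewrite eB /=.
  + case=> eb0; have eb : 1 + f.2 = b := eb0.
    have f2' : f.2 = -1 by move: eb b0 f2; clear; lia.
    have b00 : b = 0 by rewrite -eb f2'.
    have fE : f = (-1, -1) by rewrite [f]surjective_pairing ef1 f2'.
    case: (A1 se) => eA; first by rewrite LE eA eC0 eB fE b00.
    apply: (anti (-1, 1)); first by rewrite eA.
    by rewrite b00 in lastC.
  + rewrite /step /axpy /det /= => /(congr1 snd) /= eb0.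
    have eb : 1 + f.2 + (-1 * -1 - (1 + f.2) * 0) * -1 = b := eb0.
    by exfalso; move: eb b0 f2; clear; lia.
- have S1e : S1 = 0 by move: r1; rewrite es se; clear; lia.
  have eC0 : C0 = [::] \/ C0 = [:: (0, -1)].
    by apply: (@thin_vertical z) => //; rewrite -/S1 S1e.
  have [eA|eA|eA] := A2 se.
  + have zE : z = (-1, 2) by rewrite /z eA.
    move: rE; rewrite zE; case: eC0 => eC0; rewrite eC0 /=.
      by case=> eb; rewrite LE eA eC0 -eb.
    by rewrite /step /axpy /det /= => /(congr1 snd) /= eb; rewrite LE eA eC0 -eb.
  + have zE : z = (-1, 2) by rewrite /z eA.
    move: rE; rewrite zE; case: eC0 => eC0; rewrite eC0 /=.
      by case=> eb; rewrite LE eA eC0 -eb.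
    rewrite /step /axpy /det /= => /(congr1 snd) /= eb.
    apply: (anti (-1, 2)); first by rewrite eA.
    by rewrite -eb in lastC.
  + have zE : z = (-1, 1) by rewrite /z eA.
    move: rE; rewrite zE; case: eC0 => eC0; rewrite eC0 /=.
      by case=> eb; rewrite LE eA eC0 -eb.
    move=> _; apply: (anti (0, 1)); first by rewrite eA mem_head.
    by apply: sub; rewrite eC0 mem_head.
Qed.

End Thin.

Definition forms : seq (seq vec) := upright_forms ++ leaning_forms ++ thin_forms.

(** The division is by the position of the vertical axis. If the bottom edge extends strictly to its
    left, a top vertex with [z.1] >= 0 gives an upright or a leaning right side, and a top vertex
    with [z.1] < 0 makes the left side vertical. If not, then n = 1 and q = h = 1. *)
Lemma standard_forms h q n A C : standard h q n A C ->
  exists2 F, F \in forms & perm_eq (nseq n (1, 0) ++ A ++ C) F \/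
    perm_eq (map mir (nseq n (1, 0) ++ A ++ C)) F.
Proof.
move=> st; have /andP [q0 qh] := st_q st; have n0 := st_n st.
have [qn|qn] : q < n%:Z * h \/ n%:Z * h <= q by clear; lia.
- have top := std_top st.
  set z := foldl _ _ _ in top.
  have [z1|z1] := leP 0 z.1.
    case/lastP eA : A (st_nilA st) => [//|A' v] _; rewrite -eA.
    have vA : v \in A by rewrite eA mem_rcons mem_head.
    have [v1|v1] : v.1 = 0 \/ v.1 < 0 by have := std_A_le0 st vA; clear; lia.
      have [k [k0 eA']] := std_vertical st eA v1.
      exists (nseq n (1, 0) ++ A ++ C); last by left.
      by rewrite mem_cat (std_upright st qn k0 eA').
    exists (nseq n (1, 0) ++ A ++ C); last by left.
    by rewrite !mem_cat (std_leaning st qn z1 eA v1) orbT.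
  case eC : C (st_nilC st) => [//|f C'] _; rewrite -eC.
  have fC : f \in C by rewrite eC mem_head.
  have f2 : f.2 < 0 := allP (st_C st) _ fC.
  have f1 := std_C_le0 st qn fC.
  have /andP [f0 fh] := std_firstC st eC; rewrite -/z in f0 fh.
  (* The height of [f] at [z] is the positive number [z.1 * f.2] plus [z.2 * - f.1]. With [z.2] >=
     h, a total of at most h leaves [f.1] = 0. *)
  have [ef ez] : f.1 = 0 /\ - z.1 <= h.
    move: fh f1 f2 z1 top q0 qh; rewrite /det; clear.
    case: (z) => a b; case: (f) => c d /= *.
    have e : c = 0 by nia.
    by split=> //; nia.
  have eC' : C = nseq (size C) (0, -1).
    apply/all_pred1P/allP => x xC /=; apply/eqP; apply: prim_Ne2.
    - exact/(std_prim st)/std_memC.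
    - have x2 : x.2 < 0 := allP (st_C st) _ xC.
      have x1 := std_C_le0 st qn xC.
      have : 0 <= det f x.
        move: xC (st_sortC st); rewrite eC inE.
        move=> /orP [/eqP ->|xC]; first by rewrite det_self.
        by move=> /= /andP [/allP /(_ _ xC)].
      by rewrite /det ef; move: f2 x2 x1; clear; nia.
    - exact: (allP (st_C st)).
  have cl := run1 z C; rewrite [run z C](std_closed st) {1}eC' heights_nseq in cl.
  rewrite big_nseq iter_addr_0 /= mulr0 mul0rn addr0 in cl.
  have ph : n%:Z * h - q <= h by move: cl ez; clear; lia.
  have k0 : (0 < size C)%N by rewrite eC.
  have [F Fm pF] := std_upright_mir st qn ph k0 eC'.
  by exists F; [rewrite /forms mem_cat Fm | right].
- have [n1 qh'] : n = 1%N /\ q = h by move: n0 q0 qh qn; clear; nia.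
  have q1 := std_q1 st qh'; have h1 : h = 1 by rewrite -qh'.
  rewrite n1 q1 h1 in st *; exists ((1, 0) :: A ++ C); last by left.
  by rewrite /forms !mem_cat (thin_forms_mem st) !orbT.
Qed.

Lemma polygon_forms w L : polygon w L ->
  exists2 F, F \in forms & meq L F \/ meq (map mir L) F.
Proof.
move=> pw; have [w1 [L1 [p1 e1 mi na]]] := minimal_exists pw.
have [h [q [n [A [C [e2 st]]]]]] := standard_form p1 mi na.
have [F Fm pF] := standard_forms st; exists F => //.
have e := meq_trans e1 e2.
by case: pF => pF; [left | right]; apply: meq_perm pF => //; apply: meq_mir.
Qed.

(** * Mutation classes of the minimal polygons *)

Definition mutate_vec (L : seq vec) (u : vec) : seq vec :=
  oppv u :: map (shear u) (rem u L).

Fixpoint replay (L us : seq vec) : option (seq vec) :=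
  if us is u :: us' then
    if u \in L then replay (mutate_vec L u) us' else None
  else Some L.

Definition certifies (F C : seq vec) (c : seq vec * mat) : bool :=
  if replay F c.1 is Some M then (mdet c.2 == 1) && perm_eq (map (act c.2) M) C
  else false.

Lemma replay_meq L us M : replay L us = Some M -> meq L M.
Proof.
elim: us L => [|u us IH] L /=; first by case=> ->; apply: meq_refl.
case: ifP => // uL /IH; apply: meq_trans; apply: meq_mut.
exact: meq_perm (meq_refl _) (perm_to_rem uL).
Qed.

Lemma certifies_meq F C c : certifies F C c -> meq F C.
Proof.
rewrite /certifies; case e: (replay _ _) => [M|//] /andP [/eqP g1].
exact: meq_perm (meq_act g1 (replay_meq e)).
Qed.

Definition even_dets (L : seq vec) : bool :=
  all (fun u => all (fun v => (2 %| det u v)%Z) L) L.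

Lemma even_detsP L :
  reflect (forall u v, u \in L -> v \in L -> (2 %| det u v)%Z) (even_dets L).
Proof.
apply: (iffP allP) => [h u v uL vL|h u uL]; first exact: (allP (h u uL)).
by apply/allP => v; apply: h.
Qed.

(** A shear adds to each vector an integral multiple of another vector of the multiset, so new
    determinants are integral combinations of old ones. *)
Lemma even_dets_meq_imp L M : meq L M -> even_dets L -> even_dets M.
Proof.
move=> e /even_detsP eL; apply/even_detsP; elim: e => {M} //.
- by move=> M N _ IH p u v; rewrite -!(perm_mem p); apply: IH.
- move=> g M g1 _ IH u v /mapP [u' uM ->] /mapP [v' vM ->].
  by rewrite det_act g1 mul1r IH.
- move=> w M _ IH.
  have IHw x : x \in M -> (2 %| det w x)%Z by move=> xM; apply: IH; rewrite inE ?eqxx ?xM ?orbT.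
  have IHM x y : x \in M -> y \in M -> (2 %| det x y)%Z.
    by move=> xM yM; apply: IH; rewrite inE ?xM ?yM orbT.
  have ws x : x \in M -> (2 %| det w (shear w x))%Z.
    by move=> xM; rewrite det_axpyr det_self mulr0 addr0 IHw.
  move=> u v; rewrite !inE => /orP [/eqP ->|/mapP [x xM ->]] /orP [/eqP ->|/mapP [y yM ->]].
  + by rewrite det_oppl det_oppr det_self.
  + by rewrite det_oppl rpredN ws.
  + by rewrite det_oppr -det_anti ws.
  + have dD (a b : int) : (2 %| a)%Z -> (2 %| b)%Z -> (2 %| a + b)%Z by exact: rpredD.
    rewrite det_axpyl; apply: (dD _ _); last exact/dvdz_mull/ws.
    rewrite det_axpyr; apply: (dD _ _); first exact: IHM.
    by apply: dvdz_mull; rewrite det_anti rpredN IHw.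
Qed.

Lemma even_dets_meq L M : meq L M -> even_dets L = even_dets M.
Proof.
by move=> e; apply/idP/idP; apply: even_dets_meq_imp => //; apply: meq_sym.
Qed.

Lemma even_dets_mir L : even_dets (map mir L) = even_dets L.
Proof.
rewrite /even_dets all_map; apply/idP/idP => /allP h; apply/allP => u uL.
  have := h u uL; rewrite /= all_map; apply: sub_all => v /=.
  by rewrite det_mir det_anti rpredN.
rewrite /= all_map; apply: sub_all (h u uL) => v /=.
by rewrite det_mir det_anti rpredN.
Qed.

(* The value [::] is junk: minimal polygons have between 3 and 11 edges. *)
Definition canonical (r : nat) (e : bool) : seq vec :=
  match r with
  | 3 => [:: (1, 0); (-2, 3); (1, -3)]
  | 4 => if e then [:: (1, 0); (1, 0); (-1, 2); (-1, -2)]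
         else [:: (1, 0); (-2, 3); (0, -1); (1, -2)]
  | 5 => [:: (1, 0); (1, 0); (-1, 2); (-1, -1); (0, -1)]
  | 6 => nseq 3 (1, 0) ++ [:: (0, 1); (0, 1); (-3, -2)]
  | 7 => [:: (1, 0)] ++ nseq 5 (0, 1) ++ [:: (-2, -5)]
  | 8 => [:: (1, 0)] ++ nseq 5 (0, 1) ++ [:: (-1, -2); (-1, -3)]
  | 9 => [:: (1, 0)] ++ nseq 6 (0, 1) ++ [:: (-1, -3); (-1, -3)]
  | 10 => [:: (1, 0); (1, 0)] ++ nseq 4 (0, 1) ++ nseq 4 (-1, -1)
  | 11 => [:: (1, 0); (1, 0)] ++ nseq 6 (0, 1) ++ nseq 3 (-1, -1)
  | _ => [::]
  end.

(* Sequences of mutations with a final change of basis, found by computer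
   search. *)
Definition certificates : seq (seq vec * mat) :=
  [:: ([::], ((1, 0), (0, 1)));
      ([:: (1, 0); (1, 0)], ((-1, 1), (0, -1)));
      ([:: (0, 1); (0, 1); (1, 0)], ((1, -1), (1, 0)));
      ([:: (0, 1); (1, 0); (1, 1); (0, -1)], ((-1, 1), (-1, 0)));
      (nseq 4 (0, 1) ++ [:: (1, 0)], ((-1, 0), (0, -1)));
      (nseq 3 (0, 1) ++ [:: (-1, 0)], ((1, 0), (0, 1)));
      ([:: (1, 0)] ++ nseq 4 (1, 1), ((-1, 1), (-4, 3)));
      ([:: (-1, -1)] ++ nseq 3 (0, -1), ((1, 0), (2, 1)));
      ([:: (1, 0); (1, 1); (-1, 0); (-1, 0)], ((0, -1), (1, -3)));
      ([:: (1, 0)] ++ nseq 3 (1, 1), ((-1, 1), (-3, 2)));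
      (nseq 3 (1, 0), ((-1, 1), (0, -1)));
      ([:: (0, 1)], ((1, 0), (0, 1)));
      ([:: (0, 1); (-1, 0); (-1, 0)], ((0, -1), (1, -2)));
      ([::], ((-2, -1), (3, 1)));
      ([::], ((0, 1), (-1, -2)));
      ([::], ((1, 1), (-2, -1)));
      ([::], ((1, 1), (0, 1)));
      ([:: (1, 0); (1, 0)], ((-1, 0), (0, -1)));
      (nseq 5 (0, -1), ((1, 0), (5, 1)));
      ([:: (0, -1); (1, -1); (0, 1)], ((-1, 0), (-2, -1)));
      ([:: (0, -1); (0, -1); (1, -2); (0, 1); (0, 1)], ((-1, 0), (-4, -1)));
      (nseq 3 (1, 0), ((-1, 0), (0, -1)));
      ([::], ((1, -1), (0, 1)));
      ([::], ((-2, 1), (3, -2)))].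

Lemma forms_certified : all (fun F =>
  has (certifies F (canonical (size F) (even_dets F))) certificates) forms.
Proof. by vm_compute. Qed.

Lemma forms_mir_certified : all (fun F =>
  has (certifies (map mir (canonical (size F) (even_dets F)))
    (canonical (size F) (even_dets F))) certificates) forms.
Proof. by vm_compute. Qed.

Lemma polygon_canonical w L : polygon w L -> meq L (canonical (size L) (even_dets L)).
Proof.
move=> pw; have [F Fm mF] := polygon_forms pw.
have /hasP [c _ /certifies_meq FC] := allP forms_certified _ Fm.
have /hasP [c' _ /certifies_meq CC] := allP forms_mir_certified _ Fm.
case: mF => e; first by rewrite -(size_meq e) (even_dets_meq e); apply: meq_trans FC.
have := meq_mir (meq_trans e FC); rewrite mapK; last exact: mirK.
rewrite -(size_map mir L) -(even_dets_mir L) -(size_meq e) (even_dets_meq e) => e'.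
exact: meq_trans CC.
Qed.

Lemma polygons_meq w L w' L' : polygon w L -> polygon w' L' ->
  size L = size L' -> even_dets L = even_dets L' -> meq L L'.
Proof.
move=> p p' es ee; apply: meq_trans (polygon_canonical p) _.
by rewrite es ee; apply/meq_sym/(polygon_canonical p').
Qed.

(** * Closed paths along a complete fan *)

Lemma crossing (P : pred nat) a b : (a <= b)%N -> ~~ P a -> P b ->
  exists k, [/\ (a <= k)%N, (k < b)%N, ~~ P k & P k.+1].
Proof.
move=> /subnKC <-; elim: (b - a)%N => [|n IH]; first by rewrite addn0 => /negP.
move=> nPa; rewrite addnS => Pb; case Pn: (P (a + n)%N).
  have [k [k1 k2 k3 k4]] := IH nPa Pn; exists k; split=> //.
  by apply: leq_trans k2 _.
by exists (a + n)%N; split; rewrite ?leq_addr ?Pn.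
Qed.

(** The rays are indexed periodically by all natural numbers, so that the starting ray can be
    shifted to wherever an argument needs it. *)
Record fan_like (N : nat) (V : nat -> vec) : Prop := FanLike {
  fan_size : (0 < N)%N;
  fan_per : forall k, V (k + N)%N = V k;
  fan_det : forall k, det (V k) (V k.+1) = 1;
  fan_empty : forall j k, ~ (0 < det (V k) (V j) /\ 0 < det (V j) (V k.+1));
  fan_inj : forall j k, (j < N)%N -> (k < N)%N -> V j = V k -> j = k }.

Lemma fan_prim N V k : fan_like N V -> prim (V k).
Proof.
move=> f; apply/primP; exists (V k.+1).2, (- (V k.+1).1).
by rewrite -[RHS](fan_det f k) /det; ring.
Qed.

(* The ray V i only enters the cone [V j, V j.+1) if it is V j. *)
Lemma fan_up_crossing N V i j : fan_like N V ->
  det (V i) (V j) <= 0 -> 0 < det (V i) (V j.+1) -> V i = V j.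
Proof.
move=> f h1 h2; have [h|h] := ltP 0 (det (V j) (V i)).
  by case: (fan_empty f (j := i) (k := j)).
have h0 : det (V j) (V i) = 0 by move: h1 h; rewrite (det_anti (V j)); clear; lia.
have [//|e] := prim_par (fan_prim j f) (fan_prim i f) h0.
by move: h2; rewrite e det_oppl (fan_det f).
Qed.

(** [m k] transvections along the ray [V k] lead from [W k] to [W k.+1]. The heights
    [det (W k) (V k)] may have any sign here, which is why this is not yet a [polygon]. *)
Definition path_along (N : nat) (V W : nat -> vec) (m : nat -> nat) : Prop :=
  [/\ forall k, m (k + N)%N = m k, forall k, W (k + N)%N = W k &
      forall k, W k.+1 = axpy ((m k)%:Z * det (W k) (V k)) (V k) (W k)].

(** The indexing starts where the heights pass from nonpositive to positive. All later heights are
    compared with [e], the heights measured at the vertex [u] between the rays 0 and 1. *)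
Section Crossing.
Variables (N : nat) (V W : nat -> vec) (m : nat -> nat).
Hypotheses (fV : fan_like N V) (pW : path_along N V W m).

Let c k := det (W k) (V k).
Let p k := (m k)%:Z * c k.
Let u := W 1.
Let e k := det u (V k).

Hypotheses (c0 : c 0 <= 0) (c1 : 0 < c 1).

Lemma height_next k : det (W k.+1) (V k) = c k.
Proof. by case: pW => _ _ ->; rewrite det_axpyl det_self mulr0 addr0. Qed.

Lemma e0 : e 0 = c 0. Proof. exact: height_next. Qed.
Lemma e1 : e 1 = c 1. Proof. by []. Qed.

Lemma eN : e N = e 0.
Proof. by rewrite /e -[in RHS](fan_per fV) add0n. Qed.

Lemma u_cone v : det u v = e 1 * det (V 0) v - e 0 * det (V 1) v.
Proof.
have := plucker u v (V 0) (V 1).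
rewrite (fan_det fV) mulr1 /e => ->; rewrite [det v (V 1)]det_anti [det v (V 0)]det_anti.
by ring.
Qed.

(* Otherwise the cones [V j, V j.+1) and [V 0, V 1) would both contain u. *)
Lemma e_stays_nonpos j : (0 < j)%N -> (j < N)%N -> e j <= 0 -> e j.+1 <= 0.
Proof.
move=> j0 jN ej; have d := fan_det fV; rewrite leNgt; apply/negP => ej1.
have e1p : 0 < e 1 by [].
have e0n : e 0 <= 0 by rewrite e0.
have d0j : 0 < det (V 0) (V j).
  have [h|h] := leP (det (V 0) (V j.+1)) 0; last first.
    rewrite ltNge; apply/negP => h'; have h0 := fan_up_crossing fV h' h.
    by have := fan_inj fV (leq_trans _ jN) jN h0; case: (j) j0 => // k _ /(_ isT).
  have := plucker (V 0) u (V j) (V j.+1); rewrite d mulr1 (det_anti u (V 0)).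
  have := u_cone (V j.+1); rewrite -/(e j) -/(e j.+1) -/(e 0).
  rewrite ltNge => uc pl; apply/negP => h'.
  have e00 : e 0 = 0 by move: pl ej ej1 h e0n e1p h'; clear; nia.
  by move: uc ej1 h e1p; rewrite e00; clear; nia.
have d1j : 0 <= det (V 1) (V j).
  rewrite leNgt; apply/negP => h; apply: (fan_empty fV (j := j) (k := 0)); split=> //.
  by rewrite (det_anti (V 1)) oppr_gt0.
by move: ej; rewrite /e u_cone -/(e 0) -/(e 1); move: e1p e0n d0j d1j; clear; nia.
Qed.

Lemma e_nonpos_after i j : (0 < i)%N -> (i <= j)%N -> (j <= N)%N ->
  e i <= 0 -> e j <= 0.
Proof.
move=> i0 /subnKC <-; elim: (j - i)%N => [|n IH]; first by rewrite addn0.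
rewrite addnS => nN ei; apply: e_stays_nonpos => //; first by rewrite ltn_addr.
by apply: IH => //; apply: ltnW.
Qed.

Lemma e_sign : exists s, [/\ (0 < s)%N, (s < N)%N,
  forall j, (0 < j)%N -> (j <= s)%N -> 0 < e j &
  forall j, (s < j)%N -> (j <= N)%N -> e j <= 0].
Proof.
have e1n : ~~ (e 1 <= 0) by rewrite -ltNge.
have eNn : e N <= 0 by rewrite eN e0.
have [s [s1 sN es es1]] := crossing (P := fun k => e k <= 0) (fan_size fV) e1n eNn.
exists s; split=> // j j0 js.
  rewrite ltNge; apply/negP => ej; move/negP: es; apply.
  exact: (e_nonpos_after j0 js (ltnW sN)).
by apply: (e_nonpos_after (i := s.+1)).
Qed.

Lemma three_term i j :
  e i * det (V j) (V i.+1) = e j + e i.+1 * det (V j) (V i).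
Proof.
have := plucker u (V i) (V j) (V i.+1); rewrite (fan_det fV) mulr1 => ->.
by rewrite /e (det_anti (V i) (V j)); ring.
Qed.

Lemma path_sum j x : (0 < j)%N ->
  det (W j) x = det u x + \sum_(1 <= i < j) p i * det (V i) x.
Proof.
case: j => // j _; elim: j => [|j IH]; first by rewrite big_nil addr0.
rewrite big_nat_recr //= addrA -IH; case: pW => _ _ ->.
by rewrite det_axpyl.
Qed.

Lemma path_sum_back j x : (j <= N)%N ->
  det (W j.+1) x = det u x - \sum_(j.+1 <= i < N.+1) p i * det (V i) x.
Proof.
move=> jN; have := path_sum x (ltn0Sn N); have := path_sum x (ltn0Sn j).
have -> : W N.+1 = u by case: pW => _ per _; rewrite -[N.+1]add1n per.
rewrite (big_cat_nat (n := j.+1) (p := N.+1)) //=.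
move=> ->; rewrite -{1}[det u x]addr0 => /addrI s0.
by congr (_ + _); apply/eqP; rewrite -addr_eq0 -s0.
Qed.

(** [W j] is [u] plus multiples of earlier rays. By induction these multiples are nonnegative, and
    the earlier rays lie clockwise of [V j], so the height at [V j] can only have grown. *)
Lemma upper_heights s j : (forall j, (0 < j)%N -> (j <= s)%N -> 0 < e j) ->
  (0 < j)%N -> (j <= s)%N -> e j <= c j.
Proof.
move=> ep; have so i n : (0 < i)%N -> (i + n <= s)%N -> 0 <= det (V i) (V (i + n)%N).
  move=> i0; elim: n => [|n IH]; first by rewrite addn0 det_self.
  rewrite addnS => ins; have := three_term (i + n) i; have := IH (ltnW ins).
  have := ep i i0 (leq_trans (leq_addr _ _) (ltnW ins)).
  have := ep (i + n)%N (ltn_addr _ i0) (ltnW ins).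
  have := ep (i + n).+1 isT ins.
  by rewrite -/(e _); clear; nia.
have [n] := ubnP j; elim: n j => // n IH j; rewrite ltnS => jn j0 js.
rewrite /c (path_sum _ j0) lerDl big_nat_cond; apply: sumr_ge0 => i.
rewrite andbT => /andP [i0 ij].
have is' : (i <= s)%N by apply: leq_trans js; exact: ltnW.
apply: mulr_ge0; last by rewrite -(subnKC (ltnW ij)); apply: so; rewrite ?subnKC // ltnW.
apply: mulr_ge0 => //; apply: le_trans (IH i _ i0 is'); last exact: leq_trans ij jn.
exact/ltW/ep.
Qed.

Lemma lower_sorted s i j : (forall j, (s < j)%N -> (j <= N)%N -> e j <= 0) ->
  (s < i)%N -> (i <= j)%N -> (j <= N)%N -> e i < 0 ->
  0 <= det (V i) (V j) /\ ((j < N)%N -> e j < 0).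
Proof.
move=> en si /subnKC <-; elim: (j - i)%N => [|n IH]; first by rewrite addn0 det_self.
rewrite addnS => ijN ei; have [h1 h2] := IH (ltnW ijN) ei.
have e2 := h2 ijN; have e3 : e (i + n).+1 <= 0.
  by apply: en => //; rewrite ltnS ltnW // ltn_addr.
have t := three_term (i + n) i.
have h3 : 0 <= det (V i) (V (i + n).+1) by move: t e2 e3 h1 ei; clear; nia.
split=> // lt; rewrite lt_neqAle e3 andbT; apply/eqP => e0'.
have := three_term (i + n).+1 i; rewrite e0' mul0r.
have : e (i + n).+2 <= 0.
  by apply: en => //; rewrite ltnS ltnW // ltnS ltnW // ltn_addr.
by move: h3 ei; clear; nia.
Qed.

(** The mirror argument, with the path read backwards from its return to [u] after one period. *)
Lemma lower_heights s j : (forall j, (s < j)%N -> (j <= N)%N -> e j <= 0) ->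
  (s < j)%N -> (j <= N)%N -> e j < 0 -> c j <= e j.
Proof.
move=> en sj jN; have [n] := ubnP (N - j)%N; elim: n j sj jN => // n IH j sj jN.
rewrite ltnS => jn ej; rewrite -height_next (path_sum_back _ jN) gerBl.
rewrite big_nat_cond; apply: sumr_ge0 => i; rewrite andbT => /andP [ji iN].
have [h1 h2] := lower_sorted en sj (ltnW ji) iN ej.
rewrite det_anti mulrN oppr_ge0; apply: mulr_le0_ge0 => //.
rewrite /p; apply: mulr_ge0_le0 => //.
have [iN'|iN'] := ltnP i N.
  apply: le_trans (ltW (h2 iN')); apply: IH => //.
  - exact: ltn_trans ji.
  - apply: leq_trans jn; apply: ltn_sub2l => //; exact: leq_trans ji iN.
  - exact: h2.
have -> : i = N by apply/eqP; rewrite eqn_leq iN' -ltnS iN.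
suff -> : c N = c 0 by [].
rewrite /c; case: pW => _ per _.
by rewrite -[in LHS](add0n N) per (fan_per fV).
Qed.

(* The path u = W 1, ..., W N.+1 = u moves away from the line of u on both
   sides, so that only rays on this line can have positive multiplicity. *)
Lemma crossing_degenerate i j : (0 < i)%N -> (i <= N)%N -> (0 < j)%N -> (j <= N)%N ->
  (0 < m i)%N -> (0 < m j)%N -> det (V i) (V j) = 0.
Proof.
have [s [s0 sN ep en]] := e_sign.
have sum0 : \sum_(1 <= k < N.+1) p k * - e k = 0.
  transitivity (\sum_(1 <= k < N.+1) p k * det (V k) u).
    by apply: eq_bigr => k _; rewrite /e -det_anti.
  have := path_sum_back u (leq0n N); rewrite -/u !det_self sub0r => /eqP.
  by rewrite eq_sym oppr_eq0 => /eqP.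
have term k : (0 < k < N.+1)%N -> 0 <= p k * e k.
  case/andP=> k0 kN; have [ks|sk] := leqP k s.
    have := ep k k0 ks => h; apply: mulr_ge0; last exact: ltW.
    apply: mulr_ge0 => //; apply: le_trans (upper_heights ep k0 ks); exact: ltW.
  have := en k sk kN; rewrite le_eqVlt => /orP [/eqP ->|h]; first by rewrite mulr0.
  have := lower_heights en sk kN h => hc.
  by apply: mulr_le0; [apply: mulr_ge0_le0 => //; apply: le_trans hc _|]; exact: ltW.
have on_line k : (0 < k)%N -> (k <= N)%N -> (0 < m k)%N -> e k = 0.
  move=> k0 kN mk; apply/eqP; apply/negPn/negP => ek.
  have : \sum_(1 <= k < N.+1) p k * e k == 0.
    have := sum0; under eq_bigr do rewrite mulrN.
    by rewrite sumrN => /eqP; rewrite oppr_eq0.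
  rewrite big_nat_cond psumr_eq0; last by move=> t; rewrite andbT; exact: term.
  move/allP => /(_ k); rewrite mem_index_iota k0 ltnS kN => /(_ isT) /=.
  rewrite mulf_eq0 (negbTE ek) orbF /p mulf_eq0 => /orP [/eqP|/eqP ck].
    by move: mk; clear; lia.
  have [ks|sk] := leqP k s.
    by have := upper_heights ep k0 ks; have := ep k k0 ks; rewrite ck; clear; lia.
  have ek' : e k < 0 by rewrite lt_neqAle ek en.
  by have := lower_heights en sk kN ek'; rewrite ck; move: ek'; clear; lia.
move=> i0 iN j0 jN mi mj; have := plucker u (V 1) (V i) (V j).
rewrite -/(e i) -/(e j) (on_line i) // (on_line j) // !mul0r subrr -/(e 1).
by move/eqP; rewrite mulf_eq0 => /orP [/eqP e10|/eqP //]; move: c1; rewrite -e1 e10.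
Qed.

End Crossing.

Lemma periodic_mod (T : Type) (f : nat -> T) N : (forall k, f (k + N)%N = f k) ->
  forall k, f (k %% N)%N = f k.
Proof.
move=> per k; rewrite {2}(divn_eq k N) addnC; elim: (k %/ N)%N => [|q IH].
  by rewrite mul0n addn0.
by rewrite mulSn addnCA addnC per.
Qed.

Lemma fan_shift N V K : fan_like N V -> fan_like N (fun k => V (K + k)%N).
Proof.
move=> f; split.
- exact: fan_size f.
- by move=> k; rewrite addnA (fan_per f).
- by move=> k; rewrite addnS (fan_det f).
- by move=> j k; rewrite addnS; apply: (fan_empty f (j := (K + j)%N) (k := (K + k)%N)).
- move=> j k jN kN; rewrite -(periodic_mod (fan_per f) (K + j)).
  rewrite -(periodic_mod (fan_per f) (K + k)) => /(fan_inj f).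
  rewrite !ltn_mod (fan_size f) => /(_ isT isT) /eqP.
  by rewrite eqn_modDl !modn_small // => /eqP.
Qed.

Lemma path_shift N V W m K : path_along N V W m ->
  path_along N (fun k => V (K + k)%N) (fun k => W (K + k)%N) (fun k => m (K + k)%N).
Proof.
by case=> a b c; split=> k; rewrite ?addnA ?addnS ?c.
Qed.

(** If some height were nonpositive, then somewhere on the cycle heights would pass from nonpositive
    to positive; shifting the indices there, [crossing_degenerate] would make all rays of positive
    multiplicity parallel. *)
Lemma all_heights_pos N V W m : fan_like N V -> path_along N V W m ->
  (exists i j, [/\ (0 < m i)%N, (0 < m j)%N & det (V i) (V j) != 0]) ->
  (exists k, 0 < det (W k) (V k)) -> forall k, 0 < det (W k) (V k).
Proof.
move=> fV pW [i [j [mi mj nd]]] [K cK] J; rewrite ltNge; apply/negP => cJ.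
have [mper Wper _] := pW; have N0 := fan_size fV.
have per k : 0 < det (W (k + N)%N) (V (k + N)%N) = (0 < det (W k) (V k)).
  by rewrite Wper (fan_per fV).
have JK : (J <= K + J * N)%N by apply: leq_trans (leq_addl _ _); rewrite leq_pmulr.
have nJ : ~~ (0 < det (W J) (V J)) by rewrite -leNgt.
have pK : 0 < det (W (K + J * N)%N) (V (K + J * N)%N).
  by rewrite -(periodic_mod per) addnC modnMDl (periodic_mod per).
have [k [_ _ nk pk]] := crossing (P := fun k => 0 < det (W k) (V k)) JK nJ pK.
have h0 : det (W (k + 0)%N) (V (k + 0)%N) <= 0 by rewrite addn0 leNgt.
have h1 : 0 < det (W (k + 1)%N) (V (k + 1)%N) by rewrite addn1.
(* [t x] is the index in 1, ..., N that the ray [x] has after the shift by [k]; the multiple of N -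
   1 represents -(k + 1) modulo N without truncated subtraction. *)
pose t x := ((x + (N - 1) * k.+1) %% N).+1.
have tE x : ((k + t x) = x %[mod N])%N.
  rewrite /t addnS -addSn modnDmr addnCA -mulSn subn1 prednK // addnC mulnC.
  exact: modnMDl.
have tN x : (t x <= N)%N by rewrite /t ltn_mod.
have tm x : m (k + t x)%N = m x.
  by rewrite -(periodic_mod mper) tE (periodic_mod mper).
have tV x : V (k + t x)%N = V x.
  by rewrite -(periodic_mod (fan_per fV)) tE (periodic_mod (fan_per fV)).
have := crossing_degenerate (fan_shift k fV) (path_shift k pW) h0 h1
  (i := t i) (j := t j) isT (tN i) isT (tN j).
by rewrite !tm !tV => /(_ mi mj) /eqP; rewrite (negbTE nd).
Qed.

(** Entering the open half plane on the left of [V i] again is possible only from [V i] itself, by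
    [fan_up_crossing], and this ray does not recur within one period. *)
Lemma fan_no_return N V i j k : fan_like N V -> (i < j)%N -> (j < k)%N ->
  (k < i + N)%N -> det (V i) (V j) <= 0 -> det (V i) (V k) <= 0.
Proof.
move=> f ij jk kN h; rewrite leNgt; apply/negP => h'.
have nj : ~~ (0 < det (V i) (V j)) by rewrite -leNgt.
have [l [jl lk nl pl]] := crossing (P := fun l => 0 < det (V i) (V l)) (ltnW jk) nj h'.
rewrite -leNgt in nl; have e := fan_up_crossing f nl pl.
have il : (i <= l)%N by apply: leq_trans jl; apply: ltnW.
have := fan_inj (fan_shift i f) (j := 0) (k := l - i) (fan_size f).
rewrite addn0 subnKC // => /(_ _ e) h0.
have : 0%N = (l - i)%N by apply: h0; rewrite ltn_subLR // (ltn_trans lk).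
by move/esym/eqP; rewrite subn_eq0 leqNgt (leq_trans ij).
Qed.

Lemma fan_ncw N V i j k : fan_like N V -> (i <= j)%N -> (j <= k)%N -> (k < N)%N ->
  ncw (V i) (V j) (V k).
Proof.
move=> f; rewrite leq_eqVlt => /orP [/eqP ->|ij].
  move=> _ _; apply: ncw_pos12; rewrite ?det_self // => h.
  by rewrite det_anti oppr_ge0 ltW.
rewrite leq_eqVlt => /orP [/eqP ->|jk] kN.
  apply: ncw_pos23; rewrite ?det_self // => h.
  by rewrite det_anti oppr_ge0 ltW.
have per := fan_per f; have kiN : (k < i + N)%N by apply: ltn_addl.
have ijN : (i + N < j + N)%N by rewrite ltn_add2r.
have jkN : (j + N < k + N)%N by rewrite ltn_add2r.
have h1 := fan_no_return f ij jk kiN.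
have := fan_no_return f jk kiN ijN; rewrite per => h2.
have := fan_no_return f kiN ijN jkN; rewrite !per => h3.
rewrite /ncw; apply/negP => /or3P [] /andP [a b].
- have := h2 (ltW b); rewrite det_anti oppr_le0 leNgt => /negP; exact.
- have := h3 (ltW b); rewrite det_anti oppr_le0 leNgt => /negP; exact.
- have := h1 (ltW b); rewrite det_anti oppr_le0 leNgt => /negP; exact.
Qed.

Definition expand (m : nat -> nat) (a n : nat) : seq nat :=
  flatten [seq nseq (m k) k | k <- iota a n].

Lemma expand_pairwise m a n :
  all (fun k => (a <= k < a + n)%N) (expand m a n) /\ pairwise leq (expand m a n).
Proof.
elim: n a => [|n IH] a; first by [].
have [h1 h2] := IH a.+1; rewrite /expand /= -/(expand m a.+1 n); split.
  rewrite all_cat all_nseq leqnn addnS ltnS leq_addr /= orbT /=.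
  by apply: sub_all h1 => k /andP [/ltnW -> h] /=; rewrite -addSn.
rewrite pairwise_cat h2 andbT; apply/andP; split.
  apply/allrelP => x y; rewrite mem_nseq => /andP [_ /eqP ->] /(allP h1).
  by case/andP => /ltnW.
by elim: (m a) => //= l ->; rewrite all_nseq leqnn orbT.
Qed.

Lemma count_expand m x n : (x < n)%N -> count_mem x (expand m 0 n) = m x.
Proof.
move=> xn; rewrite count_flatten -map_comp.
rewrite (eq_map (g := fun k => if k == x then m k else 0%N)); last first.
  by move=> k /=; rewrite count_nseq /= eq_sym; case: eqP => _; rewrite ?mul1n.
rewrite sumnE big_map -big_mkcond /= (big_rem x) ?mem_iota //= eqxx.
rewrite big_seq_cond big1 ?addn0 // => k /andP [+ /eqP ek].
by rewrite ek mem_rem_uniq ?iota_uniq // inE eqxx.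
Qed.

Lemma expand_perm (s : seq nat) n : all (fun k => (k < n)%N) s ->
  perm_eq (expand (fun k => count_mem k s) 0 n) s.
Proof.
move=> sn; apply/allP => x _ /=; apply/eqP.
have [xn|nx] := ltnP x n; first exact: count_expand.
have -> : count_mem x s = 0%N.
  by apply/count_memPn/negP => /(allP sn); rewrite ltnNge nx.
apply/count_memPn/negP => /(allP (proj1 (expand_pairwise _ _ _))).
by rewrite add0n ltnNge nx andbF.
Qed.

Lemma fan_cyc_sorted N V (s : seq nat) : fan_like N V ->
  all (fun k => (k < N)%N) s -> pairwise leq s -> cyc_sorted (map V s).
Proof.
move=> f; elim: s => //= i s IH /andP [iN sN] /andP [is' ps].
rewrite IH // andbT pairwise_map; apply: pairwise_in ps => j k js ks jk /=.
exact: (fan_ncw f (allP is' _ js) jk (allP sN _ ks)).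
Qed.

Lemma run_expand V W m a n :
  (forall k, W k.+1 = axpy ((m k)%:Z * det (W k) (V k)) (V k) (W k)) ->
  run (W a) (map V (expand m a n)) = W (a + n)%N.
Proof.
move=> rec; elim: n a => [|n IH] a; first by rewrite addn0.
rewrite /expand /= -/(expand m a.+1 n) map_cat foldl_cat map_nseq run_nseq.
by rewrite -rec IH addnS.
Qed.

Lemma heights_expand V W m a n x :
  (forall k, W k.+1 = axpy ((m k)%:Z * det (W k) (V k)) (V k) (W k)) ->
  x \in heights (W a) (map V (expand m a n)) -> exists k, x = (V k, det (W k) (V k)).
Proof.
move=> rec; elim: n a => [|n IH] a //.
rewrite /expand /= -/(expand m a.+1 n) map_cat heights_cat map_nseq run_nseq -rec.
rewrite mem_cat => /orP [|/IH //]; rewrite heights_nseq mem_nseq => /andP [_ /eqP ->].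
by exists a.
Qed.

Lemma prim_part (w : vec) : w <> (0, 0) -> exists g u,
  [/\ 0 < g, prim u & w = (g * u.1, g * u.2)].
Proof.
case: w => a b w0; pose g := gcdz a b.
have g0 : g != 0.
  by rewrite gcdz_eq0; apply/negP => /andP [/eqP ea /eqP eb]; apply: w0; rewrite ea eb.
have gp : 0 < g by rewrite lt_neqAle eq_sym g0.
have [x [y e]] := Bezoutz a b.
have ea := divzK (dvdz_gcdl a b); have eb := divzK (dvdz_gcdr a b).
exists g, ((a %/ g)%Z, (b %/ g)%Z); split=> //; last by rewrite /= !(mulrC g) ea eb.
apply/primP; exists x, y; apply: (mulIf g0) => /=.
by rewrite mulrDl -!mulrA ea eb e mul1r.
Qed.

(* The base point of a path need not be primitive, but the whole path is
   divisible by the content of its base point. *)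
Lemma fan_polygon N V W m : fan_like N V -> path_along N V W m ->
  (exists i j, [/\ (i < N)%N, (0 < m i)%N, (0 < m j)%N & det (V i) (V j) != 0]) ->
  (exists k, 0 < det (W k) (V k)) ->
  exists w, polygon w (map V (expand m 0 N)).
Proof.
move=> f pW [i [j [iN mi mj nd]]] ex.
have pos := all_heights_pos f pW (ex_intro _ i (ex_intro _ j (And3 mi mj nd))) ex.
have [_ Wper rec] := pW.
have W0 : W 0 <> (0, 0) by move=> e; have := pos 0%N; rewrite e /det /= !mul0r subrr.
have [g [u [g0 pu eW]]] := prim_part W0.
pose W' := fix W' k := if k is k'.+1 then
   axpy ((m k')%:Z * det (W' k') (V k')) (V k') (W' k') else u.
have rec' k : W' k.+1 = axpy ((m k)%:Z * det (W' k) (V k)) (V k) (W' k) by [].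
have WW' k : W k = (g * (W' k).1, g * (W' k).2).
  elim: k => [|k IH]; first exact: eW.
  by rewrite rec rec' IH /axpy /det /=; congr pair; ring.
have pos' k : 0 < det (W' k) (V k).
  have := pos k; rewrite WW' (_ : det _ _ = g * det (W' k) (V k)).
    by rewrite pmulr_rgt0.
  by rewrite /det /=; ring.
have eN : W' N = u.
  have := Wper 0%N; rewrite add0n !WW' => -[/(mulfI (lt0r_neq0 g0)) e1].
  move/(mulfI (lt0r_neq0 g0)) => e2.
  by rewrite [W' N]surjective_pairing e1 e2 -surjective_pairing.
have [eN' es] := expand_pairwise m 0 N.
exists u; split=> //.
- by apply/allP => v /mapP [k _ ->]; apply: fan_prim f.
- exact: (fan_cyc_sorted f eN' es).
- by have := @run_expand V W' m 0 N rec'; rewrite add0n eN.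
- apply/allP => x xh; have [k ->] := heights_expand (W := W') (a := 0) rec' xh.
  exact: pos'.
- rewrite -size_eq0 size_map -lt0n; rewrite -(count_expand m iN) in mi.
  exact: leq_trans mi (count_size _ _).
Qed.

(** * The polygon of a seed of q-Painleve type *)

Definition pv (v : Z2) : vec := (x0 v, x1 v).

Lemma pv_inj : injective pv.
Proof.
move=> v w /pair_equal_spec [e0 e1]; apply/matrixP => i j; rewrite (ord1 j).
have [->|->] : i = ord0 \/ i = ord_max.
  by case: i => -[|[|//]] p; [left | right]; apply: val_inj.
- exact: e0.
- exact: e1.
Qed.

(** For consecutive rays of a smooth fan this is the relation whose coefficient is minus the
    self-intersection of the middle divisor. *)
Lemma det_eq1_add (a b c : vec) : det a b = 1 -> det b c = 1 ->
  a.1 + c.1 = det a c * b.1 /\ a.2 + c.2 = det a c * b.2.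
Proof.
move=> h1 h2.
have e1 : a.1 * b.2 = 1 + a.2 * b.1 by rewrite -h1 /det; ring.
have e2 : b.1 * c.2 = 1 + b.2 * c.1 by rewrite -h2 /det; ring.
split; rewrite /det mulrBl.
- rewrite (_ : a.1 * c.2 * b.1 = a.1 * (b.1 * c.2)); last by ring.
  by rewrite e2 (_ : a.2 * c.1 * b.1 = c.1 * (a.1 * b.2 - 1)); [ring | rewrite e1; ring].
- rewrite (_ : a.1 * c.2 * b.2 = c.2 * (a.1 * b.2)); last by ring.
  by rewrite e1 (_ : a.2 * c.1 * b.2 = a.2 * (b.1 * c.2 - 1)); [ring | rewrite e2; ring].
Qed.

Section Fan.
Variable vs : seq Z2.
Hypothesis fan : smooth_complete_fan vs.
Let N := size vs.
Let V k := pv (ray vs k).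

Lemma ray_mod k : ray vs (k %% N) = ray vs k.
Proof. by rewrite /ray modn_mod. Qed.

Lemma ray_modS k : ray vs (k %% N).+1 = ray vs k.+1.
Proof. by rewrite /ray -[(k %% N).+1]addn1 -[k.+1]addn1 modnDml. Qed.

Lemma N_gt0 : (0 < N)%N. Proof. by case: fan. Qed.

Lemma smooth_fan_like : fan_like N V.
Proof.
have [n0 un d emp] := fan; split=> //.
- by move=> k; rewrite /V /ray modnDr.
- move=> k; have := d (k %% N)%N; rewrite ltn_mod N_gt0 ray_mod ray_modS.
  by move=> /(_ isT).
- move=> j k; have := emp (j %% N)%N (k %% N)%N.
  by rewrite !ltn_mod N_gt0 !ray_mod ray_modS => /(_ isT isT).
- move=> j k jN kN /pv_inj /eqP; rewrite /ray !modn_small // nth_uniq //.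
  by move/eqP.
Qed.

Lemma N_gt2 : (2 < N)%N.
Proof.
have f := smooth_fan_like; have d := fan_det f; have per := fan_per f.
have := N_gt0; case: N per => [//|[|[|//]]] per _.
  by have := d 0%N; have -> : V 1 = V 0 := per 0%N; rewrite det_self.
by have := d 1%N; have -> : V 2 = V 0 := per 0%N; rewrite det_anti d.
Qed.

Definition prev k := (k + N).-1.

Lemma prevS k : (prev k).+1 = (k + N)%N.
Proof. by rewrite /prev prednK // addn_gt0 N_gt0 orbT. Qed.

Lemma V_prev k : V (prev k.+1) = V k.
Proof. by rewrite /prev addSn /=; exact: (fan_per smooth_fan_like). Qed.

Lemma det_prev k : det (V (prev k)) (V k) = 1.
Proof.
have := fan_det smooth_fan_like (prev k); rewrite prevS.
by rewrite (fan_per smooth_fan_like).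
Qed.

Section Divisor.
Variable c : nat -> int.
Let cc k := c (k %% N)%N.

(* The vertex of the polygon of the divisor c dual to the cone spanned by
   the rays k - 1 and k. *)
Definition dual_vertex k : vec :=
  axpy (- cc (prev k)) (V k) (cc k * (V (prev k)).1, cc k * (V (prev k)).2).

(** The intersection number of the divisor [c] with the k-th toric divisor; by [dual_vertexS] it is
    also the signed lattice length of the k-th edge of the dual polygon. *)
Definition degree k : int :=
  cc (prev k) + cc k.+1 - det (V (prev k)) (V k.+1) * cc k.

Lemma prev_per k : prev (k + N) = (prev k + N)%N.
Proof. by apply: succn_inj; rewrite prevS -addSn prevS. Qed.

Lemma degree_per k : degree (k + N)%N = degree k.
Proof.
rewrite /degree /cc prev_per -addSn !modnDr.
by rewrite !(fan_per smooth_fan_like).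
Qed.

Lemma dual_vertex_per k : dual_vertex (k + N)%N = dual_vertex k.
Proof.
rewrite /dual_vertex /cc (fan_per smooth_fan_like) modnDr.
by rewrite prev_per (fan_per smooth_fan_like) modnDr.
Qed.

Lemma det_dual_vertex k : det (dual_vertex k) (V k) = cc k.
Proof.
rewrite det_axpyl det_self mulr0 addr0 -[RHS]mulr1 -(det_prev k) /det /=; ring.
Qed.

Lemma dual_vertexS k : dual_vertex k.+1 = axpy (degree k) (V k) (dual_vertex k).
Proof.
have [e1 e2] := det_eq1_add (det_prev k) (fan_det smooth_fan_like k).
have ck : cc (prev k.+1) = cc k by rewrite /cc /prev addSn /= modnDr.
rewrite /dual_vertex V_prev ck /degree.
move: (V (prev k)) (V k) (V k.+1) e1 e2 => a b d e1 e2; rewrite /axpy /=.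
congr pair.
- by rewrite (_ : d.1 = det a d * b.1 - a.1); [ring | rewrite -e1; ring].
- by rewrite (_ : d.2 = det a d * b.2 - a.2); [ring | rewrite -e2; ring].
Qed.

Lemma sum_tdiv_int k : (k < N)%N -> \sum_(j < N) c j * tdiv_int vs j k = degree k.
Proof.
move=> kN; have N2 := N_gt2; have N0 := N_gt0.
have mS : (k.+1 %% N < N)%N by rewrite ltn_mod.
have mP : (prev k %% N < N)%N by rewrite ltn_mod.
(* The k-th column of the intersection matrix as a sum of Kronecker deltas. It agrees with the
   nested conditionals of [tdiv_int] because N > 2 keeps k and its two neighbours distinct. *)
pose t (j : nat) : int := (j == prev k %% N)%N%:R + (j == k.+1 %% N)%N%:R -
  det (V (prev k)) (V k.+1) * (j == k)%:R.
have tE j : (j < N)%N -> tdiv_int vs j k = t j.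
  move=> jN; rewrite /tdiv_int /t -/N.
  have e1 : (k == j.+1 %% N)%N = (j == prev k %% N)%N.
    have [ej|nj] := eqVneq j (prev k %% N)%N.
      by rewrite ej -addn1 modnDml addn1 prevS modnDr modn_small // eqxx.
    apply/eqP => ek; case/eqP: nj; rewrite ek /prev.
    have [jN'|jN'] := ltnP j.+1 N.
      by rewrite (modn_small jN') addSn /= modnDr modn_small.
    have -> : j.+1 = N by apply/eqP; rewrite eqn_leq jN jN'.
    by rewrite modnn add0n modn_small ?prednK //; apply: succn_inj; rewrite prednK //;
      apply/eqP; rewrite eqn_leq jN jN'.
  rewrite e1; have [ejk|jk] := eqVneq j k.
    rewrite ejk in e1 *; have -> : (k == prev k %% N)%N = false.
      rewrite -e1; apply/negbTE/eqP => h; move: h.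
      have [kN'|kN'] := ltnP k.+1 N; first by rewrite modn_small //; clear; lia.
      have -> : k.+1 = N by apply/eqP; rewrite eqn_leq kN kN'.
      by rewrite modnn => k0; move: kN' N2; rewrite k0; clear; lia.
    have -> : (k == k.+1 %% N)%N = false.
      apply/negbTE/eqP => h; move: h.
      have [kN'|kN'] := ltnP k.+1 N; first by rewrite modn_small //; clear; lia.
      have -> : k.+1 = N by apply/eqP; rewrite eqn_leq kN kN'.
      by rewrite modnn => k0; move: kN' N2; rewrite k0; clear; lia.
    by rewrite mulr1 !add0r.
  rewrite mulr0 subr0; have [ej|nj] := eqVneq j (k.+1 %% N)%N; last first.
    by rewrite addr0; case: eqP.
  suff -> : (j == prev k %% N)%N = false by [].
  apply/negbTE/eqP => ej'; move: ej; rewrite ej' /prev.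
  have [kN'|kN'] := ltnP k.+1 N.
    rewrite (modn_small kN'); case: (k) kN' => [|k'] kN'.
      by rewrite add0n modn_small ?prednK //; move: N2; clear; lia.
    by rewrite addSn /= modnDr modn_small //; [clear; lia | apply: ltn_trans kN'].
  have -> : k.+1 = N by apply/eqP; rewrite eqn_leq kN kN'.
  have -> : (k + N).-1 = (k.-1 + N)%N by move: kN' N2; clear; lia.
  by rewrite modnn modnDr modn_small; move: kN kN' N2; clear; lia.
transitivity (\sum_(j < N) c j * t j).
  by apply: eq_bigr => j _; rewrite tE.
have pick (x : nat) : (x < N)%N -> \sum_(j < N) c j * (nat_of_ord j == x)%:R = c x.
  move=> xN; rewrite (bigD1 (Ordinal xN)) //= eqxx mulr1 big1 ?addr0 // => j.
  by rewrite -val_eqE /= => /negbTE ->; rewrite mulr0.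
rewrite /t.
under eq_bigr do rewrite mulrBr mulrDr [c _ * (_ * _)]mulrCA.
rewrite sumrB big_split /= -mulr_sumr !pick //.
by rewrite /degree /cc (modn_small kN).
Qed.

End Divisor.
End Fan.

Definition psi (r : nat) (P : 'M[int]_(2, r)) (E : 'M[int]_r) (i : 'I_r) : vec :=
  pv (P *m col i E).

Lemma psiE r (P : 'M[int]_(2, r)) E i :
  psi P E i = ((P *m E) ord0 i, (P *m E) ord_max i).
Proof.
rewrite /psi /pv /x0 /x1; congr pair.
  by rewrite [RHS]mxE [LHS]mxE; apply: eq_bigr => j _; rewrite mxE.
by rewrite [RHS]mxE [LHS]mxE; apply: eq_bigr => j _; rewrite mxE.
Qed.

(* Multiplying by det (v i) (v j) clears the denominators of the linear form of
   the plane that takes the values f i at v i and f j at v j. *)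
Lemma functional_of_relations r (v : 'I_r -> vec) (f : 'I_r -> int) (i j : 'I_r) :
  (forall b : 'I_r -> int, \sum_l b l * (v l).1 = 0 -> \sum_l b l * (v l).2 = 0 ->
     \sum_l b l * f l = 0) ->
  forall l, det (v i) (v j) * f l =
    det (f j * (v i).1 - f i * (v j).1, f j * (v i).2 - f i * (v j).2) (v l).
Proof.
move=> rel l; pose b (k : 'I_r) : int := det (v i) (v j) * (k == l)%:R -
  det (v l) (v j) * (k == i)%:R - det (v i) (v l) * (k == j)%:R.
have sum (g : 'I_r -> int) : \sum_k b k * g k =
    det (v i) (v j) * g l - det (v l) (v j) * g i - det (v i) (v l) * g j.
  have pick x (y : 'I_r) : \sum_k x * (k == y)%:R * g k = x * g y.
    rewrite (bigD1 y) //= eqxx mulr1 big1 ?addr0 // => k /negbTE ->.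
    by rewrite mulr0 mul0r.
  by under eq_bigr do rewrite 2!mulrBl; rewrite !sumrB !pick.
have := rel b; rewrite !sum => h; apply/eqP; rewrite -subr_eq0; apply/eqP.
rewrite -[RHS]h; first by rewrite /det /=; ring.
- by rewrite /det; ring.
- by rewrite /det; ring.
Qed.

Lemma vanishing_linear (X G : int) : (forall t : int, 2 * t * X + G <= 0) -> X = 0.
Proof.
move=> h; have g0 := normr_ge0 G; have Gg := ler_norm (- G); rewrite normrN in Gg.
have := h (`|G| + 1); have := h (- (`|G| + 1)).
by move: `|G| g0 Gg; clear => g; have [//|X0|X0] := ltgtP X 0; nia.
Qed.

Section Seed.
Variables (r : nat) (P : 'M[int]_(2, r)) (E : 'M[int]_r) (vs : seq Z2).
Hypotheses (seed : is_seed P E) (fan : smooth_complete_fan vs)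
  (on_fan : forall i : 'I_r, P *m col i E \in vs).
Let N := size vs.
Let V k := pv (ray vs k).
Let idx (i : 'I_r) := index (P *m col i E) vs.

Definition relation (al : 'cV[int]_r) : Prop :=
  \sum_i al i ord0 * (psi P E i).1 = 0 /\ \sum_i al i ord0 * (psi P E i).2 = 0.

Lemma idx_lt i : (idx i < N)%N. Proof. by rewrite index_mem. Qed.

Lemma V_idx i : V (idx i) = psi P E i.
Proof. by rewrite /V /ray modn_small ?idx_lt // nth_index. Qed.

Lemma on_ray i k : (k < N)%N -> (P *m col i E == nth 0 vs k) = (idx i == k).
Proof.
move=> kN; have [_ un _ _] := fan; apply/eqP/eqP => [h|<-].
  by rewrite /idx h index_uniq.
by rewrite nth_index.
Qed.

Lemma coords_relation (a : 'cV[int]_r) : inK P a -> relation (coords E a).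
Proof.
rewrite /inK /coords => Pa; have Eu : E \in unitmx by case: seed; rewrite unitmxE.
have e : P *m E *m (invmx E *m a) = 0 by rewrite -mulmxA mulKVmx.
split.
- have := congr1 (fun M : 'cV[int]_2 => M ord0 ord0) e; rewrite [RHS]mxE [LHS]mxE => h.
  by rewrite -[RHS]h; apply: eq_bigr => i _; rewrite psiE mulrC.
- have := congr1 (fun M : 'cV[int]_2 => M ord_max ord0) e; rewrite [RHS]mxE [LHS]mxE => h.
  by rewrite -[RHS]h; apply: eq_bigr => i _; rewrite psiE mulrC.
Qed.

Lemma relation_coords (al : 'cV[int]_r) : relation al ->
  inK P (E *m al) /\ coords E (E *m al) = al.
Proof.
move=> [e1 e2]; have Eu : E \in unitmx by case: seed; rewrite unitmxE.
split; last by rewrite /coords mulKmx.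
rewrite /inK mulmxA; apply: pv_inj; rewrite /pv /x0 /x1; congr pair.
- rewrite [RHS]mxE -[RHS]e1 mxE; apply: eq_bigr => i _.
  by rewrite psiE mulrC.
- rewrite [RHS]mxE -[RHS]e2 mxE; apply: eq_bigr => i _.
  by rewrite psiE mulrC.
Qed.

Lemma sum_degv (al : 'cV[int]_r) (c : nat -> int) :
  \sum_(k < N) c k * degv P E vs al k = \sum_i al i ord0 * c (idx i).
Proof.
transitivity (\sum_(k < N) \sum_i (idx i == k)%:R * (al i ord0 * c k)).
  apply: eq_bigr => k _; rewrite /degv mulr_sumr big_mkcond /=.
  by apply: eq_bigr => i _; rewrite on_ray //; case: eqP => _; rewrite ?mul1r ?mul0r // mulrC.
rewrite exchange_big /=; apply: eq_bigr => i _.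
rewrite (bigD1 (Ordinal (idx_lt i))) //= eqxx mul1r big1 ?addr0 // => k.
by rewrite -val_eqE /= eq_sym => /negbTE ->; rewrite mul0r.
Qed.

Lemma form_valE (al be : 'cV[int]_r) c : form_val P E vs al be c =
  \sum_i be i ord0 * (c (idx i) - al i ord0).
Proof.
rewrite /form_val sum_degv -sumrB; apply: eq_bigr => i _; ring.
Qed.

Lemma tdiv_int_sym j k : tdiv_int vs j k = tdiv_int vs k j.
Proof. by rewrite /tdiv_int eq_sym; case: eqP => [->|_] //; rewrite orbC. Qed.

Lemma degv_pairing (al be : 'cV[int]_r) c d : Crel P E vs al c -> Crel P E vs be d ->
  \sum_i be i ord0 * c (idx i) = \sum_i al i ord0 * d (idx i).
Proof.
move=> hc hd; rewrite -!sum_degv.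
transitivity (\sum_(k < N) \sum_(j < N) c k * (d j * tdiv_int vs j k)).
  by apply: eq_bigr => k _; rewrite -hd // mulr_sumr.
rewrite exchange_big /=; apply: eq_bigr => j _; rewrite -hc // mulr_sumr.
by apply: eq_bigr => k _; rewrite tdiv_int_sym; ring.
Qed.

Lemma Crel_comb (al be : 'cV[int]_r) c d t : Crel P E vs al c -> Crel P E vs be d ->
  Crel P E vs (t *: al + be) (fun k => t * c k + d k).
Proof.
move=> hc hd k kN; under eq_bigr do rewrite mulrDl -mulrA.
rewrite big_split /= -mulr_sumr hc // hd // /degv mulr_sumr -big_split /=.
by apply: eq_bigr => i _; rewrite !mxE.
Qed.

Lemma Crel_degree al c k : Crel P E vs al c ->
  degree vs c k = \sum_(i | idx i == (k %% N)%N) al i ord0.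
Proof.
move=> hc; have kN : (k %% N < N)%N by rewrite ltn_mod; exact: N_gt0 fan.
have := hc _ kN; rewrite (sum_tdiv_int fan _ kN) /degv => h.
rewrite -(periodic_mod (degree_per fan c)); rewrite -/N h.
by apply: eq_bigl => i; rewrite on_ray.
Qed.

(** Two divisors with the same degrees have dual polygons that differ by a translation, so they
    differ by a linear form, which a relation kills. It is needed since [IntForm] may choose another
    [c] for every pair. *)
Lemma Crel_unique al (be : 'cV[int]_r) c d : Crel P E vs al c -> Crel P E vs al d ->
  relation be -> \sum_i be i ord0 * c (idx i) = \sum_i be i ord0 * d (idx i).
Proof.
move=> hc hd [b1 b2].
pose w : vec := ((dual_vertex vs c 0).1 - (dual_vertex vs d 0).1,
  (dual_vertex vs c 0).2 - (dual_vertex vs d 0).2).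
have dw k : dual_vertex vs c k = axpy 1 w (dual_vertex vs d k).
  elim: k => [|k IH].
    by rewrite [LHS]surjective_pairing /axpy /w /=; congr pair; ring.
  rewrite !(dual_vertexS fan) IH (Crel_degree k hc) (Crel_degree k hd) /axpy.
  by move: (dual_vertex vs d k) (V k) => x y /=; congr pair; ring.
have cE i : c (idx i) = d (idx i) + det w (V (idx i)).
  have := det_dual_vertex fan c (idx i); rewrite modn_small ?idx_lt // => <-.
  rewrite dw det_axpyl mul1r; have := det_dual_vertex fan d (idx i).
  by rewrite modn_small ?idx_lt // => ->.
clear dw; clearbody w.
transitivity (\sum_i be i ord0 * d (idx i) +
   (w.1 * (\sum_i be i ord0 * (psi P E i).2) - w.2 * (\sum_i be i ord0 * (psi P E i).1))).
  rewrite !mulr_sumr -sumrB -big_split /=; apply: eq_bigr => i _.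
  by rewrite cE V_idx /det; ring.
by rewrite b1 b2 !mulr0 subrr addr0.
Qed.

Variable B : 'cV[int]_r -> 'cV[int]_r -> int.
Hypothesis form : forall a b, inK P a -> inK P b ->
  exists c : nat -> int, Crel P E vs (coords E a) c /\
    B a b = form_val P E vs (coords E a) (coords E b) c.

Lemma form_at (al be : 'cV[int]_r) c : relation al -> relation be ->
  Crel P E vs al c ->
  B (E *m al) (E *m be) = \sum_i be i ord0 * (c (idx i) - al i ord0).
Proof.
move=> ra rb hc; have [Ka ea] := relation_coords ra; have [Kb eb] := relation_coords rb.
have [d [hd ->]] := form Ka Kb; rewrite ea in hd; rewrite ea eb form_valE.
under eq_bigr do rewrite mulrBr; rewrite sumrB (Crel_unique hd hc rb) -sumrB.
by apply: eq_bigr => i _; rewrite mulrBr.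
Qed.

Lemma Crel_exists (al : 'cV[int]_r) : relation al -> exists c, Crel P E vs al c.
Proof.
move=> ra; have [Ka ea] := relation_coords ra.
by have [d [hd _]] := form Ka Ka; exists d; rewrite -ea.
Qed.

Lemma relation_comb (al be : 'cV[int]_r) t : relation al -> relation be ->
  relation (t *: al + be).
Proof.
move=> [a1 a2] [b1 b2]; split.
- transitivity (t * \sum_i al i ord0 * (psi P E i).1 + \sum_i be i ord0 * (psi P E i).1).
    rewrite mulr_sumr -big_split /=; apply: eq_bigr => i _; rewrite !mxE; ring.
  by rewrite a1 b1 mulr0 addr0.
- transitivity (t * \sum_i al i ord0 * (psi P E i).2 + \sum_i be i ord0 * (psi P E i).2).
    rewrite mulr_sumr -big_split /=; apply: eq_bigr => i _; rewrite !mxE; ring.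
  by rewrite a2 b2 mulr0 addr0.
Qed.

(** With [al] isotropic, the value of the form at t [al] + [be] is affine in t and never positive,
    so its linear coefficient, twice the pairing of [al] and [be], vanishes. *)
Lemma isotropic_radical (al be : 'cV[int]_r) c :
  (forall a, inK P a -> B a a <= 0) -> relation al -> relation be ->
  Crel P E vs al c -> B (E *m al) (E *m al) = 0 ->
  \sum_i be i ord0 * (c (idx i) - al i ord0) = 0.
Proof.
move=> neg ra rb hc iso; have [d hd] := Crel_exists rb.
apply: (@vanishing_linear _ (\sum_i be i ord0 * (d (idx i) - be i ord0))) => t.
have rt := relation_comb t ra rb; have ht := Crel_comb t hc hd.
have [Kt _] := relation_coords rt; have := neg _ Kt; rewrite (form_at rt rt ht).
rewrite (form_at ra ra hc) in iso.
suff -> : \sum_i (t *: al + be) i ord0 * (t * c (idx i) + d (idx i) - (t *: al + be) i ord0)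
  = t * t * (\sum_i al i ord0 * (c (idx i) - al i ord0)) +
    t * (\sum_i be i ord0 * (c (idx i) - al i ord0)) +
    t * (\sum_i al i ord0 * (d (idx i) - be i ord0)) +
    \sum_i be i ord0 * (d (idx i) - be i ord0).
  rewrite iso mulr0 add0r => h.
  have sym : \sum_i al i ord0 * (d (idx i) - be i ord0) =
      \sum_i be i ord0 * (c (idx i) - al i ord0).
    under eq_bigr do rewrite mulrBr; rewrite sumrB -(degv_pairing hc hd) -sumrB.
    by apply: eq_bigr => i _; ring.
  by move: h; rewrite sym; move: (bigop.body _ _ _) (bigop.body _ _ _); clear; nia.
rewrite !mulr_sumr -!big_split /=; apply: eq_bigr => i _; rewrite !mxE; ring.
Qed.

Let mult k := count_mem (k %% N)%N [seq idx i | i <- enum 'I_r].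

Lemma sum_idx (k : nat) (x : int) : \sum_(i | idx i == (k %% N)%N) x = (mult k)%:Z * x.
Proof.
rewrite big_mkcond -big_enum -big_mkcond /= big_const_seq iter_addr_0.
by rewrite -mulr_natl natz /mult [in RHS]count_map.
Qed.

Lemma mult_idx i : (0 < mult (idx i))%N.
Proof.
rewrite /mult modn_small ?idx_lt // -has_count; apply/hasP; exists (idx i) => /=.
  by apply: map_f; rewrite mem_enum.
exact: eqxx.
Qed.

Lemma mult_per k : mult (k + N)%N = mult k.
Proof. by rewrite /mult modnDr. Qed.

Lemma path_opp W m : path_along N V W m -> path_along N V (fun k => oppv (W k)) m.
Proof.
case=> a b c; split=> // k; first by rewrite b.
by rewrite c /oppv /axpy /det /=; congr pair; ring.
Qed.

Lemma expand_mult : perm_eq (expand mult 0 N) [seq idx i | i <- enum 'I_r].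
Proof.
rewrite (_ : expand mult 0 N =
    expand (fun k => count_mem k [seq idx i | i <- enum 'I_r]) 0 N).
  by apply: expand_perm; apply/allP => _ /mapP [i _ ->]; exact: idx_lt.
congr flatten; apply/eq_in_map => k; rewrite mem_iota add0n => /andP [_ kN].
by rewrite /mult modn_small.
Qed.

(* al is isotropic with divisor c. Since c (idx i) - al i is a linear form in
   psi (e_i), subtracting that form from the support function c gives a polygon
   with heights det (psi e_i) (psi e_j) * al. *)
Lemma isotropic_path (al : 'cV[int]_r) c (i j : 'I_r) :
  (forall be : 'cV[int]_r, relation be ->
    \sum_l be l ord0 * (c (idx l) - al l ord0) = 0) ->
  Crel P E vs al c ->
  exists W, path_along N V W mult /\
    forall l, det (W (idx l)) (V (idx l)) = det (psi P E i) (psi P E j) * al l ord0.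
Proof.
move=> rad hc; pose f l := c (idx l) - al l ord0.
have lin := @functional_of_relations r (psi P E) f i j.
set d := det (psi P E i) (psi P E j) in lin *; set m := (_, _) in lin.
have {}lin l : d * f l = det m (psi P E l).
  apply: lin => b b1 b2; have := rad (\col_l b l).
  under eq_bigr do rewrite mxE; apply; split.
    by under eq_bigr do rewrite mxE.
  by under eq_bigr do rewrite mxE.
clearbody m d; pose W k := axpy d (dual_vertex vs c k) (oppv m).
have WE k : det (W k) (V k) = d * c (k %% N)%N - det m (V k).
  by rewrite det_axpyl det_oppl (det_dual_vertex fan) addrC.
have Wl l : det (W (idx l)) (V (idx l)) = d * al l ord0.
  by rewrite WE modn_small ?idx_lt // V_idx -lin /f; ring.
exists W; split=> //; split; first exact: mult_per.
  by move=> k; rewrite /W (dual_vertex_per fan).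
move=> k; rewrite -sum_idx.
have -> : \sum_(l | idx l == (k %% N)%N) det (W k) (V k) = d * degree vs c k.
  rewrite (Crel_degree k hc) mulr_sumr; apply: eq_bigr => l /eqP el.
  rewrite -Wl el; congr (det _ _).
    by rewrite (periodic_mod (f := W)) // => k'; rewrite /W (dual_vertex_per fan).
  exact/esym/(periodic_mod (fan_per (smooth_fan_like fan))).
rewrite /W (dual_vertexS fan) -[pv (ray vs k)]/(V k) /axpy.
by move: (dual_vertex vs c k) (V k) => x y /=; congr pair; ring.
Qed.

Lemma isotropic_polygon (al : 'cV[int]_r) c (i j : 'I_r) :
  (forall be : 'cV[int]_r, relation be ->
    \sum_l be l ord0 * (c (idx l) - al l ord0) = 0) ->
  Crel P E vs al c -> det (psi P E i) (psi P E j) != 0 -> al != 0 ->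
  exists w L, polygon w L /\ perm_eq L [seq psi P E i | i <- enum 'I_r].
Proof.
move=> rad hc d0 al0; have [W [pW Wl]] := isotropic_path i j rad hc.
have f := smooth_fan_like fan.
have nd : exists i j, [/\ (i < N)%N, (0 < mult i)%N, (0 < mult j)%N & det (V i) (V j) != 0].
  by exists (idx i), (idx j); rewrite idx_lt !mult_idx !V_idx.
have [l al1] : exists l, al l ord0 != 0.
  apply/existsP; rewrite -negb_forall; apply: contra al0 => /forallP h.
  by apply/eqP/matrixP => x y; rewrite (ord1 y) mxE; apply/eqP/h.
have [w pw] : exists w, polygon w (map V (expand mult 0 N)).
  have nz : det (W (idx l)) (V (idx l)) != 0 by rewrite Wl mulf_neq0.
  (* One height of either sign suffices: transvections commute with negation, so the path may be
     replaced by its opposite. *)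
  have [neg|pos] : det (W (idx l)) (V (idx l)) < 0 \/ 0 < det (W (idx l)) (V (idx l)).
    by apply/orP; rewrite -neq_lt.
    apply: (fan_polygon f (path_opp pW) nd); exists (idx l).
    by rewrite det_oppl oppr_gt0.
  by apply: (fan_polygon f pW nd); exists (idx l).
exists w, (map V (expand mult 0 N)); split=> //.
apply: perm_trans (perm_map V expand_mult) _; rewrite -map_comp.
suff -> : map (V \o idx) (enum 'I_r) = map (psi P E) (enum 'I_r) by [].
by apply: eq_map => x; exact: V_idx.
Qed.

End Seed.

(** Pigeonhole: among the multiples 0, ..., [size L] of [d], two have the same representative modulo
    the image. *)
Lemma multiple_in_image r (P : 'M[int]_(2, r)) (d : Z2) : finite_coker P ->
  exists (t : int) (n : 'cV[int]_r), t != 0 /\ t *: d = P *m n.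
Proof.
case=> L hL.
have [|f hf] := @fin_all_exists 'I_(size L).+1 (fun=> 'I_(size L))
    (fun k j => exists n : 'cV[int]_r, (k : nat)%:Z *: d - nth 0 L j = P *m n).
  move=> k; have [y yL [n e]] := hL ((k : nat)%:Z *: d).
  have yi : (index y L < size L)%N by rewrite index_mem.
  by exists (Ordinal yi), n; rewrite nth_index.
have /injectivePn [x [y xy fxy]] : ~~ injectiveb f.
  apply/negP => /injectiveP /leq_card; rewrite !card_ord ltnn //.
have [n1 e1] := hf x; have [n2 e2] := hf y.
exists ((x : nat)%:Z - (y : nat)%:Z), (n1 - n2); split.
  by rewrite subr_eq0; apply: contra xy => /eqP [e]; apply/eqP/val_inj.
rewrite mulmxBr -e1 -e2 fxy scalerBl opprB addrA subrK //.
Qed.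

Lemma det_image r (P : 'M[int]_(2, r)) (E : 'M[int]_r) (a b : 'cV[int]_r) :
  E \in unitmx -> det (pv (P *m a)) (pv (P *m b)) =
  \sum_i \sum_j coords E a i ord0 * coords E b j ord0 * det (psi P E i) (psi P E j).
Proof.
move=> Eu; have comb (n : 'cV[int]_r) : pv (P *m n) =
    (\sum_i coords E n i ord0 * (psi P E i).1, \sum_i coords E n i ord0 * (psi P E i).2).
  rewrite -{1}(mulKVmx Eu n) (mulmxA P E) /pv /x0 /x1.
  by congr pair; rewrite [LHS]mxE; apply: eq_bigr => i _; rewrite psiE mulrC.
rewrite !comb /det /= !mulr_suml -sumrB; apply: eq_bigr => i _.
rewrite !mulr_sumr -sumrB; apply: eq_bigr => j _; ring.
Qed.

(** Otherwise all determinants on the image vanish by bilinearity, although the image contains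
    nonzero multiples of both unit vectors. *)
Lemma seed_rank r (P : 'M[int]_(2, r)) (E : 'M[int]_r) : finite_coker P -> is_seed P E ->
  exists i j, det (psi P E i) (psi P E j) != 0.
Proof.
move=> fc [dE _]; have Eu : E \in unitmx by rewrite unitmxE.
case: (boolP [exists i, exists j, det (psi P E i) (psi P E j) != 0]) => [/existsP [i /existsP [j h]]|].
  by exists i, j.
rewrite negb_exists => /forallP h0.
have h i j : det (psi P E i) (psi P E j) = 0.
  by have := h0 i; rewrite negb_exists => /forallP /(_ j); rewrite negbK => /eqP.
have hP (n1 n2 : 'cV[int]_r) : det (pv (P *m n1)) (pv (P *m n2)) = 0.
  by rewrite (det_image _ _ _ Eu) big1 // => i _; rewrite big1 // => j _; rewrite h mulr0.
have [t [n1 [t0 e1]]] := multiple_in_image (\col_i (i == ord0)%:R) fc.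
have [s [n2 [s0 e2]]] := multiple_in_image (\col_i (i == ord_max)%:R) fc.
have := hP n1 n2; rewrite -e1 -e2 /det /pv /x0 /x1 /= !mxE /= !mulr1 !mulr0 subr0.
by move/eqP; rewrite mulf_eq0 (negbTE t0) (negbTE s0).
Qed.

Lemma seed_polygon r (P : 'M[int]_(2, r)) (E : 'M[int]_r) B :
  finite_coker P -> is_seed P E -> IntForm P E B -> q_Painleve P B ->
  exists w L, polygon w L /\ perm_eq L [seq psi P E i | i <- enum 'I_r].
Proof.
move=> fc seed [vs [fan [on_fan form]]] [neg nneg].
have [i [j d0]] := seed_rank fc seed.
have [a [Ka a0 iso]] : exists a, [/\ inK P a, a != 0 & B a a = 0].
  apply: NNPP => no; apply: nneg => a Ka a0; rewrite lt_neqAle neg // andbT.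
  by apply/eqP => iso; apply: no; exists a.
have Eu : E \in unitmx by case: seed; rewrite unitmxE.
have ea : E *m coords E a = a by rewrite /coords mulKVmx.
have ra := coords_relation seed Ka.
have [c hc] := Crel_exists seed form ra.
apply: (@isotropic_polygon r P E vs fan on_fan (coords E a) c i j) => //.
  move=> be rb.
  apply: (isotropic_radical seed fan on_fan form neg ra rb hc).
  by rewrite ea.
by apply: contra a0 => /eqP e; rewrite -ea e mulmx0.
Qed.

(** * Mutations of seeds *)

Definition psis (r : nat) (P : 'M[int]_(2, r)) (E : 'M[int]_r) : seq vec :=
  [seq psi P E i | i <- enum 'I_r].

(** The sign [false] is the one that matches [shear], because minus the pairing of e_i with e_j is
    the determinant of the images of e_j and e_i. *)
Lemma psi_mutate r (P : 'M[int]_(2, r)) E (i j : 'I_r) :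
  psi P (mutate P E j false) i =
  if i == j then oppv (psi P E j) else shear (psi P E j) (psi P E i).
Proof.
have [->|ij] := eqVneq i j.
  have -> : psi P (mutate P E j false) j = pv (P *m - col j E).
    by congr (pv (P *m _)); apply/matrixP => x y; rewrite !mxE eqxx.
  rewrite mulmxN /psi /pv /oppv /x0 /x1 /=.
  by congr pair; rewrite [LHS]mxE.
have -> : psi P (mutate P E j false) i =
    pv (P *m (col i E + Num.max 0 (det (psi P E j) (psi P E i)) *: col j E)).
  congr (pv (P *m _)); apply/matrixP => x y; rewrite !mxE (negbTE ij).
  by rewrite mulN1r -[pairing _ _ _]/(det (psi P E i) (psi P E j)) -det_anti.
rewrite mulmxDr -scalemxAr /shear; move: (Num.max 0 _) => t.
by rewrite /psi /pv /x0 /x1 /axpy /=; congr pair; rewrite [LHS]mxE [X in _ + X]mxE.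
Qed.

Lemma psis_mutate r (P : 'M[int]_(2, r)) E (j : 'I_r) :
  perm_eq (psis P E) (psi P E j :: map (psi P E) (rem j (enum 'I_r))) /\
  perm_eq (psis P (mutate P E j false))
    (oppv (psi P E j) :: map (shear (psi P E j) \o psi P E) (rem j (enum 'I_r))).
Proof.
have pe : perm_eq (enum 'I_r) (j :: rem j (enum 'I_r)).
  by apply: perm_to_rem; rewrite mem_enum.
split; apply: perm_trans (perm_map _ pe) _ => //=.
rewrite psi_mutate eqxx perm_cons.
suff -> : map (psi P (mutate P E j false)) (rem j (enum 'I_r)) =
  map (shear (psi P E j) \o psi P E) (rem j (enum 'I_r)) by [].
apply/eq_in_map => i; rewrite mem_rem_uniq ?enum_uniq // inE => /andP [ij _].
by rewrite /= psi_mutate (negbTE ij).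
Qed.

(** All changes of basis are postponed to the end: by [shear_act] a mutation after [g] is [g] after
    a mutation at the preimage of the vector. *)
Lemma meq_mut_reach r (P : 'M[int]_(2, r)) (E : 'M[int]_r) M : meq (psis P E) M ->
  exists2 E'', mut_reach P E E'' &
    exists2 g, mdet g = 1 & perm_eq M (map (act g) (psis P E'')).
Proof.
elim=> {M}.
- exists E; first exact: mut_refl.
  exists mid; first by rewrite /mdet /det /=; ring.
  by rewrite (eq_map act_mid) map_id.
- move=> M N _ [E1 r1 [g g1 pg]] MN; exists E1 => //; exists g => //.
  by apply: perm_trans pg; rewrite perm_sym.
- move=> h M h1 _ [E1 r1 [g g1 pg]]; exists E1 => //.
  exists (mmul h g); first by rewrite mdet_mmul h1 g1.
  rewrite (eq_map (act_mmul h g)) (map_comp (act h) (act g)).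
  exact: perm_map.
- move=> u M _ [E1 r1 [g g1 pg]].
  have : u \in map (act g) (psis P E1) by rewrite -(perm_mem pg) mem_head.
  case/mapP => _ /mapP [j _ ->] eu.
  exists (mutate P E1 j false); first exact: mut_step.
  exists g => //; have [p1 p2] := psis_mutate P E1 j.
  have pM : perm_eq M (map (act g) (map (psi P E1) (rem j (enum 'I_r)))).
    rewrite -(perm_cons u) {2}eu; apply: perm_trans pg _.
    exact: (perm_map (act g) p1).
  have := perm_map (act g) p2; rewrite perm_sym; apply: perm_trans.
  rewrite /= act_oppv -eu perm_cons; apply: perm_trans (perm_map (shear u) pM) _.
  rewrite -!map_comp (eq_map (g := act g \o (shear (psi P E1 j) \o psi P E1))) //.
  by move=> i /=; rewrite eu shear_act.
Qed.

(** The columns of [E] are a basis of the lattice, so the determinants of any images are integral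
    combinations of those of [E]. Hence two seeds in the same lattice have the same parity
    invariant. *)
Lemma even_dets_image r (P : 'M[int]_(2, r)) (E E' : 'M[int]_r) :
  is_seed P E -> even_dets (psis P E) -> even_dets (psis P E').
Proof.
move=> [dE _] /even_detsP ev; have Eu : E \in unitmx by rewrite unitmxE.
apply/even_detsP => _ _ /mapP [i _ ->] /mapP [j _ ->].
rewrite /psi (det_image _ _ _ Eu); apply: rpred_sum => k _; apply: rpred_sum => l _.
by apply: dvdz_mull; apply: ev; apply: map_f; rewrite mem_enum.
Qed.

Definition mx_of (g : mat) : 'M[int]_2 :=
  \matrix_(i, j) (let row := if i == ord0 then g.1 else g.2 in
                  if j == ord0 then row.1 else row.2).

Lemma pv_mx_of g (v : Z2) : pv (mx_of g *m v) = act g (pv v).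
Proof.
rewrite /pv /x0 /x1 /act; congr pair; rewrite mxE !big_ord_recl big_ord0 addr0 !mxE /=.
  by congr (_ + _ * v _ _); apply: val_inj.
by congr (_ + _ * v _ _); apply: val_inj.
Qed.

Lemma det_mx_of g : \det (mx_of g) = mdet g.
Proof.
rewrite (expand_det_row _ ord0) !big_ord_recl big_ord0 addr0 /cofactor !det_mx11 !mxE /=.
by rewrite /mdet /det /=; ring.
Qed.

Theorem theorem2p18 (r : nat) (P : 'M[int]_(2, r)) (E E' : 'M[int]_r)
  (B B' : 'cV[int]_r -> 'cV[int]_r -> int) :
  finite_coker P ->
  is_seed P E -> is_seed P E' ->
  IntForm P E B -> IntForm P E' B' ->
  q_Painleve P B -> q_Painleve P B' ->
  isometric P B B' ->
  exists2 E'' : 'M[int]_r, mut_reach P E E'' &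
    exists2 g : 'M[int]_2, \det g = 1 &
      perm_eq [seq P *m col i E' | i <- enum 'I_r]
              [seq g *m (P *m col i E'') | i <- enum 'I_r].
Proof.
move=> cok sE sE' fB fB' qB qB' _.
have [w [L [pL eL]]] := seed_polygon cok sE fB qB.
have [w' [L' [pL' eL']]] := seed_polygon cok sE' fB' qB'.
have mL : meq L (psis P E) := meq_perm (meq_refl L) eL.
have mL' : meq L' (psis P E') := meq_perm (meq_refl L') eL'.
have sz : size L = size L'.
  by rewrite (perm_size eL) (perm_size eL') !size_map.
have ev : even_dets L = even_dets L'.
  rewrite (even_dets_meq mL) (even_dets_meq mL').
  by apply/idP/idP; apply: even_dets_image.
have : meq (psis P E) (psis P E').
  by apply: meq_trans (meq_sym mL) (meq_trans (polygons_meq pL pL' sz ev) mL').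
move/meq_mut_reach => [E'' reach [g g1 pg]]; exists E'' => //.
exists (mx_of g); first by rewrite det_mx_of.
apply: (perm_map_inj pv_inj).
rewrite -[X in perm_eq X _]map_comp -[X in perm_eq _ X]map_comp.
rewrite [X in perm_eq _ X](eq_map (g := act g \o psi P E'')).
  by move: pg; rewrite /psis -map_comp.
by move=> i; rewrite /= pv_mx_of.
Qed.
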